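(* Let $n\ge 4$. There are (exactly) $3\cdot 2^{n-1}$ complex common tangent lines to $2n-2$ spheres in $\mathbb{R}^n$ whose centers are affinely dependent, but which are otherwise general. That is, for all configurations in a nonempty (dense) Zariski-open subset of the set $X$ of all tuples $(c_1,\dots,c_{2n-2},r_1,\dots,r_{2n-2})$ with $r_i>0$ and $c_1,\dots,c_{2n-2}\in\mathbb{R}^n$ affinely dependent, the number of lines in $\mathbb{C}^n$ tangent to all spheres with centers $c_i$ and radii $r_i$ is $3\cdot 2^{n-1}$. Moreover, there is a choice of $2n-2$ spheres in $\mathbb{R}^n$ with affinely dependent centers having (exactly) $2^n$ real common tangent lines.
   Context: Here $2n-2$ points of $\mathbb{R}^n$ are called affinely dependent if they do not affinely span $\mathbb{R}^n$, i.e. if they all lie in some common affine hyperplane. The set $X$ is given the topology induced by the Zariski topology of $\mathbb{R}^{n(2n-2)}\times\mathbb{R}^{2n-2}$. For $x,y\in\mathbb{C}^n$ write $x\cdot y:=\sum_{i=1}^n x_iy_i$ (bilinear, no complex conjugation) and $x^2:=x\cdot x$. A (complex) line in $\mathbb{C}^n$ is given by a point $p\in\mathbb{C}^n$ on it and a direction $v\in\mathbb{C}^n\setminus\{0\}$. The line is tangent to the sphere with center $c\in\mathbb{R}^n$ and radius $r>0$ if it is tangent to the complex quadric hypersurface $(x-c)^2=r^2$, i.e. the quadratic equation $(p+tv-c)^2=r^2$ in $t$ has a solution of multiplicity two, expressed by the vanishing of its discriminant: $[v\cdot(p-c)]^2=v^2\,((p-c)^2-r^2)$. A common tangent line is real if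 $p$ and $v$ can be chosen in $\mathbb{R}^n$; for a real line, tangency to the sphere is equivalent to having Euclidean distance $r$ from $c$. *)

(* Defs.v *)
From HB Require Import structures.
From mathcomp Require Import all_boot all_order all_algebra.
From mathcomp Require Import complex mpoly.
From mathcomp Require Import boolp classical_sets functions cardinality reals.

Set Implicit Arguments.
Unset Strict Implicit.
Unset Printing Implicit Defensive.

Import Order.TTheory GRing.Theory Num.Theory.
Local Open Scope classical_set_scope.
Local Open Scope ring_scope.

Definition dot (F : comNzRingType) (n : nat) (x y : 'rV[F]_n) : F :=
  \sum_(i < n) x 0 i * y 0 i.

Definition toC (R : rcfType) (n : nat) (x : 'rV[R]_n) : 'rV[R[i]]_n :=
  map_mx (real_complex R) x.

(* Configurations of m spheres in R^n: row i of the matrix is the i-th center,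
   entry i of the row vector is the i-th radius. *)
Definition config (R : rcfType) (m n : nat) : Type :=
  ('M[R]_(m, n) * 'rV[R]_m)%type.

Definition center (R : rcfType) (m n : nat) (x : config R m n) (i : 'I_m)
  : 'rV[R]_n := row i x.1.

Definition radius (R : rcfType) (m n : nat) (x : config R m n) (i : 'I_m) : R :=
  x.2 0 i.

Definition coords (R : rcfType) (m n : nat) (x : config R m n)
  : 'rV[R]_(m * n + m) := row_mx (mxvec x.1) x.2.

Definition zariski_closed (R : rcfType) (m n : nat) (Z : set (config R m n))
  : Prop :=
  exists S : set {mpoly R[m * n + m]},
    Z = [set x | forall f, S f -> f.@[coords x 0] = 0].

Definition zariski_open_in (R : rcfType) (m n : nat)
    (X U : set (config R m n)) : Prop :=
  exists2 Z, zariski_closed Z & U = X `\` Z.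

Definition zariski_dense_in (R : rcfType) (m n : nat)
    (X U : set (config R m n)) : Prop :=
  forall V, zariski_open_in X V -> V !=set0 -> (U `&` V) !=set0.

(* All centers lie in a common affine hyperplane a . y = b. *)
Definition affinely_dependent (R : rcfType) (m n : nat) (x : config R m n)
  : Prop :=
  exists a : 'rV[R]_n, exists b : R,
    a != 0 /\ forall i, dot a (center x i) = b.

Definition dependent_configs (R : rcfType) (m n : nat) : set (config R m n) :=
  [set x | (forall i, 0 < radius x i) /\ affinely_dependent x].

Definition cline (R : rcfType) (n : nat) (p v : 'rV[R[i]]_n)
  : set 'rV[R[i]]_n := [set p + t *: v | t in [set: R[i]]].

(* Vanishing of the (quarter) discriminant in t of
   (p + t v - c)^2 = r^2. *)
Definition tangent (R : rcfType) (n : nat) (p v : 'rV[R[i]]_n)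
    (c : 'rV[R]_n) (r : R) : Prop :=
  let q := p - toC c in
  dot v q ^+ 2 = dot v v * (dot q q - (real_complex R r) ^+ 2).

(* Lines are counted as subsets of C^n, not as pairs (p, v). *)
Definition common_tangents (R : rcfType) (m n : nat) (x : config R m n)
  : set (set 'rV[R[i]]_n) :=
  [set L | exists p v, [/\ v != 0, L = cline p v
                         & forall i, tangent p v (center x i) (radius x i)]].

Definition real_line (R : rcfType) (n : nat) : set (set 'rV[R[i]]_n) :=
  [set L | exists p v : 'rV[R]_n, v != 0 /\ L = cline (toC p) (toC v)].

(* Main.v *)
Require Import Defs.
From HB Require Import structures.
From mathcomp Require Import all_boot all_order all_algebra all_field.
From mathcomp Require Import complex mpoly.
From mathcomp Require Import boolp classical_sets functions cardinality reals.
From mathcomp Require Import ring lra zify.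

(** Equations. Let [c_0], ..., [c_(n-1)] be centers spanning the hyperplane that
contains all the centers, put [d_l = c_l - c_0], let [a] be a normal vector of
the hyperplane, and let [e_j] be the other n - 2 centers minus [c_0]. A line
tangent to all spheres is not isotropic; it has a direction [v] with [v.v = 1],
unique up to sign, and a unique point [p] (relative to [c_0]) with [p.v = 0].
Tangency to the first sphere reads [p.p = rho := r_0^2], and tangency to a
sphere with center [d] and radius [r] reads
[2 p.d = d.d - r^2 + rho - (v.d)^2]. Hence the numbers [u_l = v.d_l] determine
the numbers [p.d_l]; the components of [v] and [p] along [a] are determined by
[v.v = 1], up to a sign, and by [p.v = 0]. There remain, in the n - 1 unknowns
[u_l], a quadratic equation for each [e_j] and an equation of degree 6
expressing [p.p = rho]. The equations are even in [u], as changing the sign of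
[v] changes the sign of [u]; fixing the sign of [v.a] therefore gives a
bijection between lines and zeros, as long as [v.a <> 0] ([tangents_param]).
Generically there are [6 * 2 ^ (n - 2) = 3 * 2 ^ (n - 1)] zeros.

Counting zeros. Bezout's theorem is replaced by linear algebra on truncated
ideals [J_i(D)], the combinations of the first [i] equations in which each
product has degree less than [D]. Ranks can only go up near a given system
([rank_open]). On the other hand the rank of [J_(i+1)(D)] is bounded above in
terms of ranks for the first [i] equations, with equality for regular
sequences. So near a regular sequence the ranks are constant
([rank_tideal_stable]). Suppose moreover that the special system has N zeros
and that [J] consists of all the polynomials vanishing on them. Take a linear
form [l] separating these zeros. Then, for all systems near the special one,
the quotient has dimension N and is spanned by the powers of [l], the zeros
are parametrised by the roots of a polynomial [chi] of degree N, and [chi] is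
separable because it is so at the special system ([generic_count]). The
condition [v.a <> 0] is open for the same reason ([generically_nonzero]).

The special system. With [e_l] now the standard basis of the hyperplane, the
centers 0, [e_l], [- e_l] for [l < n - 2] and [(5/2) (e_(n-2) + e_(n-1))], with
suitable radii, lead to the equations
[X_l^2 = s^2], [X Y = 0] and a sextic that has six simple nonzero roots on each
of the two lines [X = 0] and [Y = 0], for all signs of the [X_l = +- s]. That
this system is regular and that its ideal is radical, with control of degrees,
is proved by divisions by polynomials [X_i - t] ([sys_regular],
[pt_radical]).

Density. Two configurations with dependent centers are joined by a path that is
polynomial in a parameter, and on which two nonzero polynomials have a common
point where neither vanishes ([dependent_irreducible]): nonempty open sets
meet.

Real lines. For the centers [+- e_j] in a hyperplane and a common radius with
[r^2 = 1 - 1 / (2 (n - 1))], the tangent lines are explicit: they meet the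
normal line through the origin and either pass through the origin or are
parallel to the hyperplane. There are 2 ^ n of them, all real
([cross_polytope_tangents]). *)

Set Implicit Arguments.
Unset Strict Implicit.
Unset Printing Implicit Defensive.

Import Order.TTheory GRing.Theory Num.Theory.
Local Open Scope ring_scope.

(** * Truncated ideals and their ranks *)

Section FilteredIdeal.
Variables (F : fieldType) (k : nat).
Implicit Types p q g : {mpoly F[k]}.

Lemma msizeM_bound p q a b :
  (msize p <= a)%N -> (msize q <= b.+1)%N -> (msize (p * q) <= a + b)%N.
Proof.
move=> Hp Hq; have [->|p0] := eqVneq p 0; first by rewrite mul0r msize0.
have [->|q0] := eqVneq q 0; first by rewrite mulr0 msize0.
rewrite msizeM // -ltnS prednK; last first.
  by rewrite addn_gt0 !lt0n !msize_poly_eq0 p0.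
by rewrite -addnS leq_add.
Qed.

Lemma msizeD_bound p q a :
  (msize p <= a)%N -> (msize q <= a)%N -> (msize (p + q) <= a)%N.
Proof. by move=> Hp Hq; apply: leq_trans (msizeD_le _ _) _; rewrite geq_max Hp. Qed.

Lemma msizeZ_bound c p a : (msize p <= a)%N -> (msize (c *: p) <= a)%N.
Proof. exact: leq_trans (msizeZ_le _ _). Qed.

Lemma msizeB_bound p q a :
  (msize p <= a)%N -> (msize q <= a)%N -> (msize (p - q) <= a)%N.
Proof.
by move=> hp hq; apply: msizeD_bound => //; rewrite -scaleN1r; apply: msizeZ_bound.
Qed.

Lemma msizeC_bound (c : F) a : (msize (c%:MP : {mpoly F[k]}) <= a.+1)%N.
Proof. by rewrite msizeC; case: (_ == 0). Qed.

Lemma msizeU_bound i : (msize ('X_i : {mpoly F[k]}) <= 2)%N.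
Proof. by rewrite msizeX mdeg1. Qed.

Lemma msize_exp_bound p n : (msize p <= 2)%N -> (msize (p ^+ n) <= n.+1)%N.
Proof.
move=> hp; elim: n => [|n IH]; first by rewrite expr0 msize1.
by rewrite exprSr -addn1; apply: msizeM_bound.
Qed.

(** The truncation in the subtraction is harmless: if [D <= c] then [p = 0]. *)
Lemma msizeM_sub p q D c e :
  (msize p <= D - c)%N -> (msize q <= e.+1)%N -> (msize (p * q) <= D + e - c)%N.
Proof.
move=> hp hq; have [->|p0] := eqVneq p 0; first by rewrite mul0r msize0.
rewrite -addnBAC; first exact: msizeM_bound.
by apply: ltnW; rewrite -subn_gt0; apply: leq_trans hp; rewrite lt0n msize_poly_eq0.
Qed.

Lemma msize_sum_bound (I : Type) (r : seq I) (P : pred I)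
    (G : I -> {mpoly F[k]}) a :
  (forall i, P i -> (msize (G i) <= a)%N) -> (msize (\sum_(i <- r | P i) G i) <= a)%N.
Proof.
move=> H; elim/big_rec: _ => [|i p Pi]; first by rewrite msize0.
by apply: msizeD_bound; apply: H.
Qed.

(** The combinations of [f 0], ..., [f i.-1] without cancellation of high
degrees. The bound [D] is strict: as [msize] is one more than the degree and
[d j] bounds the degree of [f j], the products [g j * f j] have degree less
than [D]. Subtraction being truncated, [g j = 0] as soon as [D <= d j]. *)
Definition tideal (f : nat -> {mpoly F[k]}) (d : nat -> nat) (i D : nat) p :=
  exists2 g : nat -> {mpoly F[k]},
    forall j, (j < i)%N -> (msize (g j) <= D - d j)%N
    & p = \sum_(j < i) g j * f j.

Variables (f : nat -> {mpoly F[k]}) (d : nat -> nat).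
Hypothesis f_size : forall j, (msize (f j) <= (d j).+1)%N.

Lemma tideal0 i D : tideal f d i D 0.
Proof.
by exists (fun=> 0) => [j _|]; rewrite ?msize0 // big1 // => j _; rewrite mul0r.
Qed.

Lemma tidealD i D p q : tideal f d i D p -> tideal f d i D q -> tideal f d i D (p + q).
Proof.
case=> g hg -> [h hh ->]; exists (fun j => g j + h j) => [j ji|].
  by apply: msizeD_bound; [apply: hg|apply: hh].
by rewrite -big_split; apply: eq_bigr => j _; rewrite mulrDl.
Qed.

Lemma tidealM i D e p q :
  tideal f d i D p -> (msize q <= e.+1)%N -> tideal f d i (D + e) (q * p).
Proof.
case=> g hg -> hq; exists (fun j => q * g j) => [j ji|]; last first.
  by rewrite mulr_sumr; apply: eq_bigr => j _; rewrite mulrA.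
by rewrite mulrC; apply: msizeM_sub => //; apply: hg.
Qed.

Lemma tidealM_sub i D e p q :
  tideal f d i e.+1 p -> (msize q <= D - e)%N -> tideal f d i D (q * p).
Proof.
move=> hp hq; have [->|q0] := eqVneq q 0; first by rewrite mul0r; apply: tideal0.
have eD : (e < D)%N.
  by rewrite -subn_gt0; apply: leq_trans hq; rewrite lt0n msize_poly_eq0.
by rewrite -(subnKC eD); apply: tidealM => //; rewrite -subSn // subSS.
Qed.

Lemma tidealZ i D c p : tideal f d i D p -> tideal f d i D (c *: p).
Proof.
move=> Hp; rewrite -mul_mpolyC -[D]addn0; apply: tidealM => //.
exact: msizeC_bound.
Qed.

Lemma tidealB i D p q : tideal f d i D p -> tideal f d i D q -> tideal f d i D (p - q).
Proof. by move=> hp hq; apply: tidealD => //; rewrite -scaleN1r; apply: tidealZ. Qed.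

Lemma tideal_sum i D (I : Type) (r : seq I) (P : pred I) (G : I -> {mpoly F[k]}) :
  (forall i0, P i0 -> tideal f d i D (G i0)) -> tideal f d i D (\sum_(i0 <- r | P i0) G i0).
Proof.
move=> H; elim/big_rec: _ => [|j p Pj]; first exact: tideal0.
by apply: tidealD; apply: H.
Qed.

Lemma tideal_mono i D D' p : (D <= D')%N -> tideal f d i D p -> tideal f d i D' p.
Proof.
move=> DD [g hg ->]; exists g => // j ji.
by apply: leq_trans (hg _ ji) _; apply: leq_sub2r.
Qed.

Lemma tidealS i D p :
  tideal f d i.+1 D p <->
  exists g q, [/\ (msize g <= D - d i)%N, tideal f d i D q & p = g * f i + q].
Proof.
split=> [[g hg ->]|[g [q [hg [h hh ->] ->]]]].
  exists (g i), (\sum_(j < i) g j * f j); split; first exact: hg.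
    by exists g => // j ji; apply: hg; apply: ltnW.
  by rewrite big_ord_recr addrC.
exists (fun j => if j == i then g else h j) => [j|].
  by rewrite ltnS leq_eqVlt; case: eqP => [->|_] //= ; apply: hh.
rewrite big_ord_recr /= eqxx addrC; congr (_ + _).
by apply: eq_bigr => j _; rewrite ltn_eqF.
Qed.

Lemma tideal_gen i D j g : (j < i)%N -> (msize g <= D - d j)%N -> tideal f d i D (g * f j).
Proof.
move=> ji hg; exists (fun l => if l == j then g else 0) => [l _|].
  by case: eqP => [->|] //; rewrite msize0.
rewrite (bigD1 (Ordinal ji)) //= eqxx big1 ?addr0 // => l.
by rewrite -val_eqE /= => /negPf->; rewrite mul0r.
Qed.

Lemma tideal_up i i' D p : (i <= i')%N -> tideal f d i D p -> tideal f d i' D p.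
Proof.
move=> ii [g hg ->]; rewrite -[\sum_(j < i) _]/(\sum_(j < i | true) _).
by apply: tideal_sum => j _; apply: tideal_gen; [apply: leq_trans ii|apply: hg].
Qed.

Lemma tideal_size i D p : tideal f d i D p -> (msize p <= D)%N.
Proof.
case=> g hg ->; apply: msize_sum_bound => j _.
by rewrite -(addnK (d j) D); apply: msizeM_sub => //; apply: hg.
Qed.

Lemma tideal_zero i D p (z : 'I_k -> F) :
  tideal f d i D p -> (forall j, (j < i)%N -> (f j).@[z] = 0) -> p.@[z] = 0.
Proof.
case=> g _ -> H; rewrite raddf_sum big1 // => j _.
by rewrite /= mevalM H ?mulr0.
Qed.

End FilteredIdeal.

Section Encoding.
Variables (F : fieldType) (k B : nat).
Implicit Types p q g : {mpoly F[k]}.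
Notation bm := 'X_{1..k < B}.
Notation q := #|{: bm}|.

Definition mon_of (c : 'I_q) : 'X_{1..k} := bmnm (enum_val c).

(** Polynomials of degree less than [B] as rows of coefficients: a truncated
ideal becomes the row space of a matrix, whose rank depends semicontinuously on
the coefficients of the generators. *)
Definition coef_row p : 'rV[F]_q := \row_c p@_(mon_of c).
Definition row_poly (v : 'rV[F]_q) : {mpoly F[k]} := \sum_c v 0 c *: 'X_[mon_of c].

Lemma coef_row_is_linear : linear coef_row.
Proof. by move=> c p r; apply/rowP => j; rewrite !mxE mcoeffD mcoeffZ. Qed.
HB.instance Definition _ :=
  GRing.isLinear.Build F {mpoly F[k]} 'rV[F]_q _ coef_row coef_row_is_linear.

Lemma row_poly_is_linear : linear row_poly.
Proof.
move=> c p r; rewrite /row_poly scaler_sumr -big_split; apply: eq_bigr => j _.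
by rewrite !mxE scalerDl scalerA.
Qed.
HB.instance Definition _ :=
  GRing.isLinear.Build F 'rV[F]_q {mpoly F[k]} _ row_poly row_poly_is_linear.

Lemma mcoeff_row_poly v c : (row_poly v)@_(mon_of c) = v 0 c.
Proof.
rewrite /row_poly raddf_sum (bigD1 c) //= mcoeffZ mcoeffX eqxx mulr1.
rewrite big1 ?addr0 // => j jc; rewrite mcoeffZ mcoeffX.
by rewrite -bmeqP (inj_eq enum_val_inj) (negPf jc) mulr0.
Qed.

Lemma row_polyK : cancel row_poly coef_row.
Proof. by move=> v; apply/rowP => c; rewrite mxE mcoeff_row_poly. Qed.

Lemma msize_row_poly v : (msize (row_poly v) <= B)%N.
Proof.
apply: msize_sum_bound => c _; apply: msizeZ_bound.
by rewrite msizeX bmdeg.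
Qed.

Lemma coef_rowK p : (msize p <= B)%N -> row_poly (coef_row p) = p.
Proof.
move=> hp; rewrite [RHS](mpolywE hp) /row_poly.
rewrite (reindex_onto (@enum_val _ {: bm}) (@enum_rank bm)) /=; last first.
  by move=> m _; rewrite enum_rankK.
apply: eq_big => c; first by rewrite enum_valK eqxx.
by move=> _; rewrite mxE.
Qed.

Definition lowdeg_mx (D : nat) : 'M[F]_q :=
  \matrix_(c < q, c' < q) ((c == c') && (mdeg (mon_of c) < D)%N)%:R.

Lemma mul_lowdeg_mx D (v : 'rV[F]_q) c :
  (v *m lowdeg_mx D) 0 c = v 0 c * ((mdeg (mon_of c) < D)%N)%:R.
Proof.
rewrite mxE (bigD1 c) //= mxE eqxx /= big1 ?addr0 // => j jc.
by rewrite mxE (negPf jc) mulr0.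
Qed.

Lemma lowdeg_mxP D (v : 'rV[F]_q) : (v <= lowdeg_mx D)%MS <-> (msize (row_poly v) <= D)%N.
Proof.
split=> [/submxP [w ->]|hv].
  apply: msize_sum_bound => c _; rewrite mul_lowdeg_mx.
  case: ltnP => h; rewrite ?mulr0 ?scale0r ?msize0 // mulr1.
  by apply: msizeZ_bound; rewrite msizeX.
apply/submxP; exists v; apply/rowP => c; rewrite mul_lowdeg_mx -mcoeff_row_poly.
case: ltnP => h; rewrite ?mulr1 // mulr0.
by apply: memN_msupp_eq0; apply: msize_mdeg_ge; apply: leq_trans h.
Qed.

Definition mulby_mx p : 'M[F]_q := \matrix_(c < q) coef_row ('X_[mon_of c] * p).

Lemma mul_mulby_mx (v : 'rV[F]_q) p : v *m mulby_mx p = coef_row (row_poly v * p).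
Proof.
rewrite mulmx_sum_row /row_poly mulr_suml linear_sum; apply: eq_bigr => c _.
by rewrite rowK -scalerAl linearZ.
Qed.

(** The rows of [lowdeg_mx (D - d j) *m mulby_mx (f j)] are the multiples of
[f j] by the monomials that are allowed as cofactors, and zero rows in place of
the multiples by other monomials, so that the size of the matrix does not
depend on [D]. *)
Fixpoint tideal_mx (f : nat -> {mpoly F[k]}) (d : nat -> nat) (i D : nat) : 'M[F]_(i * q, q) :=
  match i return 'M[F]_(i * q, q) with
  | 0 => 0
  | i'.+1 => col_mx (lowdeg_mx (D - d i') *m mulby_mx (f i')) (tideal_mx f d i' D)
  end.

Section Fixed.
Variables (f : nat -> {mpoly F[k]}) (d : nat -> nat).
Hypothesis f_size : forall j, (msize (f j) <= (d j).+1)%N.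

Lemma tideal_mxS i D :
  (tideal_mx f d i.+1 D :=: lowdeg_mx (D - d i) *m mulby_mx (f i) + tideal_mx f d i D)%MS.
Proof. by move=> *; apply: eqmx_sym; apply: addsmxE. Qed.

Lemma size_gen D j g : (msize g <= D - d j)%N -> (msize (g * f j) <= D)%N.
Proof. 
move=> hg; apply: (@tideal_size _ _ f d f_size j.+1); exact: tideal_gen.
Qed.

Lemma tideal_mxP i D (v : 'rV[F]_q) : (D <= B)%N -> (v <= tideal_mx f d i D)%MS <->
  tideal f d i D (row_poly v).
Proof.
move=> DB; elim: i v => [|i IH] v.
  split=> [/submxP [w ->]|[g _]]; first by rewrite /= mulmx0 linear0; apply: tideal0.
  by rewrite big_ord0 => v0; rewrite -[v]row_polyK v0 linear0 sub0mx.
rewrite tideal_mxS tidealS; split=> [/sub_addsmxP [[a b] /= ->]|[g [p [hg hp hv]]]].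
  have hw : (a *m lowdeg_mx (D - d i) <= lowdeg_mx (D - d i))%MS by apply: submxMl.
  exists (row_poly (a *m lowdeg_mx (D - d i))), (row_poly (b *m tideal_mx f d i D)); split.
  - exact/lowdeg_mxP.
  - by apply/IH; apply: submxMl.
  rewrite mulmxA mul_mulby_mx linearD /= coef_rowK //.
  by apply: leq_trans DB; apply: size_gen; apply/lowdeg_mxP.
have gB : (msize g <= B)%N.
  by apply: leq_trans hg _; apply: leq_trans DB; apply: leq_subr.
have pB : (msize p <= B)%N by apply: leq_trans DB; apply: tideal_size hp.
rewrite -[v]row_polyK hv linearD /=; apply: addmx_sub_adds.
  rewrite -[g](coef_rowK gB) -mul_mulby_mx; apply: submxMr.
  by apply/lowdeg_mxP; rewrite coef_rowK.
by apply/IH; rewrite coef_rowK.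
Qed.

Lemma tideal_mx_lowdeg i D : (D <= B)%N -> (tideal_mx f d i D <= lowdeg_mx D)%MS.
Proof.
by move=> DB; apply/rV_subP => v /(tideal_mxP _ _ DB) /(tideal_size f_size) h; apply/lowdeg_mxP.
Qed.

(* In the comments below [J_i(D)] is the truncated ideal and [P_D] the space of
   polynomials of degree less than [D]. [C i D] is a complement of
   [J_i(D - d i)] in [P_(D - d i)]. *)
Let C i D := (lowdeg_mx (D - d i) :\: tideal_mx f d i (D - d i))%MS.

Lemma level_sub_le (D i : nat) : (D <= B)%N -> (D - d i <= B)%N.
Proof. by apply: leq_trans; apply: leq_subr. Qed.

(** A cofactor of [f i] in [J_i(D - d i)] contributes an element that is
already in [J_i(D)], so cofactors may be taken in the complement. *)
Lemma tideal_mxS_compl i D : (D <= B)%N ->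
  (tideal_mx f d i.+1 D :=: C i D *m mulby_mx (f i) + tideal_mx f d i D)%MS.
Proof.
move=> DB; have DB' := level_sub_le i DB.
apply/eqmxP/andP; rewrite !tideal_mxS; split.
  rewrite addsmx_sub addsmxSr andbT.
  have h : (lowdeg_mx (D - d i) <= C i D + tideal_mx f d i (D - d i))%MS.
    by rewrite -{1}(addsmx_diff_cap_eq (lowdeg_mx (D - d i)) (tideal_mx f d i (D - d i)));
       apply: addsmxS => //; apply: capmxSr.
  apply: submx_trans (submxMr _ h) _.
  rewrite addsmxMr; apply: addsmxS => //.
  apply/rV_subP => v /submxP [w ->]; rewrite mulmxA mul_mulby_mx.
  set u := w *m _.
  have hu : tideal f d i (D - d i) (row_poly u) by apply/tideal_mxP => //; apply: submxMl.
  apply/tideal_mxP => //.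
  have us : (msize (row_poly u) <= D - d i)%N by apply: tideal_size hu.
  rewrite coef_rowK; last by apply: leq_trans DB; apply: size_gen.
  have [u0|u0] := eqVneq (row_poly u) 0; first by rewrite u0 mul0r; apply: tideal0.
  have Dd : (d i <= D)%N.
    apply: ltnW; rewrite -subn_gt0; apply: leq_trans us.
    by rewrite lt0n msize_poly_eq0.
  by rewrite mulrC -(subnK Dd); apply: tidealM.
by apply: addsmxS => //; apply: submxMr; apply: diffmxSl.
Qed.

Lemma rank_compl i D : (D <= B)%N ->
  (\rank (C i D) + \rank (tideal_mx f d i (D - d i)) = \rank (lowdeg_mx (D - d i)))%N.
Proof.
move=> DB; have DB' := level_sub_le i DB.
rewrite -(mxrank_cap_compl (lowdeg_mx (D - d i)) (tideal_mx f d i (D - d i))) addnC.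
by congr (_ + _)%N; rewrite (capmx_idPr (tideal_mx_lowdeg _ _)).
Qed.

(** The image of [C i D] under multiplication by [f i] has at most the
dimension of [C i D]. *)
Lemma rank_tideal_mxS i D : (D <= B)%N ->
  (\rank (tideal_mx f d i.+1 D) + \rank (tideal_mx f d i (D - d i))
     <= \rank (lowdeg_mx (D - d i)) + \rank (tideal_mx f d i D))%N.
Proof.
move=> DB; rewrite tideal_mxS_compl // -(rank_compl i DB) addnAC leq_add2r.
rewrite addnC; apply: leq_trans (mxrank_adds_leqif _ _) _.
by rewrite addnC leq_add2l mxrankM_maxl.
Qed.

(** If [f i] is not a zero divisor modulo the previous generators, then
multiplication by [f i] is injective on [C i D], and its image meets [J_i(D)]
only in 0. *)
Lemma rank_tideal_mxS_reg i D : (D <= B)%N -> f i != 0 ->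
  (forall g, (msize g <= D - d i)%N -> tideal f d i D (g * f i) ->
     tideal f d i (D - d i) g) ->
  (\rank (tideal_mx f d i.+1 D) + \rank (tideal_mx f d i (D - d i))
     = \rank (lowdeg_mx (D - d i)) + \rank (tideal_mx f d i D))%N.
Proof.
move=> DB fi0 reg; have DB' := level_sub_le i DB.
have key (v : 'rV[F]_q) : (v <= C i D)%MS -> (v *m mulby_mx (f i) <= tideal_mx f d i D)%MS ->
  v = 0.
  move=> vC; rewrite mul_mulby_mx => /(tideal_mxP _ _ DB).
  have hs : (msize (row_poly v) <= D - d i)%N.
    by apply/lowdeg_mxP; apply: submx_trans vC _; apply: diffmxSl.
  rewrite coef_rowK; last by apply: leq_trans DB; apply: size_gen.
  move/(reg _ hs) => /tideal_mxP vJ; apply/eqP; rewrite -submx0.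
  rewrite -(capmx_diff (lowdeg_mx (D - d i)) (tideal_mx f d i (D - d i))) sub_capmx.
  by apply/andP; split=> //; apply: vJ.
rewrite tideal_mxS_compl // -(rank_compl i DB) addnAC; congr (_ + _)%N.
rewrite mxrank_disjoint_sum; last first.
  apply/eqP; rewrite -submx0; apply/rV_subP => v; rewrite sub_capmx => /andP [].
  move=> /submxP [w ->]; rewrite mulmxA => h.
  by rewrite (key _ (submxMl _ _) h) mul0mx sub0mx.
rewrite [X in (X + _)%N = _](_ : _ = \rank (C i D)) //.
rewrite -[RHS](mxrank_mul_ker _ (mulby_mx (f i))).
rewrite [X in (_ + X)%N](_ : _ = 0%N) ?addn0 //.
apply/eqP; rewrite mxrank_eq0 -submx0; apply/rV_subP => v.
rewrite sub_capmx => /andP [vC /sub_kermxP h].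
by rewrite (key v vC) ?sub0mx // h sub0mx.
Qed.

End Fixed.

(** This is the substitute for Bezout's theorem. The hypothesis bounds the ranks
of [f] from below by those of [f0]. By induction on the number of generators,
they are also bounded from above: in [rank_tideal_mxS] the ranks for [j]
generators are already known to agree, and regularity says that
[f0] attains the bound. *)
Lemma rank_tideal_stable (f0 f : nat -> {mpoly F[k]}) (d : nat -> nat) (r : nat) :
  (forall j, (msize (f0 j) <= (d j).+1)%N) ->
  (forall j, (msize (f j) <= (d j).+1)%N) ->
  (forall j, (j < r)%N -> f0 j != 0) ->
  (forall j D g, (j < r)%N -> (msize g <= D - d j)%N -> tideal f0 d j D (g * f0 j) ->
     tideal f0 d j (D - d j) g) ->
  (forall j D, (j <= r)%N -> (D <= B)%N ->
    (\rank (tideal_mx f0 d j D) <= \rank (tideal_mx f d j D))%N) ->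
  forall j D, (j <= r)%N -> (D <= B)%N -> \rank (tideal_mx f d j D) = \rank (tideal_mx f0 d j D).
Proof.
move=> s0 s1 nz reg le; elim=> [|j IH] D jr DB; first by rewrite /= !mxrank0.
apply/eqP; rewrite eqn_leq le // andbT.
have DB' : (D - d j <= B)%N by apply: leq_trans DB; apply: leq_subr.
have := rank_tideal_mxS s1 j DB.
rewrite IH ?(ltnW jr) // IH ?(ltnW jr) // -(rank_tideal_mxS_reg s0 DB) ?nz //.
  by rewrite leq_add2r.
by move=> g; apply: reg.
Qed.

End Encoding.

(** * Properties that hold near a point *)

Section Generic.
Variables (T : Type) (F : fieldType) (A : (T -> F) -> Prop) (x0 : T).
Hypothesis AC : forall c, A (fun=> c).
Hypothesis AD : forall a b, A a -> A b -> A (fun x => a x + b x).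
Hypothesis AM : forall a b, A a -> A b -> A (fun x => a x * b x).

(** [P] holds on a principal open neighbourhood of [x0], the class [A] playing
the role of the polynomial functions on the parameter space [T]. *)
Definition generically (P : T -> Prop) :=
  exists a, [/\ A a, a x0 != 0 & forall x, a x != 0 -> P x].

Lemma eq_class a b : A a -> a =1 b -> A b.
Proof. by move=> Aa ab; rewrite -(funext ab). Qed.

Lemma generically_true (P : T -> Prop) : (forall x, P x) -> generically P.
Proof. by move=> H; exists (fun=> 1); split => //; rewrite oner_eq0. Qed.

Lemma generically_and (P Q : T -> Prop) : generically P -> generically Q ->
  generically (fun x => P x /\ Q x).
Proof.
move=> [a [Aa a0 aP]] [b [Ab b0 bQ]]; exists (fun x => a x * b x); split.
- exact: AM.
- by rewrite mulf_neq0.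
by move=> x; rewrite mulf_eq0 negb_or => /andP [/aP ? /bQ ?].
Qed.

Lemma generically_sub (P Q : T -> Prop) : (forall x, P x -> Q x) -> generically P ->
  generically Q.
Proof. by move=> PQ [a [Aa a0 aP]]; exists a; split => // x /aP /PQ. Qed.

Lemma generically_forall n (P : nat -> T -> Prop) :
  (forall i, (i < n)%N -> generically (P i)) ->
    generically (fun x => forall i, (i < n)%N -> P i x).
Proof.
elim: n => [|n IH] H; first exact: generically_true.
apply: generically_sub (generically_and (H n (ltnSn n)) (IH _)) => [x [h1 h2] i|i hi].
  by rewrite ltnS leq_eqVlt => /orP [/eqP->|/h2].
by apply: H; apply: ltnW.
Qed.

Lemma class_sum (I : Type) (r : seq I) (P : pred I) (a : I -> T -> F) :
  (forall i, A (a i)) -> A (fun x => \sum_(i <- r | P i) a i x).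
Proof.
move=> H; elim: r => [|i r IH].
  by apply: (eq_class (AC 0)) => x; rewrite big_nil.
have [Pi|Pi] := boolP (P i).
  by apply: (eq_class (AD (H i) IH)) => x; rewrite big_cons Pi.
by apply: (eq_class IH) => x; rewrite big_cons (negPf Pi).
Qed.

Lemma class_prod (I : Type) (r : seq I) (P : pred I) (a : I -> T -> F) :
  (forall i, A (a i)) -> A (fun x => \prod_(i <- r | P i) a i x).
Proof.
move=> H; elim: r => [|i r IH].
  by apply: (eq_class (AC 1)) => x; rewrite big_nil.
have [Pi|Pi] := boolP (P i).
  by apply: (eq_class (AM (H i) IH)) => x; rewrite big_cons Pi.
by apply: (eq_class IH) => x; rewrite big_cons (negPf Pi).
Qed.

Definition entries_in p q (M : T -> 'M[F]_(p, q)) := forall i j, A (fun x => M x i j).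

Lemma entries_in_const p q (M : 'M[F]_(p, q)) : entries_in (fun=> M).
Proof. by move=> i j; apply: AC. Qed.

Lemma entries_in_mul p q r (M : T -> 'M[F]_(p, q)) (M' : T -> 'M[F]_(q, r)) :
  entries_in M -> entries_in M' -> entries_in (fun x => M x *m M' x).
Proof.
move=> HM HM' i j.
apply: (@eq_class (fun x => \sum_k M x i k * M' x k j)) => [|x]; last by rewrite mxE.
by apply: class_sum => k; apply: AM.
Qed.

Lemma class_det p (M : T -> 'M[F]_p) : entries_in M -> A (fun x => \det (M x)).
Proof.
move=> HM; apply: class_sum => s; apply: AM; first exact: AC.
by apply: class_prod => i.
Qed.

Lemma entries_in_adj p (M : T -> 'M[F]_p) : entries_in M -> entries_in (fun x => \adj (M x)).
Proof.
move=> HM i j; apply: (@eq_class (fun x => cofactor (M x) j i)) => [|x]; last by rewrite mxE.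
apply: AM; first exact: AC.
apply: class_det => a b.
by apply: (eq_class (HM (lift j a) (lift i b))) => x; rewrite !mxE.
Qed.

Lemma entries_in_col p q r (M : T -> 'M[F]_(p, r)) (M' : T -> 'M[F]_(q, r)) :
  entries_in M -> entries_in M' -> entries_in (fun x => col_mx (M x) (M' x)).
Proof.
move=> HM HM' i j; rewrite -(splitK i); case: (fintype.split i) => l /=.
  by apply: (eq_class (HM l j)) => x; rewrite col_mxEu.
by apply: (eq_class (HM' l j)) => x; rewrite col_mxEd.
Qed.

(** [S1] and [S2] cut an identity block of size [\rank (M x0)] out of [M x0]; the
determinant of the block that they cut out of [M x] is nonzero at [x0], and
wherever it is nonzero the rank has not dropped. *)
Lemma rank_open p q (M : T -> 'M[F]_(p, q)) : entries_in M ->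
  generically (fun x => (\rank (M x0) <= \rank (M x))%N).
Proof.
move=> HM; set r := \rank (M x0).
pose S1 : 'M[F]_(r, p) := pid_mx r *m invmx (col_ebase (M x0)).
pose S2 : 'M[F]_(q, r) := invmx (row_ebase (M x0)) *m pid_mx r.
exists (fun x => \det (S1 *m M x *m S2)); split.
- apply: class_det; apply: entries_in_mul; last exact: entries_in_const.
  by apply: entries_in_mul => //; apply: entries_in_const.
- rewrite (_ : S1 *m _ *m _ = 1%:M) ?det1 ?oner_eq0 //.
  rewrite -(mulmx_ebase (M x0)) -/r /S1 /S2 !mulmxA.
  rewrite (mulmxKV (col_ebase_unit _)) (mulmxK (row_ebase_unit _)).
  rewrite !mul_pid_mx !minnn.
  have rp : (r <= p)%N by exact: rank_leq_row.
  have rq : (r <= q)%N by exact: rank_leq_col.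
  by rewrite (minn_idPr rp) minnn (minn_idPr rq) pid_mx_1.
- move=> x; rewrite -unitfE -unitmxE -row_full_unit => /eqP h.
  rewrite -/r -[X in (X <= _)%N]h.
  by apply: leq_trans (mxrankM_maxl _ _) _; apply: mxrankM_maxr.
Qed.

Section Families.
Variable k : nat.

Definition coefs_in (p : T -> {mpoly F[k]}) := forall m, A (fun x => (p x)@_m).

Lemma coefs_in_const p : coefs_in (fun=> p).
Proof. by move=> m; apply: AC. Qed.

Lemma coefs_inD p q : coefs_in p -> coefs_in q -> coefs_in (fun x => p x + q x).
Proof.
by move=> hp hq m; apply: (eq_class (AD (hp m) (hq m))) => x; rewrite mcoeffD.
Qed.

Lemma coefs_inZ (c : T -> F) p : A c -> coefs_in p -> coefs_in (fun x => c x *: p x).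
Proof.
by move=> hc hp m; apply: (eq_class (AM hc (hp m))) => x; rewrite mcoeffZ.
Qed.

Lemma coefs_inC (c : T -> F) : A c -> coefs_in (fun x => (c x)%:MP).
Proof.
move=> hc m; apply: (eq_class (AM hc (AC (m == 0%MM)%:R))) => x.
by rewrite mcoeffC.
Qed.

Lemma coefs_inM p q : coefs_in p -> coefs_in q -> coefs_in (fun x => p x * q x).
Proof.
move=> hp hq m.
apply: (@eq_class (fun x => \sum_(k : 'X_{1..k < (mdeg m).+1, (mdeg m).+1} | m == (k.1 + k.2)%MM)
      ((p x)@_k.1 * (q x)@_k.2))) => [|x]; last by rewrite mcoeffM.
by apply: class_sum => i; apply: AM.
Qed.

Lemma coefs_inB p q : coefs_in p -> coefs_in q -> coefs_in (fun x => p x - q x).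
Proof.
move=> hp hq m; apply: (eq_class (AD (hp m) (AM (AC (-1)) (hq m)))) => x.
by rewrite mcoeffB mulN1r.
Qed.

Lemma coefs_in_sum (I : Type) (r : seq I) (P : pred I) (p : I -> T -> {mpoly F[k]}) :
  (forall i, coefs_in (p i)) -> coefs_in (fun x => \sum_(i <- r | P i) p i x).
Proof.
move=> H m; apply: (eq_class (class_sum r P (fun i => H i m))) => x.
by rewrite raddf_sum.
Qed.

Lemma coefs_inX p n : coefs_in p -> coefs_in (fun x => p x ^+ n).
Proof.
move=> hp; elim: n => [|n IH]; first exact: coefs_in_const.
by move=> m; apply: (eq_class (coefs_inM hp IH m)) => x; rewrite exprS.
Qed.

Lemma entries_in_tideal_mx B (f : T -> nat -> {mpoly F[k]}) d i D :
  (forall j, coefs_in (fun x => f x j)) -> entries_in (fun x => tideal_mx B (f x) d i D).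
Proof.
move=> hf; elim: i => [|i IH] /=; first exact: entries_in_const.
apply: entries_in_col => //; apply: entries_in_mul; first exact: entries_in_const.
move=> a b.
apply: (eq_class (coefs_inM (coefs_in_const 'X_[mon_of a]) (hf i) (mon_of b))) => x.
by rewrite !mxE.
Qed.

End Families.
End Generic.

(** * The zeros of a system in terms of one linear form *)

Section Shape.
Variables (F : fieldType) (k : nat).
Implicit Types p q g : {mpoly F[k]}.
Variables (l : {mpoly F[k]}) (N : nat).
Hypothesis l_size : (msize l <= 2)%N.

Notation ev := (horner_alg l).

Lemma ev_sum (P : {poly F}) n : (size P <= n)%N -> ev P = \sum_(i < n) P`_i *: l ^+ i.
Proof.
move=> hP; rewrite /horner_alg /horner_morph (@horner_coef_wide _ n); last first.
  by apply: leq_trans hP; apply: size_poly.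
by apply: eq_bigr => i _; rewrite coef_map /= mulr_algl.
Qed.

Lemma msize_form_exp i : (msize (l ^+ i) <= i.+1)%N.
Proof. exact: msize_exp_bound. Qed.

Lemma msize_ev (P : {poly F}) n : (size P <= n)%N -> (msize (ev P) <= n)%N.
Proof.
move=> hP; rewrite (ev_sum hP); apply: msize_sum_bound => i _.
by apply: msizeZ_bound; apply: leq_trans (msize_form_exp _) _.
Qed.

Lemma meval_ev (P : {poly F}) (z : 'I_k -> F) : (ev P).@[z] = P.[l.@[z]].
Proof.
rewrite (ev_sum (leqnn _)) raddf_sum horner_coef; apply: eq_bigr => i _.
by rewrite /= mevalZ rmorphXn.
Qed.

(** Products of a polynomial [q] with the first [N] powers of [l]. With [q = 1]
these are meant to be a basis of the quotient by the ideal; for other [q],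
spanning the quotient means that [q] is invertible in it. *)
Definition powers_mx B q : 'M[F]_(N, #|{: 'X_{1..k < B}}|) :=
  \matrix_(i < N) coef_row B (q * l ^+ i).

Lemma mul_powers_mx B q (c : 'rV[F]_N) :
  c *m powers_mx B q = coef_row B (q * ev (rVpoly c)).
Proof.
rewrite mulmx_sum_row (ev_sum (size_poly _ _)) mulr_sumr linear_sum.
apply: eq_bigr => i _; rewrite rowK /= -scalerAr linearZ.
by rewrite coef_rVpoly_ord.
Qed.

Variables (f : nat -> {mpoly F[k]}) (d : nat -> nat) (r : nat).
Hypothesis f_size : forall j, (msize (f j) <= (d j).+1)%N.

Lemma powers_span B q e p :
  row_full (col_mx (powers_mx B q) (tideal_mx B f d r B)) ->
  (msize q <= e.+1)%N -> (N + e <= B)%N -> (msize p <= B)%N ->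
  exists2 h : {poly F}, (size h <= N)%N & tideal f d r B (p - q * ev h).
Proof.
move=> full hq NB hp.
have /submxP [y] : (coef_row B p <= col_mx (powers_mx B q) (tideal_mx B f d r B))%MS
  by apply: submx_full.
rewrite -[y]hsubmxK mul_row_col mul_powers_mx => E.
exists (rVpoly (lsubmx y)); first exact: size_poly.
have hs : (msize (q * ev (rVpoly (lsubmx y))) <= B)%N.
  rewrite mulrC; apply: leq_trans NB; apply: msizeM_bound => //.
  exact: msize_ev (size_poly _ _).
rewrite -[_ - _](@coef_rowK _ _ B); last first.
  exact: msizeB_bound.
by apply/tideal_mxP => //; rewrite linearB /= E addrC addrA addNr add0r submxMl.
Qed.

(* At level [D1] the powers of [l] span the quotient, at level [D2] they are
   moreover independent. Substituting congruences of level [D1] into equations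
   of degree at most [e], then dividing by a polynomial of level [D1], must not
   exceed [D2]. *)
Variables (D1 D2 e : nat).
Hypothesis full1 : row_full (col_mx (powers_mx D1 1) (tideal_mx D1 f d r D1)).
Hypothesis full2 : row_full (col_mx (powers_mx D2 1) (tideal_mx D2 f d r D2)).
Hypothesis rk2 : (\rank (tideal_mx D2 f d r D2) + N <= #|{: 'X_{1..k < D2}}|)%N.
Hypothesis ND1 : (N.+1 <= D1)%N.
Hypothesis N0 : (0 < N)%N.
Hypothesis e2 : (2 <= e)%N.
Hypothesis de : forall j, (j < r)%N -> (d j <= e)%N.
Hypothesis D12 : (D1 * e + D1 <= D2)%N.

(** The [N] rows and the truncated ideal span a space whose dimension is at
least the sum of [N] and of the rank of the ideal, so the sum is direct. *)
Lemma powers_independent (P : {poly F}) : (size P <= N)%N -> tideal f d r D2 (ev P) -> P = 0.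
Proof.
move=> hP hJ.
have D2N : (N <= D2)%N.
  by apply: leq_trans D12; apply: leq_trans (leq_addl _ _); apply: ltnW.
have hc : poly_rV P *m powers_mx D2 1 = coef_row D2 (ev P)
  by rewrite mul_powers_mx mul1r poly_rV_K.
have h0 : (poly_rV P : 'rV_N) *m powers_mx D2 1 == 0.
  have cap0 : (powers_mx D2 1 :&: tideal_mx D2 f d r D2)%MS = 0.
    apply/eqP; rewrite -mxrank_eq0 -leqn0.
    have := mxrank_sum_cap (powers_mx D2 1) (tideal_mx D2 f d r D2).
    have -> : \rank (powers_mx D2 1 + tideal_mx D2 f d r D2)%MS = #|{: 'X_{1..k < D2}}|.
      by rewrite (addsmxE (powers_mx D2 1) _); apply/eqP.
    move=> E; rewrite -(leq_add2l #|{: 'X_{1..k < D2}}|) E addn0.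
    by apply: leq_trans rk2; rewrite addnC leq_add2l rank_leq_row.
  rewrite -submx0 -cap0 sub_capmx submxMl hc; apply/tideal_mxP => //.
  by rewrite coef_rowK //; apply: msize_ev; apply: leq_trans D2N.
have free : row_free (powers_mx D2 1).
  rewrite /row_free eqn_leq rank_leq_row /=.
  rewrite -(leq_add2l (\rank (tideal_mx D2 f d r D2))); apply: leq_trans rk2 _.
  apply: leq_trans (_ : (\rank (col_mx (powers_mx D2 1) (tideal_mx D2 f d r D2)) <= _)%N).
    by rewrite (eqP full2).
  by rewrite -(addsmxE (powers_mx D2 1) _) addnC (mxrank_adds_leqif _ _).1.
have : (poly_rV P : 'rV_N) = 0.
  by apply: (row_free_inj free); rewrite mul0mx; apply/eqP.
by move/(congr1 rVpoly); rewrite poly_rV_K // linear0.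
Qed.

(** [chi] acts as the minimal polynomial of [l] modulo the ideal: the remainder
of [P] modulo [chi] also lies in the ideal, and it is too short to be nonzero
there. *)
Lemma ev_dvd (chi P : {poly F}) : chi \is monic -> size chi = N.+1 ->
  tideal f d r D1 (ev chi) -> (size P + D1 <= D2)%N -> tideal f d r D2 (ev P) ->
  chi %| P.
Proof.
move=> mon sz chiJ sP PJ; rewrite /dvdp; apply/eqP; apply: powers_independent.
  by rewrite -ltnS -sz ltn_modpN0 // -size_poly_eq0 sz.
have -> : P %% chi = P - (P %/ chi) * chi by rewrite {2}(divp_eq P chi) addrC addKr.
rewrite rmorphB rmorphM /=; apply: tidealB => //.
have [->|q0] := eqVneq (P %/ chi) 0; first by rewrite rmorph0 mul0r; apply: tideal0.
apply: (@tideal_mono _ _ _ _ _ (D1 + size (P %/ chi))).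
  by apply: leq_trans sP; rewrite addnC leq_add2r leq_divp.
by apply: tidealM => //; apply: leqW; apply: msize_ev.
Qed.

Variable h : 'I_k -> {poly F}.
Hypothesis h_size : forall i, (size (h i) <= N)%N.
Hypothesis h_J : forall i, tideal f d r D1 ('X_i - ev (h i)).

Definition subst_poly p : {poly F} := mmap (@polyC F) h p.

Lemma horner_subst_poly p c : (subst_poly p).[c] = p.@[fun i => (h i).[c]].
Proof.
rewrite /subst_poly /meval /mmap -horner_evalE rmorph_sum; apply: eq_bigr => m _.
rewrite rmorphM /= /horner_eval hornerC; congr (_ * _).
rewrite /mmap1 -horner_evalE rmorph_prod; apply: eq_bigr => i _.
by rewrite rmorphXn.
Qed.

(** Congruence at a level proportional to [a]. The sizes are recorded because
multiplying by a polynomial raises the level by its degree; with them,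
congruences multiply like degrees add. *)
Definition tcong (a : nat) p q := [/\ tideal f d r (D1 * a) (p - q),
  (msize p <= (D1 * a).+1)%N & (msize q <= (D1 * a).+1)%N].

Lemma tcongM a b p q p' q' : tcong a p q -> tcong b p' q' -> tcong (a + b) (p * p') (q * q').
Proof.
move=> [J1 s1 t1] [J2 s2 t2]; split.
- have -> : p * p' - q * q' = p' * (p - q) + q * (p' - q').
    by rewrite mulrBr mulrBr (mulrC p') (mulrC p' q) addrA subrK.
  rewrite mulnDr; apply: tidealD; first exact: tidealM.
  by rewrite addnC; apply: tidealM.
- by rewrite mulnDr -addSn; apply: msizeM_bound.
- by rewrite mulnDr -addSn; apply: msizeM_bound.
Qed.

Lemma tcong1 : tcong 0 1 1.
Proof. by split; rewrite ?subrr ?msize1 //; apply: tideal0. Qed.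

Lemma tcongX a p q n : tcong a p q -> tcong (a * n) (p ^+ n) (q ^+ n).
Proof.
move=> H; elim: n => [|n IH]; first by rewrite muln0 !expr0; apply: tcong1.
by rewrite mulnS !exprS; apply: tcongM.
Qed.

Lemma tcong_shape i : tcong 1 'X_i (ev (h i)).
Proof.
split; rewrite muln1 //.
  by rewrite msizeX mdeg1 ltnS (leq_trans _ ND1).
by apply: msize_ev; apply: leq_trans (h_size i) _; rewrite ltnW // ltnW.
Qed.

Lemma ev_subst_poly p a : (msize p <= a.+1)%N -> tideal f d r (D1 * a) (p - ev (subst_poly p)).
Proof.
move=> hp.
have E m : ev (mmap1 h m) = \prod_i ev (h i) ^+ m i.
  by rewrite /mmap1 rmorph_prod; apply: eq_bigr => i _; rewrite rmorphXn.
have -> : p - ev (subst_poly p) = \sum_(m <- msupp p) p@_m *: ('X_[m] - \prod_i ev (h i) ^+ m i).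
  rewrite {1}[p]mpolyE /subst_poly /mmap rmorph_sum -sumrB; apply: eq_bigr => m _.
  by rewrite rmorphM /= horner_algC E mulr_algl scalerBr.
rewrite big_seq_cond; apply: tideal_sum => m; rewrite andbT => /msize_mdeg_lt hm.
apply: tidealZ.
apply: (@tideal_mono _ _ _ _ _ (D1 * mdeg m)).
  by rewrite leq_mul2l -ltnS (leq_trans hm hp) orbT.
rewrite mpolyXE_id mdegE.
have : tcong (\sum_i m i) (\prod_i 'X_i ^+ m i) (\prod_i ev (h i) ^+ m i).
  elim/big_rec3: _ => [|i P Q n _ IH]; first exact: tcong1.
  by apply: tcongM IH; have := tcongX (m i) (tcong_shape i); rewrite mul1n.
by case.
Qed.

(** The case [a = 0] is apart because nonzero constants have size 1. *)
Lemma size_subst_poly p a : (msize p <= a.+1)%N -> (size (subst_poly p) <= D1 * a)%N \/ a = 0%N.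
Proof.
case: a => [|a] hp; [by right|left].
apply: leq_trans (size_sum _ _ _) _; apply/bigmax_leqP_seq => m hm _.
have [->|c0] := eqVneq (p@_m) 0; first by rewrite mul0r size_poly0.
rewrite mul_polyC size_scale //.
have : (size (mmap1 h m) <= (\sum_i N * m i).+1)%N.
  rewrite /mmap1; elim/big_rec2: _ => [|i n P _ IH]; first by rewrite size_poly1.
  apply: leq_trans (size_polyMleq _ _) _.
  have H : (size (h i ^+ m i) <= (N * m i).+1)%N.
    elim: (m i) => [|u IHu]; first by rewrite expr0 size_poly1.
    rewrite exprS; apply: leq_trans (size_polyMleq _ _) _.
    by rewrite mulnS; move: IHu (h_size i); lia.
  by rewrite -subn1 leq_subLR; apply: leq_trans (leq_add H IH) _; rewrite addSn addnS.
rewrite -big_distrr -mdegE => H; apply: leq_trans H _.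
have hm' := leq_trans (msize_mdeg_lt hm) hp.
apply: leq_trans (_ : (N * a.+1).+1 <= _)%N; first by rewrite ltnS leq_mul2l; apply/orP; right;
  rewrite -ltnS.
apply: leq_trans (_ : (N * a.+1 + a.+1) <= _)%N; first by rewrite addnS ltnS leq_addr.
by rewrite -mulSnr leq_mul2r ND1 orbT.
Qed.

Definition common_zero (z : 'I_k -> F) := forall j, (j < r)%N -> (f j).@[z] = 0.

(** A zero is determined by the value of [l] there: the congruences that express
the variables as polynomials in [l] become equalities on zeros. *)
Lemma zero_shape z i : common_zero z -> z i = (h i).[l.@[z]].
Proof.
move=> hz; have := tideal_zero (h_J i) hz.
by rewrite mevalB mevalXU meval_ev => /eqP; rewrite subr_eq0 => /eqP.
Qed.

Variable chi : {poly F}.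
Hypothesis chi_monic : chi \is monic.
Hypothesis chi_size : size chi = N.+1.
Hypothesis chi_J : tideal f d r D1 (ev chi).

Lemma zero_root z : common_zero z -> root chi l.@[z].
Proof. by move=> hz; apply/eqP; rewrite -meval_ev; apply: tideal_zero chi_J hz. Qed.

(** Conversely every root of [chi] comes from a zero. Substituting the [h i] into
[f j] gives a polynomial in one variable whose value at [l] is in the ideal,
hence a multiple of [chi] by [ev_dvd]. The same argument for
[subst_poly l - 'X] shows that the value of [l] at the zero is the given root. *)
Lemma root_zero c : root chi c ->
  common_zero (fun i => (h i).[c]) /\ l.@[fun i => (h i).[c]] = c.
Proof.
move=> rc; have r0 : chi.[c] = 0 by apply/eqP.
have key p : (size (subst_poly p) <= D1 * e)%N -> tideal f d r D2 (ev (subst_poly p)) ->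
    (subst_poly p).[c] = 0.
  move=> sp /(ev_dvd chi_monic chi_size chi_J) H.
  have /dvdpP [q ->] : chi %| subst_poly p by apply: H; apply: leq_trans D12; rewrite leq_add2r.
  by rewrite hornerM r0 mulr0.
have fe j : (j < r)%N -> (msize (f j) <= e.+1)%N.
  by move=> jr; apply: leq_trans (f_size j) _; rewrite ltnS de.
have e0 : e <> 0%N by case: (e) e2.
have D1e : (D1 * e <= D2)%N by apply: leq_trans D12; apply: leq_addr.
split=> [j jr|].
  rewrite -horner_subst_poly; apply: key.
    by case: (size_subst_poly (fe _ jr)).
  have -> : ev (subst_poly (f j)) = f j - (f j - ev (subst_poly (f j))) by rewrite subKr.
  apply: tidealB => //.
    rewrite -[f j]mul1r; apply: tideal_gen => //; rewrite msize1 subn_gt0.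
    by apply: leq_ltn_trans (de jr) _; apply: leq_trans D12;
      rewrite -mulnSr leq_pmull // (leq_trans _ ND1).
  by apply: tideal_mono D1e _; apply: ev_subst_poly; exact: fe.
have s1 : (msize l <= e.+1)%N by apply: leq_trans l_size _; apply: ltnW.
have : chi %| subst_poly l - 'X.
  apply: (ev_dvd chi_monic chi_size chi_J).
    apply: leq_trans D12; rewrite leq_add2r.
    apply: leq_trans (size_polyD _ _) _; rewrite geq_max size_polyN size_polyX.
    case: (size_subst_poly s1) => // ->; rewrite /=.
    by apply: leq_trans e2 _; rewrite leq_pmull // (leq_trans _ ND1).
  rewrite rmorphB /= horner_algX -opprB.
  rewrite -scaleN1r; apply: tidealZ; apply: tideal_mono D1e _; exact: ev_subst_poly.
case/dvdpP => q /(congr1 (horner^~ c)).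
by rewrite !hornerE r0 mulr0 horner_subst_poly => /eqP; rewrite subr_eq0 => /eqP.
Qed.

End Shape.

(** * The number of zeros near a special system *)

Lemma poly_nonroot (F : idomainType) (e : nat -> F) (p : {poly F}) :
  injective e -> p != 0 -> exists c : nat, p.[e c] != 0.
Proof.
move=> einj p0; apply: contrapT => /forallNP h.
have := @max_poly_roots _ p [seq e c | c <- iota 0 (size p)] p0.
rewrite size_map size_iota ltnn => H; suff : false by [].
apply: H; last by rewrite map_inj_uniq ?iota_uniq.
apply/allP => z /mapP [c _ ->]; rewrite /root; have := h c.
by move/negP; rewrite negbK.
Qed.

(** The form with coefficients 1, c, c^2, ... separates two given points unless
[c] is a root of a certain nonzero polynomial; there are finitely many pairs
of points and infinitely many [c]. *)
Lemma separating_form (F : numFieldType) (k : nat) (I : finType) (pt : I -> 'I_k -> F) :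
  (forall i i', pt i =1 pt i' -> i = i') ->
  exists2 l : {mpoly F[k]}, (msize l <= 2)%N & injective (fun i => l.@[pt i]).
Proof.
move=> inj.
pose P i i' : {poly F} := \sum_(j < k) (pt i j - pt i' j) *: 'X^j.
have P0 i i' : i != i' -> P i i' != 0.
  apply: contraNneq => Pii; apply/eqP/inj => j; apply/eqP; rewrite -subr_eq0; apply/eqP.
  have := congr1 (fun p : {poly F} => p`_j) Pii; rewrite coef0 coef_sum (bigD1 j) //=.
  rewrite coefZ coefXn eqxx mulr1 big1 ?addr0 // => u uj.
  by rewrite coefZ coefXn eq_sym -val_eqE in uj *; rewrite (negPf uj) mulr0.
have natr_inj : injective (fun c : nat => c%:R : F).
  by move=> a b /eqP; rewrite eqr_nat => /eqP.
have [|c hc] := @poly_nonroot _ _ (\prod_i \prod_(i' | i' != i) P i i') natr_inj.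
  by apply/prodf_neq0 => i _; apply/prodf_neq0 => i' h; rewrite P0 // eq_sym.
pose l : {mpoly F[k]} := \sum_(j < k) c%:R ^+ j *: 'X_j.
have lE i : l.@[pt i] = \sum_(j < k) c%:R ^+ j * pt i j.
  rewrite /l raddf_sum; apply: eq_bigr => j _ /=; by rewrite mevalZ mevalXU.
exists l.
  by apply: msize_sum_bound => j _; apply: msizeZ_bound; rewrite msizeX mdeg1.
move=> i i' /= /eqP; rewrite -subr_eq0 !lE -sumrB => E; apply/eqP; apply: contraTT E => ii.
have : (P i i').[c%:R] != 0.
  move: hc; rewrite horner_prod => /prodf_neq0 /(_ i isT).
  by rewrite horner_prod => /prodf_neq0 /(_ i'); apply; rewrite eq_sym.
rewrite horner_sum; congr (_ != _); apply: eq_bigr => j _.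
by rewrite hornerZ hornerXn mulrC mulrBr.
Qed.

Lemma interpolation (F : fieldType) (I : finType) (lam y : I -> F) :
  injective lam ->
  exists2 a : {poly F}, (size a <= #|I|)%N & forall i, a.[lam i] = y i.
Proof.
move=> inj.
pose L i : {poly F} := \prod_(j in predC1 i) ('X - (lam j)%:P).
have Li i : (L i).[lam i] != 0.
  rewrite horner_prod prodf_seq_neq0; apply/allP => j _; apply/implyP; rewrite inE => ji.
  by rewrite !hornerE subr_eq0 (inj_eq inj) eq_sym.
have Lj i j : j != i -> (L i).[lam j] = 0.
  by move=> ji; rewrite horner_prod (bigD1 j) //= !hornerE subrr mul0r.
exists (\sum_i (y i / (L i).[lam i]) *: L i).
  apply: leq_trans (size_sum _ _ _) _; apply/bigmax_leqP => i _.
  apply: leq_trans (size_scale_leq _ _) _.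
  by rewrite /L -big_enum size_prod_XsubC -cardE cardC1 prednK //; apply/card_gt0P; exists i.
move=> i; rewrite horner_sum (bigD1 i) //= hornerZ divfK // big1 ?addr0 // => j ji.
by rewrite hornerZ (Lj j i) ?mulr0 // eq_sym.
Qed.

Section Count.
Variables (T : Type) (F : closedFieldType) (A : (T -> F) -> Prop) (x0 : T).
Hypothesis AC : forall c, A (fun=> c).
Hypothesis AD : forall a b, A a -> A b -> A (fun x => a x + b x).
Hypothesis AM : forall a b, A a -> A b -> A (fun x => a x * b x).
Variables (k r e : nat) (d : nat -> nat) (f : T -> nat -> {mpoly F[k]}).
Hypothesis f_size : forall x j, (msize (f x j) <= (d j).+1)%N.
Hypothesis f_coefs : forall j, coefs_in A (fun x => f x j).
Hypothesis e2 : (2 <= e)%N.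
Hypothesis de : forall j, (j < r)%N -> (d j <= e)%N.
Hypothesis f0_neq0 : forall j, (j < r)%N -> f x0 j != 0.
Hypothesis f0_reg : forall j D g, (j < r)%N -> (msize g <= D - d j)%N ->
  tideal (f x0) d j D (g * f x0 j) -> tideal (f x0) d j (D - d j) g.
Variables (I : finType) (pt : I -> 'I_k -> F) (l : {mpoly F[k]}).
Hypothesis l_size : (msize l <= 2)%N.
Hypothesis l_inj : injective (fun i => l.@[pt i]).
Hypothesis pt_sol : forall i, common_zero (f x0) r (pt i).
Hypothesis rad : forall D g, (msize g <= D)%N -> (forall i, g.@[pt i] = 0) ->
  tideal (f x0) d r D g.
Hypothesis I0 : (0 < #|I|)%N.

Notation N := #|I|.
Notation ev := (horner_alg l).
Notation generically := (generically A x0).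

(** Interpolation at the points, which are separated by [l]: the quotient of
[row_poly v] by [q] agrees on the points with a polynomial in [l], and the
difference is in the ideal by [rad]. *)
Lemma special_full B q e' : (msize q <= e'.+1)%N -> (N + e' <= B)%N ->
  (forall i, q.@[pt i] != 0) ->
  row_full (col_mx (powers_mx l N B q) (tideal_mx B (f x0) d r B)).
Proof.
move=> hq NB q0; rewrite -sub1mx; apply/rV_subP => v _.
have [a sa ha] := interpolation (fun i => (row_poly v).@[pt i] / q.@[pt i]) l_inj.
have hs : (msize (q * ev a) <= B)%N.
  by rewrite mulrC; apply: leq_trans NB; apply: msizeM_bound => //; apply: msize_ev.
have vJ : tideal (f x0) d r B (row_poly v - q * ev a).
  apply: rad => [|i].
    by apply: msizeB_bound => //; apply: msize_row_poly.
  by rewrite mevalB mevalM meval_ev // ha mulrC divfK ?subrr.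
rewrite -(addsmxE (powers_mx l N B q) _).
rewrite -[v]row_polyK -[row_poly v](subrK (q * ev a)) linearD /= addrC.
apply: addmx_sub_adds.
  by rewrite -[a](poly_rV_K sa) -mul_powers_mx submxMl.
apply/tideal_mxP => //; rewrite coef_rowK //; exact: tideal_size vJ.
Qed.

(** A polynomial in [l] of size at most [N] that lies in the ideal vanishes at
the [N] values of [l] on the points, so it is 0. *)
Lemma special_rank B : (N <= B)%N ->
  (\rank (tideal_mx B (f x0) d r B) + N <= #|{: 'X_{1..k < B}}|)%N.
Proof.
move=> NB.
have key (c : 'rV[F]_N) : (c *m powers_mx l N B 1 <= tideal_mx B (f x0) d r B)%MS -> c = 0.
  rewrite mul_powers_mx mul1r => /(tideal_mxP (f_size x0) _ _ (leqnn B)).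
  have sc : (size (rVpoly c) <= N)%N by apply: size_poly.
  rewrite coef_rowK; last by apply: leq_trans NB; apply: msize_ev.
  move=> cJ; have hr i : root (rVpoly c) l.@[pt i].
    by apply/eqP; rewrite -meval_ev //; apply: tideal_zero cJ (pt_sol i).
  suff /(congr1 (@poly_rV _ N)) : rVpoly c = 0 by rewrite rVpolyK linear0.
  apply/eqP; apply: contraTT sc => c0; rewrite -ltnNge.
  have := @max_poly_roots _ _ [seq l.@[pt i] | i <- enum I] c0.
  rewrite size_map -cardE; apply.
    by apply/allP => z /mapP [i _ ->].
  by rewrite map_inj_uniq ?enum_uniq.
have free : row_free (powers_mx l N B 1).
  rewrite -kermx_eq0 -submx0; apply/rV_subP => c /sub_kermxP h.
  by rewrite (key c) ?sub0mx // h sub0mx.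
rewrite -[X in (_ + X)%N](eqP free) -mxrank_disjoint_sum ?rank_leq_col //.
apply/eqP; rewrite -submx0; apply/rV_subP => v; rewrite sub_capmx => /andP [vJ].
move=> /submxP [c vc]; rewrite vc in vJ *.
by rewrite (key c vJ) mul0mx sub0mx.
Qed.

Section Nonvanishing.
Variables (Q : T -> {mpoly F[k]}) (e' : nat).
Hypothesis Q_coefs : coefs_in A Q.
Hypothesis Q_size : forall x, (msize (Q x) <= e'.+1)%N.
Hypothesis Q_special_neq0 : forall i, (Q x0).@[pt i] != 0.

Lemma entries_in_powers_mx B : entries_in A (fun x => powers_mx l N B (Q x)).
Proof.
move=> i c; apply: (eq_class (coefs_inM AC AD AM Q_coefs (coefs_in_const AC (l ^+ i))
  (mon_of c))) => x.
by rewrite !mxE.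
Qed.

Lemma generically_full B : (N + e' <= B)%N ->
  generically (fun x => row_full (col_mx (powers_mx l N B (Q x)) (tideal_mx B (f x) d r B))).
Proof.
move=> NB; have MA : entries_in A (fun x =>
  col_mx (powers_mx l N B (Q x)) (tideal_mx B (f x) d r B)).
  by apply: entries_in_col; [apply: entries_in_powers_mx|apply: entries_in_tideal_mx].
have := rank_open x0 AC AD AM MA; apply: generically_sub => x.
rewrite (eqP (special_full (Q_size x0) NB Q_special_neq0)) => h.
by rewrite /row_full eqn_leq rank_leq_col.
Qed.

(** Where the products of [Q x] with the powers of [l] span the quotient, 1 is a
multiple of [Q x] modulo the ideal, so [Q x] has no zero in common with the
system. Spanning is a rank condition, hence open. *)
Lemma generically_nonzero : generically (fun x => forall z, common_zero (f x) r z ->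
  (Q x).@[z] != 0).
Proof.
apply: generically_sub (generically_full (leqnn (N + e'))) => x full z hz.
have [|h _ hJ] := @powers_span _ _ _ _ l_size _ _ _ (f_size x) _ _ e' 1 full (Q_size x) (leqnn _).
  by rewrite msize1 addn_gt0 I0.
have := tideal_zero hJ hz; rewrite mevalB meval1 mevalM => /eqP.
apply: contraTneq => ->; by rewrite mul0r subr0 oner_eq0.
Qed.

End Nonvanishing.

(** The first level containing [l ^+ N]. *)
Definition level1 := N.+1.
(** Equations of degree at most [e] in which polynomials of level [level1] have
been substituted can be divided by [chi] at this level. *)
Definition level2 := (level1 * e + level1)%N.

(* The relation expressing [l ^+ N] in the lower powers of [l], with
   coefficients depending polynomially on [x] thanks to Cramer's rule: [S] is a
   fixed left inverse of [M x0], so that [Bx x] is square and [Bx x0 = 1]; the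
   row [y x] satisfies [y x *m M x = \det (Bx x) *: coef_row level1 (l ^+ N)].
   Hence [chi x] is [\det (Bx x)] times a monic polynomial of degree [N]. *)
Let M x := col_mx (powers_mx l N level1 1) (tideal_mx level1 (f x) d r level1).
Let S := pinvmx (M x0).
Let Bx x := S *m M x.
Let y x := coef_row level1 (l ^+ N) *m \adj (Bx x) *m S.
Let chi x : {poly F} := \det (Bx x) *: 'X^N - rVpoly (lsubmx (y x)).

Lemma special_full1 : row_full (M x0).
Proof.
apply: (@special_full _ _ 0) => [||i]; first by rewrite msize1.
  by rewrite addn0.
by rewrite meval1 oner_eq0.
Qed.

Lemma entries_in_M : entries_in A M.
Proof.
apply: entries_in_col; last exact: entries_in_tideal_mx.
by apply: (@entries_in_powers_mx (fun=> 1)) => //; apply: coefs_in_const.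
Qed.

Lemma entries_in_Bx : entries_in A Bx.
Proof. by apply: entries_in_mul => //; apply: entries_in_M. Qed.

Lemma entries_in_y : entries_in A y.
Proof.
apply: entries_in_mul => //.
apply: entries_in_mul => //.
by apply: entries_in_adj => //; apply: entries_in_Bx.
Qed.

Lemma chi_J x : tideal (f x) d r level1 (ev (chi x)).
Proof.
have lN : (msize (l ^+ N) <= level1)%N by apply: msize_form_exp.
have hs : (msize (ev (rVpoly (lsubmx (y x)))) <= level1)%N.
  by apply: leqW; apply: msize_ev => //; apply: size_poly.
have E : y x *m M x = \det (Bx x) *: coef_row level1 (l ^+ N).
  by rewrite /y -(mulmxA _ S (M x)) -(mulmxA _ _ (S *m M x)) mul_adj_mx mul_mx_scalar.
rewrite /chi rmorphB /= linearZ /= rmorphXn /= horner_algX mulr_algl.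
rewrite -[_ - _](@coef_rowK _ _ level1); last first.
  by apply: msizeB_bound => //; apply: msizeZ_bound.
apply/tideal_mxP => //; rewrite linearB linearZ /= -E -[y x]hsubmxK /M mul_row_col.
by rewrite row_mxKl mul_powers_mx mul1r addrC addKr submxMl.
Qed.

Lemma chi_size x : \det (Bx x) != 0 -> size (chi x) = N.+1 /\ lead_coef (chi x) = \det (Bx x).
Proof.
move=> d0.
have sz : size (\det (Bx x) *: 'X^N : {poly F}) = N.+1 by rewrite size_scale // size_polyXn.
have lt : (size (- rVpoly (lsubmx (y x))) < size (\det (Bx x) *: 'X^N : {poly F}))%N.
  by rewrite size_polyN sz ltnS; apply: size_poly.
by rewrite /chi size_polyDl // lead_coefDl // lead_coefZ lead_coefXn mulr1.
Qed.

Let Q x := ev ((chi x)^`()).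

Lemma size_dchi x : (size (chi x)^`() <= N)%N.
Proof.
have : (size (chi x) <= N.+1)%N.
  apply: leq_trans (size_polyD _ _) _; rewrite geq_max size_polyN.
  rewrite (leq_trans (size_scale_leq _ _)) ?size_polyXn //=.
  by apply: leqW; apply: size_poly.
have [->|c0] := eqVneq (chi x) 0; first by rewrite deriv0 size_poly0.
by move=> h; rewrite -ltnS; apply: leq_trans (lt_size_deriv c0) h.
Qed.

Lemma Q_coefs : coefs_in A Q.
Proof.
move=> m; apply: (@eq_class _ _ _ (fun x => (\sum_(i < N) ((chi x)^`())`_i *: l ^+ i)@_m));
  last first.
  by move=> x; rewrite -ev_sum //; apply: size_dchi.
move: m; apply: coefs_in_sum => // i; apply: coefs_inZ => //.
apply: (@eq_class _ _ _ (fun x => (\det (Bx x) * (i.+1 == N)%:R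
   + (-1) * (rVpoly (lsubmx (y x)))`_i.+1) * (i.+1)%:R)); last first.
  by move=> x; rewrite coef_deriv coefB coefZ coefXn mulN1r mulr_natr.
apply: AM => //; apply: AD.
  by apply: AM => //; apply: class_det => //; apply: entries_in_Bx.
apply: AM => //; have [h|h] := ltnP i.+1 N.
  apply: (eq_class (entries_in_y 0 (lshift _ (Ordinal h)))) => x.
  by rewrite -[i.+1]/(nat_of_ord (Ordinal h)) coef_rVpoly_ord [in RHS]mxE.
by apply: (eq_class (AC 0)) => x; rewrite nth_default // (leq_trans _ h) // size_poly.
Qed.

Lemma detBx0 : \det (Bx x0) = 1.
Proof. by rewrite /Bx /S mulVpmx ?det1 // special_full1. Qed.

(** At the special parameter [chi] has degree [N] and vanishes at the [N]
distinct values of [l] on the points, so it is separable. *)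
Lemma dchi_special_neq0 i : (Q x0).@[pt i] != 0.
Proof.
have d0 : \det (Bx x0) != 0 by rewrite detBx0 oner_eq0.
have [sz lc] := chi_size d0.
rewrite meval_ev //.
have hr j : root (chi x0) l.@[pt j].
  by apply/eqP; rewrite -meval_ev //; apply: tideal_zero (chi_J x0) (pt_sol j).
pose rs := [seq l.@[pt i] | i <- enum I].
have urs : uniq rs by rewrite map_inj_uniq ?enum_uniq.
have := @all_roots_prod_XsubC _ (chi x0) rs.
rewrite size_map -cardE sz lc detBx0 scale1r => /(_ erefl) E.
have {}E : chi x0 = \prod_(z <- rs) ('X - z%:P).
  by apply: E; rewrite ?uniq_rootsE //; apply/allP => z /mapP [j _ ->].
have : separable_poly (chi x0) by rewrite E separable_prod_XsubC.
rewrite separable_poly.unlock => sep; exact: coprimep_root sep (hr i).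
Qed.

(** Where the ranks are those of the special system and the powers of [l] span
the quotient, the zeros correspond to the roots of [chi] by [zero_shape] and
[root_zero]. The roots are simple: a root gives a zero of the system, and the
derivative of [chi] evaluated at [l] does not vanish on zeros. *)
Theorem generic_count : generically (fun x => exists phi : 'I_N -> 'rV[F]_k,
  injective phi /\ forall z : 'rV_k, common_zero (f x) r (z 0) <-> exists i, z = phi i).
Proof.
have FB B : (N <= B)%N ->
    generically (fun x => row_full (col_mx (powers_mx l N B 1) (tideal_mx B (f x) d r B))).
  move=> NB; apply: (@generically_full (fun=> 1) 0 (coefs_in_const AC 1)); last by rewrite addn0.
    by move=> x; rewrite msize1.
  by move=> i; rewrite meval1 oner_eq0.
have G1 := FB level1 (leqnSn _).
have G2 : generically (fun x => row_full
  (col_mx (powers_mx l N level2 1) (tideal_mx level2 (f x) d r level2))).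
  by apply: FB; rewrite /level2 /level1; apply: leq_trans (leq_addl _ _).
have G3 : generically (fun x => forall j, (j < r.+1)%N -> forall D, (D < level2.+1)%N ->
    (\rank (tideal_mx level2 (f x0) d j D) <= \rank (tideal_mx level2 (f x) d j D))%N).
  apply: generically_forall => // j _; apply: generically_forall => // D _.
  by apply: rank_open => //; apply: entries_in_tideal_mx.
have G4 : generically (fun x => \det (Bx x) != 0).
  exists (fun x => \det (Bx x)); split => //.
    by apply: class_det => //; apply: entries_in_Bx.
  by rewrite detBx0 oner_eq0.
have G5 := @generically_nonzero Q N.-1 Q_coefs _ dchi_special_neq0.
have {}G5 := G5 _.
have sQ x : (msize (Q x) <= N.-1.+1)%N by rewrite prednK //; apply: msize_ev => //;
  apply: size_dchi.
have := generically_and AM G1 (generically_and AM G2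
  (generically_and AM G3 (generically_and AM G4 (G5 sQ)))).
apply: generically_sub => x [full1 [full2 [rks [dB Qn]]]].
have rk2 : (\rank (tideal_mx level2 (f x) d r level2) + N <= #|{: 'X_{1..k < level2}}|)%N.
  rewrite (rank_tideal_stable (f_size x0) (f_size x) f0_neq0 f0_reg _ (leqnn _) (leqnn _)).
    by apply: special_rank; rewrite /level2 /level1; apply: leq_trans (leq_addl _ _).
  by move=> j D hj hD; apply: rks.
have hh i : exists h : {poly F}, (size h <= N)%N /\ tideal (f x) d r level1 ('X_i - ev h).
  have [| | |h sh hJ] := @powers_span _ _ _ _ l_size _ _ _ (f_size x) _ 1 0 'X_i full1.
  - by rewrite msize1.
  - by rewrite addn0.
  - by rewrite msizeX mdeg1.
  by exists h; rewrite mul1r in hJ.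
have [h hP] := choice hh.
have h_size i := (hP i).1.
have h_J i := (hP i).2.
have [csz clc] := chi_size dB.
pose c := (\det (Bx x))^-1 *: chi x.
have cmon : c \is monic by rewrite monicE lead_coefZ clc mulVf.
have csize : size c = N.+1 by rewrite size_scale ?invr_eq0.
have cJ : tideal (f x) d r level1 (ev c) by rewrite linearZ /= ?mulr_algl; apply: tidealZ;
  apply: chi_J.
have RS := root_zero l_size (f_size x) full1 full2 rk2 (leqnn _) I0 e2 de (leqnn _) h_size h_J
  cmon csize cJ.
have [s cs] := closed_field_poly_normal c.
rewrite (monicP cmon) scale1r in cs.
have ss : size s = N by apply/eqP; rewrite -eqSS -csize cs size_prod_XsubC.
have us : uniq s.
  rewrite -separable_prod_XsubC -cs separable_poly.unlock;
    apply: Pdiv.ClosedField.root_coprimep => z rz.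
  have [hz lz] := RS z rz.
  have := Qn _ hz; rewrite meval_ev // lz derivZ hornerZ.
  by rewrite mulf_eq0 invr_eq0 (negPf dB).
pose phi (i : 'I_N) : 'rV[F]_k := \row_j (h j).[s`_i].
have rs (i : 'I_N) : root c s`_i by rewrite cs root_prod_XsubC mem_nth // ss.
have lphi i : l.@[phi i 0] = s`_i.
  rewrite -[RHS](RS _ (rs i)).2; apply: meval_eq => j; by rewrite mxE.
exists phi; split=> [i j eij|z].
  have := lphi i; rewrite eij lphi => /eqP.
  by rewrite nth_uniq ?ss // => /eqP /val_inj.
split=> [hz|[i ->]].
  have : root c l.@[z 0] by apply: zero_root cJ _ hz.
  rewrite cs root_prod_XsubC => zs; have [i iN E] := elimT (nthP (0 : F)) zs; rewrite ss in iN.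
  exists (Ordinal iN); apply/rowP => j; rewrite mxE /= E.
  exact: (zero_shape h_J j hz).
move=> j jr; rewrite -[RHS]((RS _ (rs i)).1 j jr); apply: meval_eq => u; by rewrite mxE.
Qed.

End Count.

(** * Substitution of constants for variables *)

Section Substitution.
Variables (F : fieldType) (k : nat).
Implicit Types (p q : {mpoly F[k]}) (a b : 'I_k -> {mpoly F[k]}).

(** Conversion would otherwise expand substitutions into sums over monomials and
compute with the indices of the last two variables. *)
Fact lock_key : unit. Proof. exact: tt. Qed.

Definition msubst a : {mpoly F[k]} -> {mpoly F[k]} :=
  locked_with lock_key (mmap (@mpolyC k F) a).

Lemma msubst_mmap a : msubst a = mmap (@mpolyC k F) a.
Proof. exact: unlock. Qed.

Lemma msubst_is_additive a : additive (msubst a).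
Proof. rewrite msubst_mmap; exact: mmap_is_additive. Qed.

Lemma msubst_is_multiplicative a : multiplicative (msubst a).
Proof. rewrite msubst_mmap; exact: mmap_is_multiplicative. Qed.

HB.instance Definition _ a := GRing.isAdditive.Build {mpoly F[k]} {mpoly F[k]} (msubst a)
  (msubst_is_additive a).
HB.instance Definition _ a := GRing.isMultiplicative.Build {mpoly F[k]} {mpoly F[k]} (msubst a)
  (msubst_is_multiplicative a).

Lemma msubstC a c : msubst a c%:MP = c%:MP.
Proof. by rewrite msubst_mmap mmapC. Qed.

Lemma msubstZ a c p : msubst a (c *: p) = c *: msubst a p.
Proof. by rewrite -mul_mpolyC rmorphM /= msubstC mul_mpolyC. Qed.

Lemma msubstX a i : msubst a 'X_i = a i.
Proof. by rewrite msubst_mmap mmapX mmap1U. Qed.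

Lemma msubstE a p : msubst a p = \sum_(m <- msupp p) p@_m *: \prod_i a i ^+ m i.
Proof. by rewrite msubst_mmap; apply: eq_bigr => m _; rewrite mul_mpolyC. Qed.

Lemma rmorph_ext (S : nzRingType) (u v : {rmorphism {mpoly F[k]} -> S}) :
  (forall c, u c%:MP = v c%:MP) -> (forall i, u 'X_i = v 'X_i) -> u =1 v.
Proof.
move=> hc hX p; rewrite [p]mpolyE !rmorph_sum; apply: eq_bigr => m _.
rewrite -mul_mpolyC !rmorphM hc mpolyXE_id !rmorph_prod; congr (_ * _).
by apply: eq_bigr => i _; rewrite !rmorphXn hX.
Qed.

Lemma msubst_comp a b p : msubst b (msubst a p) = msubst (fun i => msubst b (a i)) p.
Proof.
apply: (@rmorph_ext _ (msubst b \o msubst a) (msubst (fun i => msubst b (a i)))).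
  by move=> c; rewrite /= !msubstC.
by move=> i; rewrite /= !msubstX.
Qed.

Lemma eq_msubst a b p : (forall i, a i = b i) -> msubst a p = msubst b p.
Proof. by move=> h; congr (msubst _ p); apply: funext. Qed.

Lemma msubst_id p : msubst (fun i => 'X_i) p = p.
Proof.
apply: (@rmorph_ext _ (msubst (fun i => 'X_i)) idfun) => [c|i] /=; first by rewrite msubstC.
by rewrite msubstX.
Qed.

Lemma msubst_const (z : 'I_k -> F) p : msubst (fun i => (z i)%:MP) p = (p.@[z])%:MP.
Proof.
apply: (@rmorph_ext _ (msubst (fun i => (z i)%:MP)) (@mpolyC k F \o meval z)) => [c|i] /=.
  by rewrite msubstC mevalC.
by rewrite msubstX mevalXU.
Qed.

Lemma msize_prodX a (m : 'X_{1..k}) : (forall i, (msize (a i) <= 2)%N) ->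
  (msize (\prod_i a i ^+ m i) <= (mdeg m).+1)%N.
Proof.
move=> ha; rewrite mdegE; elim/big_rec2: _ => [|i p n _ IH]; first by rewrite msize1.
rewrite addnC mulrC -addSn; apply: msizeM_bound => //.
exact: msize_exp_bound.
Qed.

Lemma msize_msubst a p D : (forall i, (msize (a i) <= 2)%N) -> (msize p <= D)%N ->
  (msize (msubst a p) <= D)%N.
Proof.
move=> ha hp; rewrite msubstE big_seq_cond; apply: msize_sum_bound => m.
rewrite andbT => /msize_mdeg_lt hm; apply: msizeZ_bound.
by apply: leq_trans (msize_prodX _ ha) _; apply: leq_trans hm hp.
Qed.

Definition msubst1 i t := msubst (fun j => if j == i then t%:MP else 'X_j).
HB.instance Definition _ i t := GRing.RMorphism.on (msubst1 i t).

Lemma msize_msubst1 i t p D : (msize p <= D)%N -> (msize (msubst1 i t p) <= D)%N.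
Proof.
by apply: msize_msubst => j; case: eqP => _; [apply: msizeC_bound|apply: msizeU_bound].
Qed.

Lemma msubst1C i t c : msubst1 i t c%:MP = c%:MP.
Proof. exact: msubstC. Qed.

Lemma msubst1Z i t c p : msubst1 i t (c *: p) = c *: msubst1 i t p.
Proof. exact: msubstZ. Qed.

Lemma msubst1X i t j : msubst1 i t 'X_j = if j == i then t%:MP else 'X_j.
Proof. exact: msubstX. Qed.

Lemma msubst1_id i t p u : msubst1 i t (msubst1 i u p) = msubst1 i u p.
Proof.
rewrite /msubst1 msubst_comp; apply: eq_msubst => j.
by case: eqP => [|/eqP/negPf h]; rewrite ?msubstC // msubstX h.
Qed.

Lemma msubst1_comm i t j u p : i != j ->
  msubst1 i t (msubst1 j u p) = msubst1 j u (msubst1 i t p).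
Proof.
move=> ij; rewrite /msubst1 !msubst_comp; apply: eq_msubst => l.
have [->|lj] := eqVneq l j.
  by rewrite msubstC eq_sym (negPf ij) msubstX eqxx.
by rewrite msubstX; case: eqP => _; rewrite ?msubstC // msubstX (negPf lj).
Qed.

(** By linearity it is enough to treat monomials, for which the quotient comes
from the factorisation of [X^m - t^m]. *)
Lemma msubst1_factor i t p D : (msize p <= D)%N ->
  exists2 h, (msize h <= D.-1)%N & p = msubst1 i t p + ('X_i - t%:MP) * h.
Proof.
move=> hp.
have H : forall m : 'X_{1..k}, exists h : {mpoly F[k]},
    (msize h <= mdeg m)%N /\ 'X_[m] = msubst1 i t 'X_[m] + ('X_i - t%:MP) * h.
  move=> m.
  pose rest : {mpoly F[k]} := \prod_(j | j != i) 'X_j ^+ m j.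
  pose s : {mpoly F[k]} := \sum_(u < m i) 'X_i ^+ ((m i).-1 - u) * t%:MP ^+ u.
  exists (s * rest); split.
    rewrite mdegE (bigD1 i) //=; apply: msizeM_bound.
      apply: msize_sum_bound => u _; apply: (leq_trans (n := m i + 0)); last by rewrite addn0.
      apply: msizeM_bound.
        apply: leq_trans (msize_exp_bound _ (msizeU_bound F i)) _.
        by apply: (leq_ltn_trans (leq_subr _ _)); rewrite prednK //;
          apply: leq_ltn_trans (ltn_ord u).
      by rewrite -rmorphXn; apply: msizeC_bound.
    rewrite /rest; elim/big_rec2: _ => [|j n p0 _ IH]; first by rewrite msize1.
    rewrite addnC mulrC -addSn; apply: msizeM_bound => //.
    by apply: msize_exp_bound; apply: msizeU_bound.
  have -> : 'X_[m] = 'X_i ^+ m i * rest by rewrite mpolyXE_id (bigD1 i).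
  rewrite rmorphM rmorphXn /= /msubst1 msubstX eqxx.
  have -> : msubst (fun j => if j == i then t%:MP else 'X_j) rest = rest.
    rewrite /rest rmorph_prod; apply: eq_bigr => j ji.
    by rewrite rmorphXn /= msubstX (negPf ji).
  by rewrite mulrA -subrXX -mulrDl addrC subrK.
have [h hh] := choice H.
exists (\sum_(m <- msupp p) p@_m *: h m).
  rewrite big_seq_cond; apply: msize_sum_bound => m; rewrite andbT => hm.
  apply: msizeZ_bound; apply: leq_trans (hh m).1 _.
  have := leq_trans (msize_mdeg_lt hm) hp; by case: (D).
rewrite {1 2}[p]mpolyE rmorph_sum mulr_sumr -big_split; apply: eq_bigr => m _ /=.
by rewrite {1}(hh m).2 /msubst1 msubstZ -scalerAr -scalerDr.
Qed.

End Substitution.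

(** * A system whose zeros can be listed *)

Section Trans.
Variables (F : fieldType) (k : nat).
Implicit Types (p q : {mpoly F[k]}).

Lemma tideal_trans (f f' : nat -> {mpoly F[k]}) (d d' : nat -> nat) i i' D p :
  (forall j, (msize (f' j) <= (d' j).+1)%N) ->
  (forall j, (j < i)%N -> tideal f' d' i' (d j).+1 (f j)) ->
  tideal f d i D p -> tideal f' d' i' D p.
Proof.
move=> s' H [g gs ->]; apply: tideal_sum => j _.
apply: (tidealM_sub (e := d j)) => //; [exact: H|exact: gs].
Qed.

Lemma tideal_kill (S : nzRingType) (phi : {rmorphism {mpoly F[k]} -> S})
   (f : nat -> {mpoly F[k]}) (d : nat -> nat) i D p :
  (forall j, (j < i)%N -> phi (f j) = 0) -> tideal f d i D p -> phi p = 0.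
Proof.
by move=> H [g _ ->]; rewrite rmorph_sum big1 // => j _; rewrite rmorphM H ?mulr0.
Qed.

End Trans.

(** Up to nonzero scalars the system consists of [X_j^2 - s^2] for [j < K], of
[X Y], where [X] and [Y] are the last two variables, and of a polynomial of
degree at most 6 known only through its restrictions to the lines [X = 0] and [Y = 0]
when the other variables are given values [s] or [- s]. On each of these lines
it has the simple roots [ts] and a nonzero constant term. *)
Section Special.
Variables (F : fieldType) (K : nat).
Notation k := K.+2.
Implicit Types (p q : {mpoly F[k]}).
Variable s : F.
Hypothesis s0 : s != 0.
Hypothesis two0 : (2%:R : F) != 0.

Notation v := (fun j : nat => inord j : 'I_k).
Definition iX : 'I_k := locked_with lock_key (inord K).
Definition iY : 'I_k := locked_with lock_key (inord K.+1).

Lemma val_iX : iX = K :> nat.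
Proof. by rewrite /iX unlock inordK. Qed.

Lemma val_iY : iY = K.+1 :> nat.
Proof. by rewrite /iY unlock inordK. Qed.

Lemma XYneq : iX != iY.
Proof. by rewrite -val_eqE /= val_iX val_iY ltn_eqF. Qed.

Definition sign_of (eps : nat -> bool) j : F := if eps j then s else - s.

Definition sign_subst (i : nat) (eps : nat -> bool) : {mpoly F[k]} -> {mpoly F[k]} :=
  msubst (fun j : 'I_k => if (j < i)%N then (sign_of eps j)%:MP else 'X_j).
HB.instance Definition _ i eps := GRing.RMorphism.on (sign_subst i eps).

Lemma sign_substZ i eps c p : sign_subst i eps (c *: p) = c *: sign_subst i eps p.
Proof. exact: msubstZ. Qed.

Lemma sign_subst0 eps p : sign_subst 0 eps p = p.
Proof. exact: msubst_id. Qed.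

Lemma sign_substS i eps p : (i < k)%N ->
  sign_subst i.+1 eps p = sign_subst i eps (msubst1 (v i) (sign_of eps i) p).
Proof.
move=> ik; rewrite /sign_subst /msubst1 msubst_comp; apply: eq_msubst => j.
rewrite -val_eqE /= inordK // ltnS leq_eqVlt; case: eqP => [->|_] /=.
  by rewrite msubstC.
by rewrite msubstX.
Qed.

Lemma eq_sign_subst i eps eps' p : (forall j, (j < i)%N -> eps j = eps' j) ->
  sign_subst i eps p = sign_subst i eps' p.
Proof.
by move=> h; apply: eq_msubst => j; case: ifP => // ji; rewrite /sign_of h.
Qed.

Definition sqdiff j : {mpoly F[k]} := 'X_(v j) ^+ 2 - (s ^+ 2)%:MP.

Lemma sqdiff_size j : (msize (sqdiff j) <= 3)%N.
Proof.
apply: msizeB_bound; last exact: msizeC_bound.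
by apply: msize_exp_bound; apply: msizeU_bound.
Qed.

Section Tower.
Variables (Psi : ({mpoly F[k]} -> {mpoly F[k]}) -> Prop) (P : nat -> {mpoly F[k]} -> Prop).
Hypothesis Psi_lin : forall psi, Psi psi ->
  forall c p q, psi (c *: p + q) = c *: psi p + psi q.
Hypothesis P0 : forall D, P D 0.
Hypothesis PD : forall D p q, P D p -> P D q -> P D (p + q).
Hypothesis PM : forall D e p q, P D p -> (msize q <= e.+1)%N -> P (D + e) (q * p).
Hypothesis base : forall D p, (msize p <= D)%N -> (forall psi, Psi psi -> psi p = 0) -> P D p.

Definition in_tower i D p := exists q, P D q /\ tideal sqdiff (fun=> 2) i D (p - q).

Lemma in_towerD i D p q : in_tower i D p -> in_tower i D q -> in_tower i D (p + q).
Proof.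
move=> [p' [Pp Jp]] [q' [Pq Jq]]; exists (p' + q'); split; first exact: PD.
by rewrite opprD addrACA; apply: tidealD.
Qed.

Lemma in_towerM i D e p q : in_tower i D p -> (msize q <= e.+1)%N -> in_tower i (D + e) (q * p).
Proof.
move=> [p' [Pp Jp]] hq; exists (q * p'); split; first exact: PM.
by rewrite -mulrBr; apply: tidealM => // j; apply: sqdiff_size.
Qed.

(** [P] is the family of truncations of an ideal that contains every polynomial
killed by all maps in [Psi]; the generators [X_j^2 - s^2] are added one at a
time. Dividing [p] by [X_i - s] and the quotient by [X_i + s] gives
[p = a + (X_i - s) b + (X_i^2 - s^2) g'], where [X_i] does not occur in [a] and
[b]. The value of [p] at [X_i = s] is [a] and its value at [X_i = - s] is
[a - 2 s b], so [a] and [b] satisfy the hypothesis for the first [i]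
variables. *)
Lemma tower_radical i D p : (i <= K)%N -> (msize p <= D)%N ->
  (forall eps psi, Psi psi -> psi (sign_subst i eps p) = 0) -> in_tower i D p.
Proof.
elim: i D p => [|i IH] D p iK hp h.
  exists p; split; last by rewrite subrr; apply: tideal0.
  by apply: base => // psi hpsi; rewrite -(sign_subst0 (fun=> true) p); apply: h.
have ik : (i < k)%N by apply: ltn_trans iK _; rewrite ltnS.
have h' eps psi (b : bool) : Psi psi ->
  psi (sign_subst i eps (msubst1 (v i) (if b then s else - s) p)) = 0.
  move=> hpsi; pose e' j := if j == i then b else eps j.
  have := h e' psi hpsi; rewrite sign_substS // /sign_of /e' eqxx.
  rewrite (@eq_sign_subst i e' eps) // => j ji; by rewrite /e' ltn_eqF.
pose a := msubst1 (v i) s p.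
have aT : in_tower i D a.
  apply: IH; [exact: ltnW|exact: msize_msubst1|move=> eps psi]; exact: (h' _ _ true).
have [g gs E1] := msubst1_factor (v i) s hp.
pose b := msubst1 (v i) (- s) g.
have [g' gs' E2] := msubst1_factor (v i) (- s) gs.
have bT : in_tower i D.-1 b.
  apply: IH; [exact: ltnW|exact: msize_msubst1|move=> eps psi hpsi].
  have E : msubst1 (v i) (- s) p = a + (- s *+ 2) *: b.
    rewrite E1 rmorphD rmorphM /= msubst1_id -/a -/b; congr (_ + _).
    rewrite rmorphB /= /msubst1 msubstX eqxx msubstC -mpolyCB mul_mpolyC.
    by rewrite mulr2n.
  have := h' eps psi false hpsi; rewrite E addrC.
  rewrite rmorphD /= sign_substZ Psi_lin //.
  have -> : psi (sign_subst i eps a) = 0 by apply: (h' _ _ true).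
  move/eqP; rewrite addr0 scaler_eq0 -mulr_natr mulf_eq0 oppr_eq0 (negPf s0) (negPf two0) /=.
  by move/eqP.
have DE : (p = a + (('X_(v i) - s%:MP) * b + g' * sqdiff i)).
  rewrite E1 -/a {1}E2 -/b mulrDr; congr (_ + (_ + _)).
  rewrite mulrA mulrC; congr (_ * _).
  by rewrite /sqdiff mpolyCN opprK -subr_sqr rmorphXn.
rewrite DE.
have lift q : in_tower i D q -> in_tower i.+1 D q.
  by move=> [q' [Pq Jq]]; exists q'; split => //; apply: tideal_up Jq.
have [D0|D0] := posnP D.
  have p0 : p = 0 by apply/eqP; rewrite -msize_poly_eq0 -leqn0 -D0.
  rewrite -DE p0; exists 0; split => //; rewrite subrr; exact: tideal0.
apply: in_towerD; first exact: lift.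
apply: in_towerD.
  apply: lift; rewrite -(prednK D0) -addn1; apply: in_towerM => //.
  by apply: msizeB_bound; [apply: msizeU_bound|apply: msizeC_bound].
exists 0; split => //; rewrite subr0; apply: tideal_gen => //.
by apply: leq_trans gs' _; case: (D) => [//|[|n]] //=; rewrite subSS subn1.
Qed.

End Tower.

Definition axis_maps (psi : {mpoly F[k]} -> {mpoly F[k]}) :=
  psi = msubst1 iX 0 \/ psi = msubst1 iY 0.
Definition axis_ideal D p := exists2 h, (msize h <= D - 2)%N & p = ('X_iX * 'X_iY) * h.

Lemma axis_ideal0 D : axis_ideal D 0.
Proof. by exists 0; rewrite ?msize0 // mulr0. Qed.

Lemma axis_idealD D p q : axis_ideal D p -> axis_ideal D q -> axis_ideal D (p + q).
Proof.
move=> [h hs ->] [g gs ->]; exists (h + g); rewrite ?mulrDr //.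
exact: msizeD_bound.
Qed.

Lemma axis_idealM D e p q : axis_ideal D p -> (msize q <= e.+1)%N -> axis_ideal (D + e) (q * p).
Proof.
move=> [h hs ->] hq; exists (h * q); last by rewrite [RHS]mulrA [RHS]mulrC.
exact: msizeM_sub.
Qed.

(** Division by [X], then of the quotient by [Y]. *)
Lemma axis_radical D p : (msize p <= D)%N -> (forall psi, axis_maps psi -> psi p = 0) ->
  axis_ideal D p.
Proof.
move=> hp h.
have hX : msubst1 iX 0 p = 0 by apply: h; left.
have hY : msubst1 iY 0 p = 0 by apply: h; right.
have [g gs E] := msubst1_factor iX 0 hp; rewrite hX add0r subr0 in E.
have [g' gs' E'] := msubst1_factor iY 0 gs.
have gY : msubst1 iY 0 g = 0.
  move: hY; rewrite E rmorphM /= /msubst1 msubstX (negPf XYneq) => /eqP.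
  by rewrite mulf_eq0 -msize_poly_eq0 msizeX /= => /eqP.
rewrite gY add0r subr0 in E'; exists g'; last by rewrite E E' mulrA.
by rewrite subn2.
Qed.

Lemma axis_maps_lin psi : axis_maps psi -> forall c p q, psi (c *: p + q) = c *: psi p + psi q.
Proof. by case=> -> c p q; rewrite rmorphD /= /msubst1 msubstZ. Qed.

Variables (ts : seq F) (c0 : F).
Hypothesis ts_uniq : uniq ts.
Hypothesis ts_size : size ts = 6.
Hypothesis ts0 : 0 \notin ts.
Hypothesis c00 : c0 != 0.

Definition root_poly i : {mpoly F[k]} := c0 *: \prod_(t <- ts) ('X_i - t%:MP).

Lemma linear_factors i (rs : seq F) D p : uniq rs -> (msize p <= D)%N ->
  (forall t, t \in rs -> msubst1 i t p = 0) ->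
  exists2 h, (msize h <= D - size rs)%N & p = \prod_(t <- rs) ('X_i - t%:MP) * h.
Proof.
elim: rs D p => [|t rs IH] D p /=.
  by move=> _ hp _; exists p; rewrite ?subn0 // big_nil mul1r.
case/andP=> trs urs hp h.
have [g gs E] := msubst1_factor i t hp.
rewrite h ?mem_head // add0r in E.
have [u us E'] : exists2 h, (msize h <= D.-1 - size rs)%N
  & g = \prod_(t <- rs) ('X_i - t%:MP) * h.
  apply: IH => // t' t'rs.
  have : msubst1 i t' p = 0 by apply: h; rewrite in_cons t'rs orbT.
  rewrite E rmorphM rmorphB /= msubst1X eqxx msubst1C -mpolyCB mul_mpolyC => /eqP.
  rewrite scaler_eq0 subr_eq0 => /orP [/eqP tt|/eqP //].
  by rewrite -tt t'rs in trs.
exists u; first by rewrite subnS -predn_sub in us *.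
by rewrite big_cons E E' mulrA.
Qed.

Lemma linear_factors_size i : (msize (\prod_(t <- ts) ('X_i - t%:MP : {mpoly F[k]})) <= 7)%N.
Proof.
apply: (leq_trans (n := (size ts).+1)); last by rewrite ts_size.
elim: (ts) => [|t rs IH]; first by rewrite big_nil msize1.
rewrite big_cons mulrC /= -[X in (_ <= X)%N]addn1; apply: msizeM_bound => //.
by apply: msizeB_bound; [apply: msizeU_bound|apply: msizeC_bound].
Qed.

Definition root_poly0 : F := c0 * \prod_(t <- ts) (- t).

Lemma root_poly0_neq0 : root_poly0 != 0.
Proof.
rewrite mulf_neq0 // prodf_seq_neq0; apply/allP => t tt /=.
by rewrite oppr_eq0; apply: contraNneq ts0 => <-.
Qed.

(** A polynomial with the same restrictions as the sextic to the two lines; each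
summand is constant on the line where the other one is not, and the common
constant term is counted once. *)
Definition root_poly2 := root_poly iX + root_poly iY - root_poly0%:MP.

Lemma msubst1_root_poly i : msubst1 i 0 (root_poly i) = root_poly0%:MP.
Proof.
rewrite /root_poly /msubst1 msubstZ rmorph_prod /root_poly0 -mul_mpolyC rmorphM /=; congr (_ * _).
rewrite rmorph_prod; apply: eq_bigr => u _.
by rewrite rmorphB /= msubstX eqxx msubstC mpolyC0 sub0r mpolyCN.
Qed.

Lemma msubst1_root_poly_neq i j t : i != j -> msubst1 i t (root_poly j) = root_poly j.
Proof.
move=> ij; rewrite /root_poly /msubst1 msubstZ rmorph_prod; congr (_ *: _).
by apply: eq_bigr => u _; rewrite rmorphB /= msubstX eq_sym (negPf ij) msubstC.
Qed.

Definition point_maps (psi : {mpoly F[k]} -> {mpoly F[k]}) := exists2 t, t \in ts &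
  psi = msubst1 iX t \o msubst1 iY 0 \/ psi = msubst1 iX 0 \o msubst1 iY t.

Lemma point_maps_lin psi : point_maps psi -> forall c p q, psi (c *: p + q) = c *: psi p + psi q.
Proof.
by case=> t _ [] -> c p q; rewrite /= [msubst1 iY _ _]rmorphD rmorphD /= /msubst1 !msubstZ.
Qed.

Definition point_ideal D p := exists2 h, (msize h <= D - 6)%N & axis_ideal D (p - root_poly2 * h).

Lemma point_ideal0 D : point_ideal D 0.
Proof. by exists 0; rewrite ?msize0 // mulr0 subrr; apply: axis_ideal0. Qed.

Lemma point_idealD D p q : point_ideal D p -> point_ideal D q -> point_ideal D (p + q).
Proof.
move=> [h hs Hp] [g gs Hq]; exists (h + g); first exact: msizeD_bound.
by rewrite mulrDr opprD addrACA; apply: axis_idealD.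
Qed.

Lemma point_idealM D e p q : point_ideal D p -> (msize q <= e.+1)%N ->
  point_ideal (D + e) (q * p).
Proof.
move=> [h hs Hp] hq; exists (h * q); first exact: msizeM_sub.
rewrite (mulrC h) mulrA (mulrC root_poly2) -mulrA -mulrBr; exact: axis_idealM.
Qed.

Lemma root_poly_size i : (msize (root_poly i) <= 7)%N.
Proof. by apply: msizeZ_bound; apply: linear_factors_size. Qed.

Lemma root_poly2_size : (msize root_poly2 <= 7)%N.
Proof.
apply: msizeB_bound; last exact: msizeC_bound.
by apply: msizeD_bound; apply: root_poly_size.
Qed.

Lemma msubst1Y_root_poly2 : msubst1 iY 0 root_poly2 = root_poly iX.
Proof.
rewrite /root_poly2 rmorphB rmorphD /= msubst1_root_poly // msubst1_root_poly_neq;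
  last by rewrite eq_sym XYneq.
by rewrite msubst1C addrK.
Qed.

Lemma msubst1X_root_poly2 : msubst1 iX 0 root_poly2 = root_poly iY.
Proof.
rewrite /root_poly2 rmorphB rmorphD /= msubst1_root_poly // msubst1_root_poly_neq;
  last exact: XYneq.
by rewrite msubst1C addrC addrA addNr add0r.
Qed.

(** On each line the polynomial is a multiple of the product of the [X_i - t].
The two cofactors take the same value at the origin, because the product does
not vanish there; so they are restrictions of one polynomial [h2], and
[p - root_poly2 * h2] vanishes on both lines. *)
Lemma point_radical D p : (msize p <= D)%N -> (forall psi, point_maps psi -> psi p = 0) ->
  point_ideal D p.
Proof.
move=> hp h.
have hY : (msize (msubst1 iY 0 p) <= D)%N by apply: msize_msubst1.
have hX : (msize (msubst1 iX 0 p) <= D)%N by apply: msize_msubst1.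
have YX : iY != iX by rewrite eq_sym XYneq.
have [al als E1] : exists2 h, (msize h <= D - size ts)%N &
    msubst1 iY 0 p = \prod_(t <- ts) ('X_iX - t%:MP) * h.
  apply: (linear_factors ts_uniq hY) => t tt; apply: (h (msubst1 iX t \o msubst1 iY 0)).
  by exists t => //; left.
have [be bes E2] : exists2 h, (msize h <= D - size ts)%N &
    msubst1 iX 0 p = \prod_(t <- ts) ('X_iY - t%:MP) * h.
  apply: (linear_factors ts_uniq hX) => t tt; rewrite msubst1_comm //;
    apply: (h (msubst1 iX 0 \o msubst1 iY t)).
  by exists t => //; right.
have [al' al'E] : exists a, a = msubst1 iY 0 al by exists (msubst1 iY 0 al).
have [be' be'E] : exists b, b = msubst1 iX 0 be by exists (msubst1 iX 0 be).
have GE i : \prod_(t <- ts) ('X_i - t%:MP) = c0^-1 *: root_poly i.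
  by rewrite /root_poly scalerA mulVf // scale1r.
have {}E1 : msubst1 iY 0 p = root_poly iX * (c0^-1 *: al').
  by rewrite -(msubst1_id iY 0) E1 GE rmorphM /= msubst1Z -al'E msubst1_root_poly_neq //
    -scalerAl scalerAr.
have {}E2 : msubst1 iX 0 p = root_poly iY * (c0^-1 *: be').
  by rewrite -(msubst1_id iX 0) E2 GE rmorphM /= msubst1Z -be'E msubst1_root_poly_neq ?XYneq //
    -scalerAl scalerAr.
have E0 : msubst1 iX 0 al' = msubst1 iY 0 be'.
  have := msubst1_comm 0 0 p XYneq; rewrite E1 E2 !rmorphM /= !msubst1_root_poly // !msubst1Z.
  rewrite !mul_mpolyC !scalerA => /(scalerI _); apply.
  by rewrite mulf_neq0 ?invr_eq0 // root_poly0_neq0.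
pose h2 := c0^-1 *: (al' + be' - msubst1 iX 0 al').
have h2s : (msize h2 <= D - 6)%N.
  rewrite ts_size in als bes; apply: msizeZ_bound; apply: msizeB_bound.
    by apply: msizeD_bound; rewrite ?al'E ?be'E; apply: msize_msubst1.
  by rewrite al'E; do 2 apply: msize_msubst1.
exists h2 => //; apply: axis_radical.
  apply: msizeB_bound => //; rewrite mulrC -(addnK 6 D).
  apply: msizeM_sub => //; exact: root_poly2_size.
move=> psi [] ->.
  rewrite rmorphB rmorphM /= msubst1X_root_poly2 E2 /h2 msubst1Z rmorphB rmorphD /=.
  by rewrite be'E !msubst1_id -be'E addrAC subrr add0r subrr.
rewrite rmorphB rmorphM /= msubst1Y_root_poly2 E1 /h2 msubst1Z rmorphB rmorphD /=.
by rewrite -E0 (msubst1_comm 0 0 al' YX) al'E msubst1_id -al'E addrK subrr.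
Qed.

Variables (f : nat -> {mpoly F[k]}) (c : nat -> F).
Definition sys_deg (j : nat) : nat := if j == K.+1 then 6%N else 2%N.
Hypothesis c_neq0 : forall j, c j != 0.
Hypothesis f_size : forall j, (msize (f j) <= (sys_deg j).+1)%N.
Hypothesis f_quad : forall j, (j < K)%N -> f j = c j *: sqdiff j.
Hypothesis f_conic : f K = c K *: ('X_iX * 'X_iY).
Hypothesis f_lastY : forall eps, msubst1 iY 0 (sign_subst K eps (f K.+1)) = root_poly iX.
Hypothesis f_lastX : forall eps, msubst1 iX 0 (sign_subst K eps (f K.+1)) = root_poly iY.

Lemma sign_of_sq eps j : sign_of eps j ^+ 2 = s ^+ 2.
Proof. by rewrite /sign_of; case: (eps j); rewrite ?sqrrN. Qed.

Lemma sign_subst_sqdiff i eps j : (j < i)%N -> (j < K)%N -> sign_subst i eps (sqdiff j) = 0.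
Proof.
move=> ji jK; rewrite /sqdiff rmorphB rmorphXn /= /sign_subst msubstX msubstC.
have jk : (j < k)%N by apply: ltn_trans jK _; rewrite leqnSn.
by rewrite inordK // ji -rmorphXn /= sign_of_sq subrr.
Qed.

Lemma sign_subst_sqdiff_free i eps j : (i <= j)%N -> (j < K)%N ->
  sign_subst i eps (sqdiff j) = sqdiff j.
Proof.
move=> ij jK; rewrite /sqdiff rmorphB rmorphXn /= /sign_subst msubstX msubstC.
have jk : (j < k)%N by apply: ltn_trans jK _; rewrite leqnSn.
by rewrite inordK // ltnNge ij.
Qed.

Lemma sqdiff_neq0 j : sqdiff j != 0.
Proof.
apply/negP => /eqP /(congr1 (meval (fun=> 0))) /eqP.
rewrite mevalB rmorphXn /= mevalXU mevalC meval0 expr0n sub0r oppr_eq0.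
by rewrite expf_eq0 (negPf s0) andbF.
Qed.

Lemma sign_subst_high i eps (j : 'I_k) : (i <= j)%N -> sign_subst i eps 'X_j = 'X_j.
Proof. by move=> ij; rewrite /sign_subst msubstX ltnNge ij. Qed.

Lemma sign_subst_X eps : sign_subst K eps 'X_iX = 'X_iX.
Proof. by rewrite sign_subst_high ?val_iX. Qed.

Lemma sign_subst_Y eps : sign_subst K eps 'X_iY = 'X_iY.
Proof. by rewrite sign_subst_high ?val_iY. Qed.

Lemma unscale (a : F) (p : {mpoly F[k]}) : a != 0 -> p = a^-1 *: (a *: p).
Proof. by move=> a0; rewrite scalerA mulVf ?scale1r. Qed.

Lemma sqdiff_tideal i D p : (i <= K)%N -> tideal sqdiff (fun=> 2) i D p -> tideal f sys_deg i D p.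
Proof.
move=> iK; apply: tideal_trans => // j ji.
have jK := leq_trans ji iK.
rewrite (unscale (sqdiff j) (c_neq0 j)) -f_quad //; apply: tidealZ.
rewrite -[f j]mul1r; apply: tideal_gen => //; rewrite msize1 /sys_deg ltn_eqF //.
by apply: leq_trans jK _; apply: leqnSn.
Qed.

Lemma radical_sqdiff i D p : (i <= K)%N -> (msize p <= D)%N ->
  (forall eps, sign_subst i eps p = 0) -> tideal f sys_deg i D p.
Proof.
move=> iK ps h; apply: sqdiff_tideal => //.
have [q [-> ]] : in_tower (fun _ q => q = 0) i D p; last by rewrite subr0.
apply: (tower_radical (Psi := fun psi => psi = id)) => //.
- by move=> _ -> c1 p1 q1.
- by move=> _ p1 q1 -> ->; rewrite addr0.
- by move=> _ _ p1 q1 -> _; rewrite mulr0.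
- by move=> _ p1 _ /(_ id erefl).
- by move=> eps psi ->; apply: h.
Qed.

Lemma radical_conic D p : (msize p <= D)%N ->
  (forall eps, msubst1 iX 0 (sign_subst K eps p) = 0) ->
  (forall eps, msubst1 iY 0 (sign_subst K eps p) = 0) -> tideal f sys_deg K.+1 D p.
Proof.
move=> ps hX hY.
have [q [[h hs qE]] J] : in_tower (axis_ideal) K D p.
  apply: (tower_radical (Psi := axis_maps)) => //.
  - exact: axis_maps_lin.
  - exact: axis_ideal0.
  - exact: axis_idealD.
  - exact: axis_idealM.
  - exact: axis_radical.
  by move=> eps psi [] ->.
rewrite -[p](subrK q); apply: tidealD.
  by apply: (@tideal_up _ _ _ _ K) => //; apply: sqdiff_tideal.
rewrite qE (unscale ('X_iX * 'X_iY) (c_neq0 K)) -f_conic -scalerAl; apply: tidealZ.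
by rewrite mulrC; apply: tideal_gen => //; rewrite /sys_deg ltn_eqF.
Qed.

(** The sextic and [root_poly2] have the same restrictions to the two lines for
all signs, so they differ by an element of the ideal of the other
generators. *)
Lemma root_poly2_tideal : tideal f sys_deg K.+2 7 root_poly2.
Proof.
rewrite -[root_poly2](subKr (f K.+1)); apply: tidealB.
  by rewrite -[f _]mul1r; apply: tideal_gen => //; rewrite msize1 /sys_deg eqxx.
have sG eps : sign_subst K eps root_poly2 = root_poly2.
  have sGi (i : 'I_k) : sign_subst K eps 'X_i = 'X_i ->
    sign_subst K eps (root_poly i) = root_poly i.
    move=> h; rewrite /root_poly sign_substZ rmorph_prod; congr (_ *: _).
    by apply: eq_bigr => t _; rewrite rmorphB /= h /sign_subst msubstC.
  rewrite /root_poly2 rmorphB rmorphD /= !sGi ?sign_subst_X ?sign_subst_Y //.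
  by rewrite /sign_subst msubstC.
apply: (@tideal_up _ _ _ _ K.+1) => //; apply: radical_conic.
- apply: msizeB_bound; last exact: root_poly2_size.
  by apply: leq_trans (f_size _) _; rewrite /sys_deg eqxx.
- by move=> eps; rewrite rmorphB /= sG rmorphB /= f_lastX msubst1X_root_poly2 subrr.
- by move=> eps; rewrite rmorphB /= sG rmorphB /= f_lastY msubst1Y_root_poly2 subrr.
Qed.

Lemma root_poly_neq0 (i : 'I_k) : root_poly i != 0.
Proof.
apply/negP => /eqP h; have := msubst1_root_poly i; rewrite h rmorph0 => /eqP; rewrite eq_sym.
by rewrite mpolyC_eq0 (negPf (root_poly0_neq0)).
Qed.

Lemma sys_neq0 j : (j < k)%N -> f j != 0.
Proof.
rewrite ltnS leq_eqVlt => /orP [/eqP->|].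
  apply: contra_eq_neq (f_lastY xpredT) => ->.
  by rewrite !rmorph0 eq_sym root_poly_neq0.
rewrite ltnS leq_eqVlt => /orP [/eqP->|jK].
  rewrite f_conic -mul_mpolyC !mulf_eq0 mpolyC_eq0 (negPf (c_neq0 _)) /=.
  by rewrite -!msize_poly_eq0 !msizeX !mdeg1.
by rewrite f_quad // -mul_mpolyC mulf_eq0 mpolyC_eq0 (negPf (c_neq0 _)) sqdiff_neq0.
Qed.

Lemma sign_subst_kill i eps j : (i <= K)%N -> (j < i)%N -> sign_subst i eps (f j) = 0.
Proof.
move=> iK ji; have jK := leq_trans ji iK.
by rewrite f_quad // sign_substZ sign_subst_sqdiff ?scaler0.
Qed.

(** The truncated ideal of the first [j] generators consists of the polynomials
that vanish on a union of linear varieties; the restriction of [f j] to each of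
them is a nonzero polynomial, so if [g * f j] vanishes there then so does
[g]. *)
Lemma sys_regular j D g : (j < k)%N -> (msize g <= D - sys_deg j)%N ->
  tideal f sys_deg j D (g * f j) -> tideal f sys_deg j (D - sys_deg j) g.
Proof.
rewrite ltnS leq_eqVlt => /orP [/eqP->|].
  move=> gs J; have dK : (sys_deg K = 2)%N by rewrite /sys_deg ltn_eqF.
  have kill (phi : {rmorphism {mpoly F[k]} -> {mpoly F[k]}}) :
     (forall j, (j < K)%N -> phi (f j) = 0) -> phi ('X_iX * 'X_iY) = 0 ->
     phi (f K.+1) != 0 -> phi g = 0.
    move=> h1 h2 h3.
    have h4 j0 : (j0 < K.+1)%N -> phi (f j0) = 0.
      rewrite ltnS leq_eqVlt => /orP [/eqP->|/h1 //].
      by rewrite f_conic -mul_mpolyC rmorphM /= h2 mulr0.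
    have := tideal_kill h4 J; rewrite rmorphM => /eqP.
    by rewrite mulf_eq0 (negPf h3) orbF => /eqP.
  apply: radical_conic => // eps.
    apply: (kill (msubst1 iX 0 \o sign_subst K eps)) => /=.
    - by move=> i iK; rewrite sign_subst_kill // rmorph0.
    - by rewrite rmorphM /= sign_subst_X sign_subst_Y rmorphM /= msubst1X eqxx mpolyC0 mul0r.
    - by rewrite f_lastX root_poly_neq0.
  apply: (kill (msubst1 iY 0 \o sign_subst K eps)) => /=.
  - by move=> i iK; rewrite sign_subst_kill // rmorph0.
  - by rewrite rmorphM /= sign_subst_X sign_subst_Y rmorphM /= (msubst1X iY 0 iY) eqxx mpolyC0
    mulr0.
  - by rewrite f_lastY root_poly_neq0.
rewrite ltnS leq_eqVlt => jK gs J.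
have jK' : (j <= K)%N by rewrite leq_eqVlt.
apply: radical_sqdiff => // eps.
have := tideal_kill (phi := sign_subst j eps) (fun i ij => sign_subst_kill eps jK' ij) J.
rewrite rmorphM => /eqP; rewrite mulf_eq0 => /orP [/eqP //|].
case/orP: jK => [/eqP E|jK].
  rewrite E in J *; rewrite f_conic -mul_mpolyC !rmorphM /= sign_subst_X sign_subst_Y.
  rewrite {1}/sign_subst msubstC !mulf_eq0 mpolyC_eq0 (negPf (c_neq0 _)) /=.
  by rewrite -!msize_poly_eq0 !msizeX !mdeg1.
rewrite f_quad // /= sign_substZ sign_subst_sqdiff_free // -mul_mpolyC mulf_eq0 mpolyC_eq0.
by rewrite (negPf (c_neq0 _)) (negPf (sqdiff_neq0 _)).
Qed.

Definition sign_pt (eps : nat -> bool) (b : bool) (t : F) (j : 'I_k) : F :=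
  if (j < K)%N then sign_of eps j else if (j == iX) == b then t else 0.

Lemma sign_ptP eps b t p :
  (if b then msubst1 iX t (msubst1 iY 0 (sign_subst K eps p)) else msubst1 iX 0
    (msubst1 iY t (sign_subst K eps p)))
   = (p.@[sign_pt eps b t])%:MP.
Proof.
have E1 := val_iX; have E2 := val_iY.
have jcase (j : 'I_k) : (j < K)%N = false -> j = iX \/ j = iY.
  move/negbT; rewrite -leqNgt leq_eqVlt => /orP [/eqP h|h].
    by left; apply: val_inj; rewrite /= -h E1.
  right; apply: val_inj; rewrite /= E2; apply/eqP; rewrite eqn_leq h andbT.
  by rewrite -ltnS ltn_ord.
have YX : (iY == iX) = false by rewrite eq_sym; apply/negbTE/XYneq.
rewrite -msubst_const; case: b; rewrite /msubst1 /sign_subst !msubst_comp; apply: eq_msubst => j.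
  rewrite /sign_pt; case: ifP => jK; first by rewrite !msubstC.
  case: (jcase j jK) => ->; rewrite msubstX.
    by rewrite (negPf XYneq) msubstX eqxx.
  by rewrite eqxx YX msubstC mpolyC0.
rewrite /sign_pt; case: ifP => jK; first by rewrite !msubstC.
case: (jcase j jK) => ->; rewrite msubstX.
  by rewrite (negPf XYneq) msubstX eqxx mpolyC0.
by rewrite eqxx YX msubstC.
Qed.

Definition sign_ext (e : {ffun 'I_K -> bool}) (j : nat) := [exists o : 'I_K, (val o == j) && e o].

Lemma sign_extE e (o : 'I_K) : sign_ext e o = e o.
Proof.
apply/existsP/idP => [[o' /andP [/eqP /val_inj ->]] //|h].
by exists o; rewrite eqxx.
Qed.

(** The signs of the first [K] coordinates, the line, and the root on it. *)
Definition pt_index : finType := ({ffun 'I_K -> bool} * (bool * 'I_6))%type.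

Definition pt (i : pt_index) : 'I_k -> F := sign_pt (sign_ext i.1) i.2.1 ts`_i.2.2.

Lemma card_pt_index : #|{: pt_index}| = (2 ^ K * 12)%N.
Proof. by rewrite !card_prod card_ffun card_bool !card_ord. Qed.

Lemma roots_nth (r : 'I_6) : ts`_r \in ts.
Proof. by rewrite mem_nth // ts_size. Qed.

Lemma pt_inj i i' : pt i =1 pt i' -> i = i'.
Proof.
case: i i' => [e [b r]] [e' [b' r']]; rewrite /pt /= => h.
have t0 (u : 'I_6) : ts`_u != 0 by apply: contraNneq ts0 => <-; apply: roots_nth.
have ee : e = e'.
  apply/ffunP => o; have ok : (o < k)%N by apply: ltn_trans (ltn_ord o) _; rewrite leqnSn.
  have := h (Ordinal ok); rewrite /sign_pt /= ltn_ord /sign_of !sign_extE.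
  have ss : s != - s by rewrite -subr_eq0 opprK -mulr2n -mulr_natr mulf_neq0.
  by do 2 case: (_ o) => //; move/eqP; rewrite ?(negPf ss) // eq_sym (negPf ss).
have KX : (iX < K)%N = false by rewrite val_iX ltnn.
have KY : (iY < K)%N = false by rewrite val_iY ltnNge leqnSn.
have YX : (iY == iX) = false by rewrite eq_sym; apply/negbTE/XYneq.
have inj : ts`_r = ts`_r' -> r = r'.
  by move/eqP; rewrite nth_uniq ?ts_size // => /eqP /val_inj.
have := h iX; have := h iY; rewrite /sign_pt KX KY eqxx YX.
case: (b) (b') => [] [] //=.
- by move=> _ /inj ->; rewrite ee.
- by move=> _ /eqP; rewrite (negPf (t0 _)).
- by move=> _ /eqP; rewrite eq_sym (negPf (t0 _)).
- by move=> /inj ->; rewrite ee.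
Qed.

Lemma pt_common_zero i j : (j < k)%N -> (f j).@[pt i] = 0.
Proof.
case: i => [e [b r]] jk; apply/eqP; rewrite -(mpolyC_eq0 k); apply/eqP.
rewrite /pt /= -sign_ptP.
have YX : (iY == iX) = false by rewrite eq_sym; apply/negbTE/XYneq.
have Gt (i : 'I_k) : msubst1 i ts`_r (root_poly i) = 0.
  rewrite /root_poly msubst1Z rmorph_prod (big_rem _ (roots_nth r)) /= rmorphB /= msubst1X eqxx
    msubst1C.
  by rewrite subrr mul0r scaler0.
move: jk; rewrite ltnS leq_eqVlt => /orP [/eqP->|].
  case: b; first by rewrite f_lastY Gt.
  by rewrite msubst1_comm ?XYneq // f_lastX Gt.
rewrite ltnS leq_eqVlt => /orP [/eqP->|jK].
  rewrite f_conic sign_substZ rmorphM /= sign_subst_X sign_subst_Y.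
  have z0 (i : 'I_k) : msubst1 i 0 'X_i = 0 :> {mpoly F[k]} by rewrite msubst1X eqxx mpolyC0.
  case: b; rewrite !msubst1Z !rmorphM /=.
    by rewrite z0 rmorph0 mulr0 scaler0.
  by rewrite [msubst1 iY _ 'X_iX]msubst1X (negPf XYneq) z0 mul0r scaler0.
rewrite sign_subst_kill //; by case: b; rewrite !rmorph0.
Qed.

Lemma pt_radical D g : (msize g <= D)%N -> (forall i, g.@[pt i] = 0) -> tideal f sys_deg k D g.
Proof.
move=> gs h.
have hz eps b (r : 'I_6) : g.@[sign_pt eps b ts`_r] = 0.
  transitivity (g.@[pt ([ffun o : 'I_K => eps o], (b, r))]); last exact: h.
  apply: meval_eq => j.
  rewrite /pt /= /sign_pt; case: ifP => // jK; rewrite /sign_of.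
  by rewrite (sign_extE _ (Ordinal jK)) ffunE.
have hz' eps b t : t \in ts -> g.@[sign_pt eps b t] = 0.
  move/(seq.nthP 0) => [r rt <-]; rewrite ts_size in rt; exact: (hz _ _ (Ordinal rt)).
have [q [[h1 h1s [h2 h2s qE]]] J] : in_tower point_ideal K D g.
  apply: (tower_radical (Psi := point_maps)) => //.
  - exact: point_maps_lin.
  - exact: point_ideal0.
  - exact: point_idealD.
  - exact: point_idealM.
  - exact: point_radical.
  move=> eps psi [t tt] [] -> /=.
    by have := sign_ptP eps true t g => /= ->; rewrite hz'.
  by have := sign_ptP eps false t g => /= ->; rewrite hz'.
rewrite -[g](subrK q); apply: tidealD.
  apply: (@tideal_up _ _ _ _ K); first by rewrite !leqW.
  exact: sqdiff_tideal.
rewrite -[q](subrK (root_poly2 * h1)) qE; apply: tidealD.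
  rewrite (unscale ('X_iX * 'X_iY) (c_neq0 K)) -f_conic -scalerAl; apply: tidealZ.
  by rewrite mulrC; apply: tideal_gen => //; rewrite /sys_deg ltn_eqF.
by rewrite mulrC; apply: (tidealM_sub (e := 6)) => //; apply: root_poly2_tideal.
Qed.

End Special.


(** * Lines and tangency *)

Local Open Scope classical_set_scope.
Local Open Scope card_scope.
Local Open Scope ring_scope.

Section Dot.
Variables (F : comNzRingType) (n : nat).
Implicit Types x y z : 'rV[F]_n.

Lemma dotE x y : dot x y = (x *m y^T) 0 0.
Proof. by rewrite mxE; apply: eq_bigr => i _; rewrite mxE. Qed.

Lemma dotC x y : dot x y = dot y x.
Proof. by apply: eq_bigr => i _; rewrite mulrC. Qed.

Lemma dotDl x y z : dot (x + y) z = dot x z + dot y z.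
Proof. by rewrite !dotE mulmxDl mxE. Qed.

Lemma dotNl x z : dot (- x) z = - dot x z.
Proof. by rewrite !dotE mulNmx mxE. Qed.

Lemma dotZl c x z : dot (c *: x) z = c * dot x z.
Proof. by rewrite !dotE -scalemxAl mxE. Qed.

Lemma dotDr x y z : dot z (x + y) = dot z x + dot z y.
Proof. by rewrite dotC dotDl !(dotC _ z). Qed.

Lemma dotNr x z : dot z (- x) = - dot z x.
Proof. by rewrite dotC dotNl (dotC x). Qed.

Lemma dotZr c x z : dot z (c *: x) = c * dot z x.
Proof. by rewrite dotC dotZl (dotC x). Qed.

Lemma dot0l x : dot 0 x = 0.
Proof. by rewrite -(scale0r x) dotZl mul0r. Qed.

Definition dotL := (dotDl, dotNl, dotZl, dotDr, dotNr, dotZr).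

Lemma dot_row m (A : 'M[F]_(m, n)) x l : dot x (row l A) = (x *m A^T) 0 l.
Proof. by rewrite mxE; apply: eq_bigr => i _; rewrite !mxE. Qed.

Lemma dot_delta y l : dot y (delta_mx 0 l) = y 0 l.
Proof.
rewrite /dot (bigD1 l) //= mxE !eqxx mulr1 big1 ?addr0 // => j jl.
by rewrite mxE (negPf jl) andbF mulr0.
Qed.

End Dot.

Lemma dot_mull (F : comNzRingType) (n m : nat) (A : 'M[F]_(m, n)) (y : 'rV_m) (x : 'rV_n) :
  dot (y *m A) x = dot y (x *m A^T).
Proof. by rewrite !dotE trmx_mul trmxK mulmxA. Qed.


Lemma dot_self_eq0 (R : realDomainType) (n : nat) (a : 'rV[R]_n) : (dot a a == 0) = (a == 0).
Proof.
apply/eqP/eqP => [h|->]; last exact: dot0l.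
apply/rowP => i; rewrite mxE; apply/eqP; rewrite -sqrf_eq0 expr2; apply/eqP.
move/eqP: h; rewrite /dot psumr_eq0 => [/allP /(_ i)|j _]; last by rewrite -expr2 sqr_ge0.
by rewrite mem_index_enum => /(_ isT) /eqP.
Qed.

Lemma toC_dot (R : rcfType) (n : nat) (y z : 'rV[R]_n) :
  dot (toC y) (toC z) = real_complex R (dot y z).
Proof. by rewrite /dot rmorph_sum; apply: eq_bigr => i _; rewrite !mxE rmorphM. Qed.

Section ConsRow.
Variables (S : comNzRingType) (n : nat).
Implicit Types (a b : S) (y z : 'rV[S]_n).

(** A row with its first entry apart: in the explicit configurations the first
coordinate is the one along the normal of the hyperplane of the centers. *)
Definition consr a y : 'rV[S]_n.+1 := row_mx (a%:M : 'M_1) y : 'rV_(1 + n).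

Lemma consr0 a y : consr a y 0 0 = a.
Proof.
have -> : (0 : 'I_n.+1) = @lshift 1 n 0 by apply: val_inj.
by rewrite [LHS](@row_mxEl _ 1 1 n) mxE eqxx mulr1n.
Qed.

Lemma consrS a y j : consr a y 0 (lift 0 j) = y 0 j.
Proof.
have -> : lift 0 j = @rshift 1 n j by apply: val_inj.
exact: (@row_mxEr _ 1 1 n).
Qed.

Lemma dot_consr a y b z : dot (consr a y) (consr b z) = a * b + dot y z.
Proof.
rewrite /dot big_ord_recl !consr0; congr (_ + _).
by apply: eq_bigr => j _; rewrite !consrS.
Qed.

Lemma eq_consr (w w' : 'rV[S]_n.+1) :
  w 0 0 = w' 0 0 -> (forall j, w 0 (lift 0 j) = w' 0 (lift 0 j)) -> w = w'.
Proof.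
by move=> h0 hS; apply/rowP => i; case: (unliftP 0 i) => [j ->|->].
Qed.

Lemma consrB a y b z : consr a y - consr b z = consr (a - b) (y - z).
Proof.
apply: eq_consr => [|j]; rewrite [LHS]mxE [X in _ + X]mxE ?consr0 //.
by rewrite !consrS !mxE.
Qed.

End ConsRow.

Section Lines.
Variables (R : rcfType) (n : nat).
Notation C := R[i].
Implicit Types (p v q w : 'rV[C]_n).

Lemma cline_eqP p v p' v' : cline p v = cline p' v' ->
  exists t t', p' = p + t *: v /\ p' + v' = p + t' *: v.
Proof.
move=> E.
have : cline p' v' p' by exists 0 => //; rewrite scale0r addr0.
have : cline p' v' (p' + v') by exists 1 => //; rewrite scale1r.
by rewrite -E => -[t' _ E2] [t _ E1]; exists t, t'.
Qed.

Lemma cline_move p v (t s : C) : s != 0 -> cline (p + t *: v) (s *: v) = cline p v.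
Proof.
move=> s0; apply/seteqP; split => y [u _ <-].
  by exists (t + u * s) => //; rewrite scalerDl scalerA addrA.
exists ((u - t) / s) => //; rewrite scalerA divfK // scalerBl addrA.
by rewrite addrAC addrK.
Qed.

Lemma cline_opp p v : cline p (- v) = cline p v.
Proof.
by rewrite -(cline_move p v 0 (_ : -1 != 0)) ?scale0r ?addr0 ?scaleN1r // oppr_eq0 oner_eq0.
Qed.

(** An affine change of the parameter of a line multiplies the discriminant by
the square of its slope. *)
Lemma tangent_move p v (t s : C) c r :
  tangent p v c r -> tangent (p + t *: v) (s *: v) c r.
Proof.
rewrite /tangent; set q := p - toC c.
have -> : p + t *: v - toC c = q + t *: v by rewrite /q addrAC.
clearbody q; rewrite /= !dotL (dotC q v) => E.
have -> : (s * (dot v q + t * dot v v)) ^+ 2 =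
  s ^+ 2 * (dot v q ^+ 2 + (2%:R * t * dot v q * dot v v + t ^+ 2 * dot v v ^+ 2)) by ring.
by rewrite E; ring.
Qed.

(** A line with a non-isotropic direction is represented by a direction of
square 1 and by the point, relative to an origin [o], that is orthogonal to it;
by [normalize_inj] the only ambiguity is the sign of the direction. *)
Lemma normalize o p v : dot v v != 0 -> exists q w,
  [/\ dot w w = 1, dot q w = 0, cline p v = cline (o + q) w
    & forall c r, tangent p v c r -> tangent (o + q) w c r].
Proof.
move=> vv0; pose s := sqrtC (dot v v).
have s2 : s ^+ 2 = dot v v by apply: sqrtCK.
have s0 : s != 0 by rewrite -sqrf_eq0 s2.
pose t := - dot (p - o) v / dot v v.
pose q := p - o + t *: v.
have pq : o + q = p + t *: v by rewrite /q addrA (addrC o) subrK.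
exists q, (s^-1 *: v); rewrite pq; split.
- by rewrite !dotL mulrA -s2; field.
- by rewrite /q /t !dotL; field; rewrite ?vv0 ?s0.
- by rewrite cline_move ?invr_eq0.
- by move=> c r; apply: tangent_move.
Qed.

Lemma normalize_inj o q v q' v' :
  dot v v = 1 -> dot q v = 0 -> dot v' v' = 1 -> dot q' v' = 0 ->
  cline (o + q) v = cline (o + q') v' -> q' = q /\ (v' = v \/ v' = - v).
Proof.
move=> v1 qv v1' qv' /cline_eqP [t [t' [E1 E2]]].
have {}E1 : q' = q + t *: v by apply: (addrI o); rewrite E1 addrA.
have {}E2 : v' = (t' - t) *: v.
  apply: (addrI q'); apply: (addrI o); rewrite addrA E2 E1 scalerBl.
  by rewrite -!addrA; congr (_ + (_ + _)); rewrite addrC subrK.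
have tt : (t' - t) ^+ 2 = 1.
  by rewrite -v1' E2 !dotL v1; ring.
have t'0 : t' - t != 0 by rewrite -sqrf_eq0 tt oner_eq0.
have t0 : t = 0.
  move: qv'; rewrite E2 E1 !dotL qv v1 mulr0 add0r mulr1 => /eqP.
  by rewrite mulf_eq0 (negPf t'0) orbF => /eqP.
split; first by rewrite E1 t0 scale0r addr0.
move/eqP: tt; rewrite sqrf_eq1 E2 => /orP [] /eqP ->; first by left; rewrite scale1r.
by right; rewrite scaleN1r.
Qed.

End Lines.

Lemma toC_consr (R : rcfType) (n : nat) (a : R) (y : 'rV_n) :
  toC (consr a y) = consr (real_complex R a) (toC y).
Proof. by apply: eq_consr => [|j]; rewrite [LHS]mxE ?consr0 // !consrS mxE. Qed.

(** * Tangent lines as zeros of a polynomial system *)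

(** Coordinates are relative to the center [i0]; the centers [ib l] give the
frame of the hyperplane and the [ie j] are the remaining ones. Inverses of the
Gram matrix are replaced by its adjugate, so that all the expressions are
polynomial in the configuration. For a center [d] with radius [r] the power
[d.d - r^2 + rho] is the quantity that tangency equates to
[2 p.d + (v.d)^2]. *)
Section Geometry.
Variables (R : rcfType) (m k : nat).
Notation n := k.+1.
Notation C := R[i].
Variables (i0 : 'I_m) (ib : 'I_k -> 'I_m) (J : finType) (ie : J -> 'I_m).
Hypothesis cover : forall i, [\/ i = i0, exists l, i = ib l | exists j, i = ie j].
Variable x : config R m n.
Notation cC i := (toC (center x i)).
Notation rC i := (real_complex R (radius x i)).

Definition frame : 'M[C]_(k, n) := \matrix_l (cC (ib l) - cC i0).
Definition gram : 'M[C]_k := frame *m frame^T.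
Definition gram_det : C := \det gram.
Definition gram_adj : 'M[C]_k := \adj gram.
Definition offset j : 'rV[C]_n := cC (ie j) - cC i0.
Definition offset_coord j : 'rV[C]_k := offset j *m frame^T *m gram_adj.
Definition rho : C := rC i0 ^+ 2.
Definition frame_power : 'rV[C]_k := \row_l (gram l l - rC (ib l) ^+ 2 + rho).
Definition offset_power j : C := dot (offset j) (offset j) - rC (ie j) ^+ 2 + rho.
(** Twice the scalar products with the frame of the point of the line that is
orthogonal to its direction. *)
Definition foot (u : 'rV[C]_k) : 'rV[C]_k := \row_l (frame_power 0 l - u 0 l ^+ 2).
(** [gram_det] times the square of the normal component of a direction of
square 1. *)
Definition normal_part (u : 'rV[C]_k) : C := gram_det - dot (u *m gram_adj) u.
(** Tangency to the sphere [ie j], multiplied by [gram_det ^+ 2]. *)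
Definition quadric j (u : 'rV[C]_k) : C :=
  dot (offset_coord j) u ^+ 2 + gram_det * dot (offset_coord j) (foot u) - gram_det ^+ 2
    * offset_power j.
(** The first sphere gives [p.p = rho]; the normal component of [p] has been
eliminated by means of [p.v = 0]. *)
Definition sextic (u : 'rV[C]_k) : C :=
  dot (foot u *m gram_adj) u ^+ 2 - normal_part u
    * (4%:R * rho * gram_det - dot (foot u *m gram_adj) (foot u)).
Definition direction (u : 'rV[C]_k) := (forall j, quadric j u = 0) /\ sextic u = 0.

Hypothesis del0 : gram_det != 0.
Hypothesis dep : affinely_dependent x.
Hypothesis w0 : forall u, direction u -> normal_part u != 0.

(** Tangency of the line through [q], orthogonal to its unit direction [v]. All
the equations but the first three are affine in [q], as [q.q] has been replaced
by its value. *)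
Definition normal q v : Prop :=
  [/\ dot v v = 1, dot q v = 0, dot q q = rho,
      forall l, 2%:R * dot q (row l frame) = frame_power 0 l - dot v (row l frame) ^+ 2
    & forall j, 2%:R * dot q (offset j) = offset_power j - dot v (offset j) ^+ 2].

Lemma footE u l : foot u 0 l = frame_power 0 l - u 0 l ^+ 2.
Proof. by rewrite mxE. Qed.

Lemma gramE l : gram l l = dot (row l frame) (row l frame).
Proof. by rewrite dot_row -row_mul [RHS]mxE. Qed.

(** The normal of the hyperplane is a real vector, hence it is not isotropic. *)
Lemma normal_vec : exists a : 'rV[C]_n, [/\ dot a a != 0, forall l, dot a (row l frame) = 0
  & forall j, dot a (offset j) = 0].
Proof.
case: dep => a [b [a0 ab]]; exists (toC a); split.
- by rewrite toC_dot fmorph_eq0 dot_self_eq0.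
- by move=> l; rewrite rowK dotDr dotNr !toC_dot !ab subrr.
- by move=> j; rewrite /offset dotDr dotNr !toC_dot !ab subrr.
Qed.

Section WithNormal.
Variable a : 'rV[C]_n.
Hypothesis a0 : dot a a != 0.
Hypothesis ad : forall l, dot a (row l frame) = 0.
Hypothesis ae : forall j, dot a (offset j) = 0.

Lemma normal_frame : a *m frame^T = 0.
Proof. by apply/rowP => l; rewrite -dot_row ad mxE. Qed.

Lemma gram_mul_adj : gram *m gram_adj = gram_det%:M.
Proof. exact: mul_mx_adj. Qed.

(** The frame and the normal are a basis: the frame has a nonzero Gram
determinant, and is orthogonal to the normal. *)
Lemma orth_eq0 (y : 'rV[C]_n) : y *m frame^T = 0 -> dot y a = 0 -> y = 0.
Proof.
move=> yd ya; pose M : 'M[C]_(1 + k, n) := col_mx a frame.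
have free : row_free (M : 'M_n).
  rewrite -kermx_eq0 -submx0; apply/rV_subP => z /sub_kermxP.
  rewrite -[z](hsubmxK (z : 'rV_(1 + k))) (mul_row_col _ _ a frame); set z1 := lsubmx _;
    set z2 := rsubmx _.
  move=> E; have : z2 *m gram *m gram_adj = 0.
    have := congr1 (mulmx^~ frame^T) E;
      rewrite /= mulmxDl mul0mx -!mulmxA normal_frame mulmx0 add0r.
    by rewrite !mulmxA => ->; rewrite mul0mx.
  rewrite -mulmxA gram_mul_adj mul_mx_scalar => /eqP;
    rewrite scaler_eq0 (negPf del0) /= => /eqP z20.
  move: E; rewrite z20 mul0mx addr0 [z1]mx11_scalar mul_scalar_mx => /eqP.
  rewrite scaler_eq0 => /orP [/eqP ->|/eqP a00].
    by rewrite raddf0 row_mx0 sub0mx.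
  by move: a0; rewrite a00 dot0l eqxx.
have : y *m (M : 'M_n)^T = 0.
  apply: etrans (etrans (congr1 (mulmx y) (tr_col_mx a frame)) (mul_mx_row y a^T frame^T)) _.
  rewrite yd [y *m a^T]mx11_scalar -dotE ya raddf0; exact: row_mx0.
have uM : (M : 'M_n)^T \in unitmx by rewrite unitmx_tr -row_free_unit.
by move/(congr1 (mulmx^~ (invmx (M : 'M_n)^T))); rewrite /= mulmxK // mul0mx.
Qed.

Definition coord (y : 'rV[C]_k) (nu : C) : 'rV[C]_n :=
  gram_det^-1 *: (y *m gram_adj *m frame) + nu *: a.

Lemma coord_dd y nu : coord y nu *m frame^T = y.
Proof.
rewrite mulmxDl -!scalemxAl normal_frame scaler0 addr0 -!mulmxA -/gram.
by rewrite mul_adj_mx mul_mx_scalar scalerA mulVf // scale1r.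
Qed.

Lemma coord_a y nu : dot (coord y nu) a = nu * dot a a.
Proof.
rewrite dotDl !dotZl dot_mull normal_frame dotC dot0l mulr0 add0r //.
Qed.

Lemma coordK (y : 'rV[C]_n) : coord (y *m frame^T) (dot y a / dot a a) = y.
Proof.
apply/eqP; rewrite -subr_eq0; apply/eqP; apply: orth_eq0.
  by rewrite mulmxBl coord_dd subrr.
by rewrite dotDl dotNl coord_a divfK // subrr.
Qed.

Lemma dot_coord y nu y' nu' :
  dot (coord y nu) (coord y' nu') = gram_det^-1 * dot (y *m gram_adj) y' + nu * nu' * dot a a.
Proof.
rewrite [in LHS]/coord dotDl dotZl dot_mull coord_dd dotZl; congr (_ + _).
by rewrite dotC coord_a mulrA.
Qed.

Lemma dot_offset q j : dot q (offset j) = gram_det^-1 * dot (offset_coord j) (q *m frame^T).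
Proof.
rewrite -{1}[offset j]coordK (dotC (offset j) a) ae mul0r /coord scale0r addr0.
by rewrite dotZr dotC dot_mull.
Qed.

(** Opposite directions describe the same line and have opposite normal
components; fixing a square root selects one of them. *)
Definition normal_coord (u : 'rV[C]_k) : C := sqrtC (normal_part u / (gram_det * dot a a)).
Definition foot_coord (u : 'rV[C]_k) : C :=
  - (2%:R^-1 * gram_det^-1 * dot (foot u *m gram_adj) u) / (normal_coord u * dot a a).
Definition dir_of u := coord u (normal_coord u).
Definition foot_of u := coord (2%:R^-1 *: foot u) (foot_coord u).

Lemma two_neq0 : (2%:R : C) != 0. Proof. by rewrite pnatr_eq0. Qed.

Lemma normal_coord_sq u : normal_coord u ^+ 2 = normal_part u / (gram_det * dot a a).
Proof. exact: sqrtCK. Qed.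

Lemma normal_coord_neq0 u : direction u -> normal_coord u != 0.
Proof.
move=> /w0 h; rewrite -sqrf_eq0 normal_coord_sq mulf_neq0 // invr_eq0.
by rewrite mulf_neq0.
Qed.

Lemma normal_sol u : direction u -> normal (foot_of u) (dir_of u).
Proof.
move=> us; have nu0 := normal_coord_neq0 us; have W0 := w0 us; case: us => Q S.
have ns := normal_coord_sq u; split.
- rewrite dot_coord -expr2 ns /normal_part; field.
  by rewrite ?a0 ?del0.
- rewrite dot_coord -scalemxAl dotZl /foot_coord; field.
  by rewrite ?a0 ?del0 ?nu0.
- rewrite dot_coord -scalemxAl dotZl dotZr -expr2.
  have -> : foot_coord u ^+ 2 * dot a a =
    4%:R^-1 * gram_det^-1 ^+ 2 * (dot (foot u *m gram_adj) u ^+ 2) / (normal_coord u ^+ 2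
    * dot a a).
    by rewrite /foot_coord; field; rewrite ?a0 ?del0 ?nu0.
  move/eqP: S; rewrite /sextic subr_eq0 ns => /eqP ->.
  by field; rewrite ?W0 ?del0 ?a0.
- by move=> l; rewrite !dot_row !coord_dd !mxE; field.
- move=> j; rewrite !dot_offset !coord_dd dotZr.
  move: (Q j); rewrite /quadric => /eqP; rewrite subr_eq0 => /eqP E.
  apply: (mulfI (expf_neq0 2 del0)); rewrite mulrBr -E.
  by field; rewrite ?del0.
Qed.

Lemma normal_foot q v : normal q v ->
  q = coord (2%:R^-1 *: foot (v *m frame^T)) (dot q a / dot a a).
Proof.
case=> _ _ _ ql _.
suff <- : q *m frame^T = 2%:R^-1 *: foot (v *m frame^T) by rewrite coordK.
apply/rowP => l.
by rewrite [RHS]mxE footE -!dot_row -ql mulrA mulVf ?two_neq0 // mul1r.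
Qed.

(** For the normal components [nu] of [v] and [mu] of [q], the first three
equations give [nu ^+ 2], [mu * nu] and [mu ^+ 2] in terms of [u]; the sextic
says that the square of the second is the product of the other two. *)
Lemma sol_normal q v : normal q v -> direction (v *m frame^T) /\
  (dot v a / dot a a) ^+ 2 = normal_coord (v *m frame^T) ^+ 2.
Proof.
move=> N; case: (N) => vv1 qv qq1 ql qe; set u := v *m frame^T; set nu := dot v a / dot a a.
have vE : v = coord u nu by rewrite coordK.
pose mu := dot q a / dot a a.
have qE : q = coord (2%:R^-1 *: foot u) mu by apply: normal_foot N.
have n1 : nu ^+ 2 * dot a a = 1 - gram_det^-1 * dot (u *m gram_adj) u.
  by rewrite -vv1 {1 2}vE dot_coord; ring.
have n2 : mu * nu * dot a a = - (2%:R^-1 * gram_det^-1 * dot (foot u *m gram_adj) u).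
  apply/eqP; rewrite -addr_eq0 -qv qE {1}vE dot_coord -scalemxAl dotZl; apply/eqP; ring.
have n3 : mu ^+ 2 * dot a a = rho - 4%:R^-1 * gram_det^-1 * dot (foot u *m gram_adj) (foot u).
  rewrite -qq1 qE dot_coord -scalemxAl dotZl dotZr; field; by rewrite del0.
split; last by rewrite normal_coord_sq /normal_part; apply: (mulIf a0); rewrite n1; field;
  rewrite a0 del0.
split=> [j|].
  have := qe j; rewrite !dot_offset -/u.
  have -> : q *m frame^T = 2%:R^-1 *: foot u by rewrite qE coord_dd.
  rewrite dotZr /quadric => E.
  have -> : offset_power j = 2%:R * (gram_det^-1 * (2%:R^-1 * dot (offset_coord j) (foot u)))
    + (gram_det^-1 * dot (offset_coord j) u) ^+ 2.
    by rewrite E subrK.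
  by field; rewrite del0.
rewrite /sextic.
have -> : dot (foot u *m gram_adj) u = - 2%:R * gram_det * (mu * nu * dot a a).
  by rewrite n2; field; rewrite del0.
have -> : normal_part u = gram_det * (nu ^+ 2 * dot a a) by rewrite n1 /normal_part; field;
  rewrite del0.
have -> : 4%:R * rho * gram_det - dot (foot u *m gram_adj) (foot u) =
  4%:R * gram_det * (mu ^+ 2 * dot a a).
  by rewrite n3; field; rewrite del0.
by ring.
Qed.

Lemma normal_unique q v : normal q v -> normal_coord (v *m frame^T) != 0 ->
   dot v a / dot a a = normal_coord (v *m frame^T) ->
     v = dir_of (v *m frame^T) /\ q = foot_of (v *m frame^T).
Proof.
move=> N; case: (N) => vv1 qv qq1 ql qe nu0 E; set u := v *m frame^T.
have vE : v = dir_of u by rewrite /dir_of -E coordK.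
split=> //.
pose mu := dot q a / dot a a.
have qE : q = coord (2%:R^-1 *: foot u) mu by apply: normal_foot N.
rewrite qE /foot_of; congr coord; rewrite /foot_coord -/u.
have n2 : mu * normal_coord u * dot a a = - (2%:R^-1 * gram_det^-1 * dot (foot u *m gram_adj) u).
  apply/eqP; rewrite -addr_eq0 -qv qE {1}vE dot_coord -scalemxAl dotZl; apply/eqP; ring.
rewrite -n2 -mulrA mulfK // mulf_neq0 //.
Qed.

Lemma foot_opp u : foot (- u) = foot u.
Proof. by apply/rowP => l; rewrite !mxE sqrrN. Qed.

Lemma normal_part_opp u : normal_part (- u) = normal_part u.
Proof. by rewrite /normal_part mulNmx !dotL opprK. Qed.

Lemma direction_opp u : direction u -> direction (- u).
Proof.
case=> Q S; split=> [j|]; [rewrite -(Q j) /quadric|rewrite -S /sextic].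
  by rewrite foot_opp !dotL sqrrN.
by rewrite foot_opp normal_part_opp !dotL sqrrN.
Qed.

Lemma normal_coord_opp u : normal_coord (- u) = normal_coord u.
Proof. by rewrite /normal_coord normal_part_opp. Qed.

Lemma normal_opp q v : normal q v -> normal q (- v).
Proof.
by case=> h1 h2 h3 h4 h5; split=> [|||l|j]; rewrite ?dotNl ?dotNr ?opprK ?h2 ?oppr0 ?sqrrN.
Qed.

Lemma normal_tangent q v : normal q v -> v != 0 /\
  forall i, tangent (cC i0 + q) v (center x i) (radius x i).
Proof.
case=> h1 h2 h3 h4 h5; split.
  by apply: contra_eq_neq h1 => ->; rewrite dot0l eq_sym oner_eq0.
have key i d : d = cC i - cC i0 -> 2%:R * dot q d = dot d d - rC i ^+ 2 + rho - dot v d ^+ 2 ->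
   tangent (cC i0 + q) v (center x i) (radius x i).
  move=> dE E; rewrite /tangent.
  have -> : cC i0 + q - cC i = q - d by rewrite dE opprB addrA (addrC q).
  rewrite /= h1 mul1r !dotL h3 (dotC v q) h2 (dotC d q).
  rewrite sub0r sqrrN; have -> : dot v d ^+ 2 = dot d d - rC i ^+ 2 + rho - 2%:R * dot q d
    by rewrite E; ring.
  by ring.
move=> i; case: (cover i) => [->|[l ->]|[j ->]].
- apply: (key _ 0); rewrite ?subrr // (dotC q) (dotC v) !dot0l /rho; ring.
- apply: (key _ (row l frame)); first by rewrite rowK.
  by rewrite h4 mxE gramE.
- exact: (key _ (offset j)).
Qed.

(** An isotropic direction tangent to all spheres would be orthogonal to
[p - c] for all centers [c], hence to the frame, hence proportional to the
normal, which is not isotropic. *)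
Lemma tangent_normal p v : v != 0 ->
  (forall i, tangent p v (center x i) (radius x i)) ->
  exists q v', normal q v' /\ cline p v = cline (cC i0 + q) v'.
Proof.
move=> v0 T.
have vv0 : dot v v != 0.
  apply/negP => /eqP h.
  have T' i : dot v (p - cC i) = 0.
    by apply/eqP; rewrite -sqrf_eq0; apply/eqP; rewrite (T i) h mul0r.
  have vd : v *m frame^T = 0.
    apply/rowP => l; rewrite -dot_row rowK mxE.
    have -> : cC (ib l) - cC i0 = (p - cC i0) - (p - cC (ib l)).
      by rewrite opprB [RHS]addrC addrA subrK.
    by rewrite dotDr dotNr !T' subrr.
  have vE := coordK v; rewrite vd in vE.
  have /eqP := h; rewrite -vE dot_coord mul0mx dot0l mulr0 add0r -expr2.
  rewrite mulf_eq0 (negPf a0) orbF sqrf_eq0 => /eqP n0.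
  by move: v0; rewrite -vE n0 /coord !mul0mx scaler0 scale0r addr0 eqxx.
have [q [v' [v1 qv lineE tanE]]] := normalize (cC i0) p vv0.
exists q, v'; split=> //.
have T2 i : tangent (cC i0 + q) v' (center x i) (radius x i) by apply: tanE.
have key i d : d = cC i - cC i0 -> 2%:R * dot q d = dot q q + dot d d - rC i ^+ 2 - dot v' d ^+ 2.
  move=> dE; have := T2 i; rewrite /tangent.
  have -> : cC i0 + q - cC i = q - d by rewrite dE opprB addrA (addrC q).
  rewrite /= v1 mul1r !dotL (dotC v' q) qv add0r sqrrN (dotC d q) => ->.
  by ring.
have qq1 : dot q q = rho.
  have := @key i0 0; rewrite subrr => /(_ erefl).
  rewrite (dotC q) (dotC v') !dot0l mulr0 expr0n subr0 addr0 => /eqP.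
  by rewrite eq_sym subr_eq0 => /eqP.
split=> // [l|j].
  rewrite (key (ib l)) ?rowK // qq1 mxE.
  by rewrite gramE rowK; ring.
by rewrite (key (ie j)) // qq1 /offset_power; ring.
Qed.

Lemma normal_inj q v q' v' : normal q v -> normal q' v' ->
  cline (cC i0 + q) v = cline (cC i0 + q') v' -> q' = q /\ (v' = v \/ v' = - v).
Proof. by case=> v1 qv _ _ _ [v1' qv' _ _ _]; apply: normalize_inj. Qed.

Definition line_of u := cline (cC i0 + foot_of u) (dir_of u).

Lemma line_of_tangent u : direction u -> common_tangents x (line_of u).
Proof.
move=> us; have [v0 T] := normal_tangent (normal_sol us).
by exists (cC i0 + foot_of u), (dir_of u).
Qed.

(** Equal lines have equal or opposite directions. Opposite ones would have
opposite normal components, but [normal_coord] is even in [u] and nonzero. *)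
Lemma line_of_inj u u' : direction u -> direction u' -> line_of u = line_of u' -> u = u'.
Proof.
move=> us us' E.
have [_ [e|e]] := normal_inj (normal_sol us) (normal_sol us') E.
  by rewrite -(coord_dd u (normal_coord u)) -/(dir_of u) -e coord_dd.
have e1 : u' = - u.
  by rewrite -(coord_dd u' (normal_coord u')) -/(dir_of u') e mulNmx coord_dd.
have e2 : normal_coord u' = - normal_coord u.
  apply: (mulIf a0); have := coord_a u' (normal_coord u');
    rewrite -/(dir_of u') e dotNl coord_a => <-.
  by rewrite mulNr.
have := normal_coord_neq0 us; rewrite e1 normal_coord_opp in e2.
by have /eqP := e2; rewrite -addr_eq0 -mulr2n mulrn_eq0 /= => ->.
Qed.

(** Of the two unit directions of a line, one has the chosen square root as its
normal component. *)
Lemma line_of_surj L : common_tangents x L -> exists2 u, direction u & L = line_of u.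
Proof.
move=> [p [v [v0 -> T]]]; have [q [v' [N ->]]] := tangent_normal v0 T.
have [us /eqP] := sol_normal N; rewrite eqf_sqr => /orP [] /eqP E.
  exists (v' *m frame^T) => //.
  by have [e1 e2] := normal_unique N (normal_coord_neq0 us) E; rewrite /line_of -e1 -e2.
have N' := normal_opp N.
have us' : direction (- v' *m frame^T) by rewrite mulNmx; apply: direction_opp.
exists (- v' *m frame^T) => //.
have E' : dot (- v') a / dot a a = normal_coord (- v' *m frame^T).
  by rewrite dotNl mulNr E mulNmx normal_coord_opp opprK.
have [e1 e2] := normal_unique N' (normal_coord_neq0 us') E'.
by rewrite /line_of -e1 -e2 cline_opp.
Qed.

End WithNormal.

Theorem tangents_param : exists line_of : 'rV[C]_k -> set 'rV[C]_n,
  [/\ forall u, direction u -> common_tangents x (line_of u),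
      forall u u', direction u -> direction u' -> line_of u = line_of u' -> u = u'
    & forall L, common_tangents x L -> exists2 u, direction u & L = line_of u].
Proof.
have [a [a0 ad ae]] := normal_vec; exists (line_of a); split.
- exact: line_of_tangent.
- exact: line_of_inj.
- exact: line_of_surj.
Qed.

End Geometry.

(** * Irreducibility of the set of dependent configurations *)

Section Density.
Variables (R : rcfType) (m n : nat).
Implicit Types x y : config R m n.

Definition eval_config (t : R) (CP : 'M[{poly R}]_(m, n)) (RP : 'rV[{poly R}]_m) : config R m n :=
  (map_mx (horner_eval t) CP, map_mx (horner_eval t) RP).

Lemma coords_eval_config t CP RP (f : {mpoly R[m * n + m]}) :
  f.@[coords (eval_config t CP RP) 0] = (subst_poly ((row_mx (mxvec CP) RP) 0) f).[t].
Proof.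
rewrite horner_subst_poly; apply: meval_eq => i.
by rewrite /coords /eval_config /= -map_mxvec -map_row_mx mxE.
Qed.

(** Every point of the hyperplane [a.y = b] has the form
[(a.a) p - (a.p) a + beta a], which for every [p] lies in the hyperplane
[a.y = beta (a.a)] and is polynomial in [a], [p] and [beta]. *)
Lemma hyperplane_chart (a p : 'rV[R]_n) (b : R) : a != 0 -> dot a p = b ->
  dot a a *: ((dot a a)^-1 *: p) - dot a ((dot a a)^-1 *: p) *: a + (b / dot a a) *: a = p.
Proof.
move=> a0 ap; have aa0 : dot a a != 0 by rewrite dot_self_eq0.
by rewrite scalerA divff // scale1r dotZr ap (mulrC _ b) subrK.
Qed.

(** The parameters [a], [p], [beta] of the charts [hyperplane_chart] and the
radii are interpolated linearly. The centers are dependent wherever the normal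
[a] does not vanish, that is, [a] being real, wherever [q = a.a] does not
vanish. *)
Lemma dependent_path x0 x1 : dependent_configs x0 -> dependent_configs x1 ->
  exists CP RP (q : {poly R}), [/\ eval_config 0 CP RP = x0, eval_config 1 CP RP = x1, q != 0
    & forall t, 0 < t < 1 -> q.[t] != 0 -> dependent_configs (eval_config t CP RP)].
Proof.
move=> [r0 [a0 [b0 [a00 ab0]]]] [r1 [a1 [b1 [a10 ab1]]]].
pose lin (u v : R) : {poly R} := u%:P + (v - u) *: 'X.
have linE u v t : (lin u v).[t] = u + (v - u) * t by rewrite !hornerE.
have lin0 u v : (lin u v).[0] = u by rewrite linE mulr0 addr0.
have lin1 u v : (lin u v).[1] = v by rewrite linE mulr1 addrC subrK.
pose s0 := (dot a0 a0)^-1; pose s1 := (dot a1 a1)^-1.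
pose a : 'rV[{poly R}]_n := \row_j lin (a0 0 j) (a1 0 j).
pose P : 'M[{poly R}]_(m, n) := \matrix_(i, j) lin (s0 * x0.1 i j) (s1 * x1.1 i j).
pose be := lin (b0 * s0) (b1 * s1).
pose CP : 'M[{poly R}]_(m, n) := \matrix_(i, j)
  (dot a a * P i j - dot a (row i P) * a 0 j + be * a 0 j).
pose RP : 'rV[{poly R}]_m := \row_i lin (x0.2 0 i) (x1.2 0 i).
pose at1 t : 'rV[R]_n := \row_j (a 0 j).[t].
have dotH (y z : 'rV[{poly R}]_n) t : (dot y z).[t] =
    dot (\row_j (y 0 j).[t]) (\row_j (z 0 j).[t]).
  by rewrite horner_sum; apply: eq_bigr => j _; rewrite hornerM !mxE.
have CPE t i : center (eval_config t CP RP) i =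
    dot (at1 t) (at1 t) *: (\row_j (P i j).[t]) - dot (at1 t) (\row_j (P i j).[t]) *: at1 t
     + be.[t] *: at1 t.
  apply/rowP => j; rewrite /center /eval_config /= !mxE /horner_eval !hornerE !dotH.
  congr (_ - dot _ _ * _ + _); by apply/rowP => l; rewrite !mxE.
exists CP, RP, (dot a a); split.
- apply: injective_projections; last first.
    by apply/rowP => i; rewrite /eval_config /= !mxE /horner_eval lin0.
  apply/row_matrixP => i; rewrite -[LHS]/(center (eval_config 0 CP RP) i) CPE.
  have -> : at1 0 = a0 by apply/rowP => j; rewrite !mxE lin0.
  have -> : \row_j (P i j).[0] = s0 *: center x0 i.
    by apply/rowP => j; rewrite !mxE lin0.
  by rewrite lin0 hyperplane_chart.
- apply: injective_projections; last first.
    by apply/rowP => i; rewrite /eval_config /= !mxE /horner_eval lin1.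
  apply/row_matrixP => i; rewrite -[LHS]/(center (eval_config 1 CP RP) i) CPE.
  have -> : at1 1 = a1 by apply/rowP => j; rewrite !mxE lin1.
  have -> : \row_j (P i j).[1] = s1 *: center x1 i.
    by apply/rowP => j; rewrite !mxE lin1.
  by rewrite lin1 hyperplane_chart.
- apply: contra a00 => /eqP /(congr1 (horner^~ 0)); rewrite dotH horner0.
  have -> : \row_j (a 0 j).[0] = a0 by apply/rowP => j; rewrite !mxE lin0.
  by move/eqP; rewrite dot_self_eq0.
move=> t /andP [t0 t1] qt; split.
  move=> i; rewrite /radius /eval_config /= !mxE /horner_eval linE.
  have -> : x0.2 0 i + (x1.2 0 i - x0.2 0 i) * t = (1 - t) * x0.2 0 i + t * x1.2 0 i by ring.
  by rewrite addr_gt0 // mulr_gt0 ?subr_gt0 //; [apply: r0|apply: r1].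
have at_neq0 : at1 t != 0.
  by apply: contra qt => /eqP h; rewrite dotH -/(at1 t) h dot0l.
exists (at1 t), (be.[t] * dot (at1 t) (at1 t)); split => // i.
rewrite CPE !dotL; ring.
Qed.

(** On the path the two polynomials become nonzero polynomials in the parameter;
the values 1/2, 1/3, ... of the parameter are infinitely many points of the
open unit interval, so one of them avoids all the roots. *)
Lemma dependent_irreducible x0 x1 (f g : {mpoly R[m * n + m]}) :
  dependent_configs x0 -> dependent_configs x1 ->
  f.@[coords x0 0] != 0 -> g.@[coords x1 0] != 0 ->
  exists y, [/\ dependent_configs y, f.@[coords y 0] != 0 & g.@[coords y 0] != 0].
Proof.
move=> X0 X1 f0 g0; have [CP [RP [q [E0 E1 q0 H]]]] := dependent_path X0 X1.
pose F h := subst_poly ((row_mx (mxvec CP) RP) 0) h.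
have e_inj : injective (fun c : nat => (c.+2)%:R^-1 : R).
  by move=> a b /invr_inj /eqP; rewrite eqr_nat => /eqP [].
have [|c hc] := @poly_nonroot _ _ (q * (F f * F g)) e_inj.
  rewrite !mulf_neq0 //.
    by apply: contraNneq f0 => h; rewrite -E0 coords_eval_config -/(F f) h horner0.
  by apply: contraNneq g0 => h; rewrite -E1 coords_eval_config -/(F g) h horner0.
move: hc; set t := _^-1; rewrite !hornerM !mulf_eq0 !negb_or => /and3P [h1 h2 h3].
exists (eval_config t CP RP); split; rewrite ?coords_eval_config //.
apply: H => //; rewrite invr_gt0 ltr0n /= invf_lt1 ?ltr0n //.
by rewrite ltr1n.
Qed.

End Density.

(** * Polynomial dependence on the configuration *)

Section PolyFunctions.
Variables (R : rcfType) (m n : nat).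
Notation C := R[i].
Notation T := (config R m n).

Definition polyfun (a : T -> C) := exists p : {mpoly C[m * n + m]},
  forall x, a x = p.@[fun i => real_complex R (coords x 0 i)].

Lemma polyfunC c : polyfun (fun=> c).
Proof. by exists c%:MP => x; rewrite mevalC. Qed.

Lemma polyfunD a b : polyfun a -> polyfun b -> polyfun (fun x => a x + b x).
Proof. by move=> [p hp] [q hq]; exists (p + q) => x; rewrite mevalD hp hq. Qed.

Lemma polyfunM a b : polyfun a -> polyfun b -> polyfun (fun x => a x * b x).
Proof. by move=> [p hp] [q hq]; exists (p * q) => x; rewrite mevalM hp hq. Qed.

Lemma polyfun_center i j : polyfun (fun x => (toC (center x i)) 0 j).
Proof.
exists 'X_(lshift m (mxvec_index i j)) => x.
by rewrite mevalXU /coords row_mxEl mxvecE !mxE.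
Qed.

Lemma polyfun_radius i : polyfun (fun x => real_complex R (radius x i)).
Proof. by exists 'X_(rshift (m * n) i) => x; rewrite mevalXU /coords row_mxEr. Qed.

Lemma polyfun_real a : polyfun a -> exists f g : {mpoly R[m * n + m]},
  forall x, a x = 0 <-> f.@[coords x 0] = 0 /\ g.@[coords x 0] = 0.
Proof.
move=> [p hp].
pose f : {mpoly R[m * n + m]} := \sum_(u <- msupp p) complex.Re (p@_u) *: 'X_[u].
pose g : {mpoly R[m * n + m]} := \sum_(u <- msupp p) complex.Im (p@_u) *: 'X_[u].
exists f, g => x.
have -> : a x = (f.@[coords x 0])%:C%C + 'i%C * (g.@[coords x 0])%:C%C.
  have fE : f.@[coords x 0] = \sum_(u <- msupp p) complex.Re (p@_u) * \prod_i coords x 0 i ^+ u i.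
    by rewrite /f raddf_sum; apply: eq_bigr => u _ /=; rewrite mevalZ mevalX.
  have gE : g.@[coords x 0] = \sum_(u <- msupp p) complex.Im (p@_u) * \prod_i coords x 0 i ^+ u i.
    by rewrite /g raddf_sum; apply: eq_bigr => u _ /=; rewrite mevalZ mevalX.
  rewrite hp mevalE fE gE !rmorph_sum mulr_sumr -big_split; apply: eq_bigr => u _ /=.
  rewrite [in LHS](complexE p@_u) !rmorphM !rmorph_prod /= mulrDl mulrA.
  by congr (_ * _ + _ * _); apply: eq_bigr => i _; rewrite rmorphXn.
split=> [/eqP|[-> ->]]; last by rewrite mulr0 addr0.
by rewrite eq_complex /= !(mul0r, mulr0, mul1r, addr0, add0r, subr0, oppr0) => /andP [/eqP ->
  /eqP ->].
Qed.

End PolyFunctions.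

(** The formulas for the system over an arbitrary ring, to be used with numbers
and with polynomials in the unknowns. *)
Section Formulas.
Variables (k : nat).

Section Ring.
Variable S : comNzRingType.
Definition footF (al u : 'rV[S]_k) : 'rV[S]_k := \row_l (al 0 l - u 0 l ^+ 2).
Definition normal_partF (A : 'M[S]_k) (del : S) (u : 'rV[S]_k) : S := del - dot (u *m A) u.
Definition quadricF (bt al u : 'rV[S]_k) (del eta : S) : S :=
  dot bt u ^+ 2 + del * dot bt (footF al u) - del ^+ 2 * eta.
Definition sexticF (A : 'M[S]_k) (al u : 'rV[S]_k) (del rho : S) : S :=
  dot (footF al u *m A) u ^+ 2
  - normal_partF A del u * (4%:R * rho * del - dot (footF al u *m A) (footF al u)).
End Ring.

Section Morph.
Variables (S S' : comNzRingType) (phi : {rmorphism S -> S'}).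

Lemma dot_morph n (y z : 'rV[S]_n) : phi (dot y z) = dot (map_mx phi y) (map_mx phi z).
Proof. by rewrite /dot rmorph_sum; apply: eq_bigr => i _; rewrite !mxE rmorphM. Qed.

Lemma footF_morph al u : map_mx phi (footF al u) = footF (map_mx phi al) (map_mx phi u).
Proof. by apply/rowP => l; rewrite !mxE rmorphB rmorphXn. Qed.

Lemma normal_partF_morph A del u : phi (normal_partF A del u) =
  normal_partF (map_mx phi A) (phi del) (map_mx phi u).
Proof. by rewrite /normal_partF rmorphB dot_morph map_mxM. Qed.

Lemma quadricF_morph bt al u del eta : phi (quadricF bt al u del eta) =
  quadricF (map_mx phi bt) (map_mx phi al) (map_mx phi u) (phi del) (phi eta).
Proof. by rewrite /quadricF rmorphB rmorphD !(rmorphXn, rmorphM) /= !dot_morph footF_morph. Qed.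

Lemma sexticF_morph A al u del rho : phi (sexticF A al u del rho) =
  sexticF (map_mx phi A) (map_mx phi al) (map_mx phi u) (phi del) (phi rho).
Proof.
rewrite /sexticF rmorphB !(rmorphXn, rmorphM) /= normal_partF_morph rmorphB !(rmorphXn,
  rmorphM) /= !dot_morph.
by rewrite !map_mxM /= !footF_morph rmorph_nat.
Qed.
End Morph.

Section Size.
Variables (F : fieldType) (v : nat).
Notation S := {mpoly F[v]}.

Lemma msize_dot n (y z : 'rV[S]_n) a b : (forall l, (msize (y 0%R l) <= a)%N) ->
  (forall l, (msize (z 0%R l) <= b.+1)%N) -> (msize (dot y z) <= a + b)%N.
Proof. by move=> hy hz; apply: msize_sum_bound => l _; apply: msizeM_bound. Qed.

Lemma msizeX2_bound (p : S) a : (msize p <= a.+1)%N -> (msize (p ^+ 2) <= a.+1 + a)%N.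
Proof. by move=> hp; rewrite expr2; apply: msizeM_bound. Qed.

Lemma msize_mulC n (y : 'rV[S]_n) (A : 'M[F]_n) a : (forall l, (msize (y 0%R l) <= a)%N) ->
  forall l, (msize ((y *m map_mx (@mpolyC v F) A) 0%R l) <= a)%N.
Proof.
move=> hy l; rewrite mxE; apply: msize_sum_bound => j _.
by rewrite mxE mulrC mul_mpolyC; apply: msizeZ_bound.
Qed.

Lemma msize_footF (al : 'rV[F]_k) (u : 'rV[S]_k) : (forall l, (msize (u 0%R l) <= 2)%N) ->
  forall l, (msize (footF (map_mx (@mpolyC v F) al) u 0%R l) <= 3)%N.
Proof.
move=> hu l; rewrite mxE; apply: msizeB_bound.
  by rewrite mxE; apply: msizeC_bound.
exact: (@msizeX2_bound _ 1).
Qed.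

Lemma msize_quadricF (b al : 'rV[F]_k) (u : 'rV[S]_k) (del eta : F) :
  (forall l, (msize (u 0%R l) <= 2)%N) ->
  (msize (quadricF (map_mx (@mpolyC v F) b) (map_mx (@mpolyC v F) al) u del%:MP eta%:MP) <= 3)%N.
Proof.
move=> hu; have hb l : (msize (map_mx (@mpolyC v F) b 0%R l) <= 1)%N.
  by rewrite mxE; apply: msizeC_bound.
apply: msizeB_bound; last by rewrite -rmorphXn -rmorphM; apply: msizeC_bound.
apply: msizeD_bound.
  by apply: (@msizeX2_bound _ 1); apply: (@msize_dot _ _ _ 1 1).
rewrite mul_mpolyC; apply: msizeZ_bound; apply: (@msize_dot _ _ _ 1 2) => // l.
exact: msize_footF.
Qed.

Lemma msize_normal_partF (A : 'M[F]_k) (u : 'rV[S]_k) (del : F) :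
  (forall l, (msize (u 0%R l) <= 2)%N) ->
  (msize (normal_partF (map_mx (@mpolyC v F) A) del%:MP u) <= 3)%N.
Proof.
move=> hu; apply: msizeB_bound; first exact: msizeC_bound.
by apply: (@msize_dot _ _ _ 2 1) => //; apply: msize_mulC.
Qed.

Lemma msize_sexticF (A : 'M[F]_k) (al : 'rV[F]_k) (u : 'rV[S]_k) (del rho : F) :
  (forall l, (msize (u 0%R l) <= 2)%N) ->
  (msize (sexticF (map_mx (@mpolyC v F) A) (map_mx (@mpolyC v F) al) u del%:MP rho%:MP) <= 7)%N.
Proof.
move=> hu; apply: msizeB_bound.
  apply: (@msizeX2_bound _ 3); apply: (@msize_dot _ _ _ 3 1) => //.
  by apply: msize_mulC; apply: msize_footF.
apply: (@msizeM_bound _ _ _ _ 3 4); first exact: msize_normal_partF.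
apply: msizeB_bound; first by rewrite -(rmorph_nat (@mpolyC v F)) -!rmorphM; apply: msizeC_bound.
by apply: (@msize_dot _ _ _ 3 2); [apply: msize_mulC|]; apply: msize_footF.
Qed.
End Size.

Section Families.
Variables (T : Type) (F : fieldType) (Af : (T -> F) -> Prop).
Hypothesis AC : forall c, Af (fun=> c).
Hypothesis AD : forall a b, Af a -> Af b -> Af (fun x => a x + b x).
Hypothesis AM : forall a b, Af a -> Af b -> Af (fun x => a x * b x).
Variable v : nat.
Notation S := {mpoly F[v]}.

Definition row_coefs_in n (y : T -> 'rV[S]_n) := forall l, coefs_in Af (fun x => y x 0 l).

Lemma row_coefs_in_const n (y : 'rV[S]_n) : row_coefs_in (fun=> y).
Proof. by move=> l; apply: coefs_in_const. Qed.

Lemma eq_coefs_in (p q : T -> S) : coefs_in Af p -> p =1 q -> coefs_in Af q.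
Proof. by move=> hp pq; rewrite -(funext pq). Qed.

Lemma coefs_in_dot n (y z : T -> 'rV[S]_n) : row_coefs_in y -> row_coefs_in z ->
  coefs_in Af (fun x => dot (y x) (z x)).
Proof. by move=> hy hz; apply: coefs_in_sum => // l; apply: coefs_inM. Qed.

Lemma row_coefs_in_mapC n (b : T -> 'rV[F]_n) : entries_in Af b ->
  row_coefs_in (fun x => map_mx (@mpolyC v F) (b x)).
Proof.
move=> hb l; apply: (@eq_coefs_in (fun x => (b x 0 l)%:MP)); last by move=> x; rewrite mxE.
exact: coefs_inC.
Qed.

Lemma row_coefs_in_mul n (y : T -> 'rV[S]_n) (A : T -> 'M[F]_n) : row_coefs_in y ->
  entries_in Af A ->
  row_coefs_in (fun x => y x *m map_mx (@mpolyC v F) (A x)).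
Proof.
move=> hy hA l; apply: (@eq_coefs_in (fun x => \sum_j y x 0 j * (A x j l)%:MP)); last first.
  by move=> x; rewrite mxE; apply: eq_bigr => j _; rewrite mxE.
by apply: coefs_in_sum => // j; apply: coefs_inM => //; apply: coefs_inC.
Qed.

Variable u : 'rV[S]_k.

Lemma row_coefs_in_footF (al : T -> 'rV[F]_k) : entries_in Af al ->
  row_coefs_in (fun x => footF (map_mx (@mpolyC v F) (al x)) u).
Proof.
move=> hal l; apply: (@eq_coefs_in (fun x => (al x 0 l)%:MP - u 0 l ^+ 2)); last first.
  by move=> x; rewrite !mxE.
by apply: coefs_inB => //; apply: coefs_inC.
Qed.

Lemma coefs_in_normal_partF (A : T -> 'M[F]_k) (del : T -> F) : entries_in Af A -> Af del ->
  coefs_in Af (fun x => normal_partF (map_mx (@mpolyC v F) (A x)) (del x)%:MP u).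
Proof.
move=> hA hd; apply: coefs_inB => //; first exact: coefs_inC.
apply: coefs_in_dot; last exact: row_coefs_in_const.
by apply: row_coefs_in_mul => //; apply: row_coefs_in_const.
Qed.

Lemma coefs_in_quadricF (b al : T -> 'rV[F]_k) (del eta : T -> F) :
  entries_in Af b -> entries_in Af al -> Af del -> Af eta ->
  coefs_in Af (fun x => quadricF (map_mx (@mpolyC v F) (b x)) (map_mx (@mpolyC v F) (al x)) u
     (del x)%:MP (eta x)%:MP).
Proof.
move=> hb hal hd he; have hb' := row_coefs_in_mapC hb.
have hd' : coefs_in Af (fun x => (del x)%:MP : S) by apply: coefs_inC.
apply: coefs_inB => //; last first.
  by apply: coefs_inM => //; [apply: coefs_inX|apply: coefs_inC].
apply: coefs_inD => //.
  by apply: coefs_inX => //; apply: coefs_in_dot => //; apply: row_coefs_in_const.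
by apply: coefs_inM => //; apply: coefs_in_dot => //; apply: row_coefs_in_footF.
Qed.

Lemma coefs_in_sexticF (A : T -> 'M[F]_k) (al : T -> 'rV[F]_k) (del rho : T -> F) :
  entries_in Af A -> entries_in Af al -> Af del -> Af rho ->
  coefs_in Af (fun x => sexticF (map_mx (@mpolyC v F) (A x)) (map_mx (@mpolyC v F) (al x)) u
     (del x)%:MP (rho x)%:MP).
Proof.
move=> hA hal hd hr; have hK := row_coefs_in_footF hal.
have hKA := row_coefs_in_mul hK hA.
apply: coefs_inB => //.
  by apply: coefs_inX => //; apply: coefs_in_dot => //; apply: row_coefs_in_const.
apply: coefs_inM => //; first exact: coefs_in_normal_partF.
apply: coefs_inB => //; last exact: coefs_in_dot.
apply: coefs_inM => //; last exact: coefs_inC.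
by apply: coefs_inM => //; apply: coefs_inC.
Qed.
End Families.
End Formulas.

Lemma card_eq_ordinal (T : Type) (A : set T) N (g : 'I_N -> T) : injective g ->
  (forall y, A y <-> exists i, y = g i) -> A #= `I_N.
Proof.
move=> gi gA; rewrite (card_eqr card_II).
have -> : A = g @` [set: 'I_N].
  apply/seteqP; split => y; first by move/gA => [i ->]; exists i.
  by case=> i _ <-; apply/gA; exists i.
by apply: inj_card_eq => i j _ _; apply: gi.
Qed.

(** * The polynomial system of a configuration *)

Section Instance.
Variables (R : rcfType) (K : nat).
Hypothesis K0 : (0 < K)%N.
Notation C := R[i].
Notation k := K.+2.
Notation n := K.+3.
Notation m := (1 + (K.+2 + K.+1))%N.
Notation T := (config R m n).

Definition idx0 : 'I_m := lshift _ ord0.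
Definition idx_frame (l : 'I_k) : 'I_m := rshift 1 (lshift K.+1 l).
Definition idx_offset (j : 'I_K.+1) : 'I_m := rshift 1 (rshift K.+2 j).

Lemma idx_cover (i : 'I_m) :
  [\/ i = idx0, exists l, i = idx_frame l | exists j, i = idx_offset j].
Proof.
case: (split_ordP i) => [j ->|j ->].
  by constructor 1; rewrite [j]ord1.
case: (split_ordP j) => [l ->|l ->]; first by constructor 2; exists l.
by constructor 3; exists l.
Qed.

Notation iX := (iX K).
Notation iY := (iY K).
(** Linear change of unknowns suited to the special configuration, whose last
quadric is a multiple of [3 x^2 + 10 x y + 3 y^2 = (3 x + y) (x + 3 y)]: with
[x = 3 X - Y] and [y = 3 Y - X] the factors become [8 X] and [8 Y]. *)
Definition linforms : 'rV[{mpoly C[k]}]_k := \row_l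
  (if (l < K)%N then 'X_l else if l == iX then 3%:R * 'X_iX - 'X_iY
   else 3%:R * 'X_iY - 'X_iX).

Lemma linforms_size l : (msize (linforms 0%R l) <= 2)%N.
Proof.
have h i j : (msize (3%:R * 'X_i - 'X_j : {mpoly C[k]}) <= 2)%N.
  apply: msizeB_bound; last by rewrite msizeX mdeg1.
  by rewrite -mpolyC_nat mul_mpolyC; apply: msizeZ_bound; rewrite msizeX mdeg1.
by rewrite mxE; case: ifP => _; last case: ifP => _; rewrite ?h // msizeX mdeg1.
Qed.

Definition dir_coords (z : 'rV[C]_k) : 'rV[C]_k := map_mx (meval (z 0)) linforms.

Lemma last_two_cases (l : 'I_k) : (l < K)%N = false -> l = iX \/ l = iY.
Proof.
move/negbT; rewrite -leqNgt leq_eqVlt => /orP [/eqP h|h].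
  by left; apply: val_inj; rewrite /= val_iX.
right; apply: val_inj; rewrite /= val_iY; apply/eqP; rewrite eqn_leq h andbT.
by rewrite -ltnS ltn_ord.
Qed.

Lemma iXK : (iX < K)%N = false. Proof. by rewrite val_iX ltnn. Qed.
Lemma iYK : (iY < K)%N = false. Proof. by rewrite val_iY ltnNge leqnSn. Qed.
Lemma iYX : (iY == iX) = false. Proof. by rewrite eq_sym; apply/negbTE/XYneq. Qed.

Lemma linforms_low (l : 'I_k) : (l < K)%N -> linforms 0 l = 'X_l.
Proof. by move=> h; rewrite mxE h. Qed.
Lemma linforms_X : linforms 0 iX = 3%:R * 'X_iX - 'X_iY.
Proof. by rewrite mxE iXK eqxx. Qed.
Lemma linforms_Y : linforms 0 iY = 3%:R * 'X_iY - 'X_iX.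
Proof. by rewrite mxE iYK iYX. Qed.

Lemma dir_coords_low z (l : 'I_k) : (l < K)%N -> dir_coords z 0 l = z 0 l.
Proof. by move=> h; rewrite mxE linforms_low // mevalXU. Qed.
Lemma dir_coords_X z : dir_coords z 0 iX = 3%:R * z 0 iX - z 0 iY.
Proof. by rewrite mxE linforms_X mevalB mevalM !mevalXU rmorph_nat. Qed.
Lemma dir_coords_Y z : dir_coords z 0 iY = 3%:R * z 0 iY - z 0 iX.
Proof. by rewrite mxE linforms_Y mevalB mevalM !mevalXU rmorph_nat. Qed.

Definition dir_coords_inv (u : 'rV[C]_k) : 'rV[C]_k := \row_l
  (if (l < K)%N then u 0 l else if l == iX then (3%:R * u 0 iX + u 0 iY) / 8%:R
   else (3%:R * u 0 iY + u 0 iX) / 8%:R).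

Lemma dir_coords_invK u : dir_coords (dir_coords_inv u) = u.
Proof.
apply/rowP => l; case h: (l < K)%N; first by rewrite dir_coords_low // mxE h.
case: (last_two_cases h) => ->.
  by rewrite dir_coords_X ![dir_coords_inv _ _ _]mxE iXK iYK eqxx iYX; field.
by rewrite dir_coords_Y ![dir_coords_inv _ _ _]mxE iXK iYK eqxx iYX; field.
Qed.

Lemma dir_coordsK z : dir_coords_inv (dir_coords z) = z.
Proof.
apply/rowP => l; rewrite mxE; case h: (l < K)%N; first by rewrite dir_coords_low.
by case: (last_two_cases h) => ->; rewrite ?eqxx ?iYX dir_coords_X dir_coords_Y; field.
Qed.

Notation bt_ x j := (offset_coord idx0 idx_frame idx_offset x j).
Notation al_ x := (frame_power idx0 idx_frame x).
Notation del_ x := (gram_det idx0 idx_frame x).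
Notation AA_ x := (gram_adj idx0 idx_frame x).
Notation eta_ x j := (offset_power idx0 idx_offset x j).
Notation rho_ x := (rho idx0 x).
Notation frame_ x := (frame idx0 idx_frame x).
Notation gram_ x := (gram idx0 idx_frame x).
Notation offset_ x j := (offset idx0 idx_offset x j).
Notation direction_ x := (direction idx0 idx_frame idx_offset x).
Notation normal_part_ x := (normal_part idx0 idx_frame x).
Notation quadric_ x := (quadric idx0 idx_frame idx_offset x).
Notation sextic_ x := (sextic idx0 idx_frame x).
Notation mp := (@mpolyC k C).

Definition tangent_sys (x : T) (j : nat) : {mpoly C[k]} :=
  if (j < K.+1)%N then
    let j' : 'I_K.+1 := inord j in
    quadricF (map_mx mp (bt_ x j')) (map_mx mp (al_ x)) linforms (del_ x)%:MP (eta_ x j')%:MP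
  else if j == K.+1 then sexticF (map_mx mp (AA_ x)) (map_mx mp (al_ x)) linforms (del_ x)%:MP
    (rho_ x)%:MP
  else 0.

Definition normal_sys (x : T) : {mpoly C[k]} :=
  normal_partF (map_mx mp (AA_ x)) (del_ x)%:MP linforms.

Lemma tangent_sys_size x j : (msize (tangent_sys x j) <= (sys_deg K j).+1)%N.
Proof.
rewrite /tangent_sys /sys_deg; case: ifP => h; first by rewrite ltn_eqF //;
  apply: msize_quadricF linforms_size.
case: ifP => _; first by apply: msize_sexticF linforms_size.
by rewrite msize0.
Qed.

Lemma map_meval (z : 'I_k -> C) p q (M : 'M[C]_(p, q)) : map_mx (meval z) (map_mx mp M) = M.
Proof. by apply/matrixP => i j; rewrite !mxE mevalC. Qed.

Lemma tangent_sys_zero x (z : 'rV[C]_k) : common_zero (tangent_sys x) k (z 0) <->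
  direction_ x (dir_coords z).
Proof.
have Q (j : 'I_K.+1) : (tangent_sys x j).@[z 0] = quadric_ x j (dir_coords z).
  rewrite /tangent_sys ltn_ord inord_val (quadricF_morph (meval (z 0))) !map_meval.
  by congr (quadricF _ _ _ _ _); apply: mevalC.
have S : (tangent_sys x K.+1).@[z 0] = sextic_ x (dir_coords z).
  rewrite /tangent_sys ltnn eqxx (sexticF_morph (meval (z 0))) !map_meval.
  by congr (sexticF _ _ _ _ _); apply: mevalC.
split=> [h|[h1 h2] j].
  split=> [j|]; last by rewrite -S; apply: h.
  by rewrite -Q; apply: h; apply: ltn_trans (ltn_ord j) _.
rewrite ltnS leq_eqVlt => /orP [/eqP ->|jK]; first by rewrite S.
by rewrite -[j]/(nat_of_ord (Ordinal jK)) Q.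
Qed.

Lemma normal_sys_eval x (z : 'rV[C]_k) : (normal_sys x).@[z 0] = normal_part_ x (dir_coords z).
Proof.
rewrite /normal_sys (normal_partF_morph (meval (z 0))) map_meval.
by congr (normal_partF _ _ _); apply: mevalC.
Qed.

Notation pf := (@polyfun R m n).
Notation PC := (@polyfunC R m n).
Notation PD := (@polyfunD R m n).
Notation PM := (@polyfunM R m n).

Lemma polyfunB a b : pf a -> pf b -> pf (fun x => a x - b x).
Proof.
move=> ha hb; apply: (eq_class (PD ha (PM (PC (-1)) hb))) => x.
by rewrite mulN1r.
Qed.

Lemma entries_in_toC i : entries_in pf (fun x : T => toC (center x i)).
Proof. by move=> a b; rewrite [a]ord1; apply: polyfun_center. Qed.

Lemma entries_inB p q (M N : T -> 'M[C]_(p, q)) : entries_in pf M -> entries_in pf N ->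
  entries_in pf (fun x => M x - N x).
Proof. by move=> hM hN i j; apply: (eq_class (polyfunB (hM i j) (hN i j))) => x;
  rewrite !mxE. Qed.

Lemma entries_in_tr p q (M : T -> 'M[C]_(p, q)) : entries_in pf M ->
  entries_in pf (fun x => (M x)^T).
Proof. by move=> hM i j; apply: (eq_class (hM j i)) => x; rewrite mxE. Qed.

Lemma entries_in_frame : entries_in pf (fun x : T => frame_ x).
Proof.
move=> l j; apply: (eq_class (entries_inB (@entries_in_toC (idx_frame l)) (@entries_in_toC idx0)
  0 j)) => x.
by rewrite [RHS]mxE.
Qed.

Lemma entries_in_gram : entries_in pf (fun x : T => gram_ x).
Proof. by apply: (entries_in_mul PC PD PM);
  [apply: entries_in_frame|apply/entries_in_tr/entries_in_frame]. Qed.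

Lemma polyfun_gram_det : pf (fun x : T => del_ x).
Proof. exact: (class_det PC PD PM entries_in_gram). Qed.

Lemma entries_in_gram_adj : entries_in pf (fun x : T => AA_ x).
Proof. exact: (entries_in_adj PC PD PM entries_in_gram). Qed.

Lemma entries_in_offset j : entries_in pf (fun x : T => offset_ x j).
Proof. by apply: entries_inB; apply: entries_in_toC. Qed.

Lemma entries_in_offset_coord j : entries_in pf (fun x : T => bt_ x j).
Proof.
apply: (entries_in_mul PC PD PM); last exact: entries_in_gram_adj.
by apply: (entries_in_mul PC PD PM);
  [apply: entries_in_offset|apply/entries_in_tr/entries_in_frame].
Qed.

Lemma polyfun_rho : pf (fun x : T => rho_ x).
Proof.
apply: (eq_class (PM (@polyfun_radius R m n idx0) (@polyfun_radius R m n idx0))) => x.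
by rewrite /rho expr2.
Qed.

Lemma entries_in_frame_power : entries_in pf (fun x : T => al_ x).
Proof.
move=> a l; apply: (eq_class (PD (polyfunB (entries_in_gram l l)
  (PM (@polyfun_radius R m n (idx_frame l)) (@polyfun_radius R m n (idx_frame l))))
  polyfun_rho)) => x.
by rewrite [RHS]mxE expr2.
Qed.

Lemma polyfun_offset_power j : pf (fun x : T => eta_ x j).
Proof.
have h : pf (fun x : T => dot (offset_ x j) (offset_ x j)).
  by apply: (class_sum PC PD) => l; apply: PM; apply: entries_in_offset.
apply: (eq_class (PD (polyfunB h (PM (@polyfun_radius R m n (idx_offset j))
  (@polyfun_radius R m n (idx_offset j)))) polyfun_rho)) => x.
by rewrite /offset_power expr2.
Qed.

Lemma tangent_sys_polyfun j : coefs_in pf (fun x => tangent_sys x j).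
Proof.
rewrite /tangent_sys; case: (j < K.+1)%N.
  apply: (coefs_in_quadricF PC PD PM);
    [exact: entries_in_offset_coord|exact: entries_in_frame_power|exact: polyfun_gram_det|exact:
    polyfun_offset_power].
case: (j == K.+1); last exact: (coefs_in_const PC).
apply: (coefs_in_sexticF PC PD PM);
  [exact: entries_in_gram_adj|exact: entries_in_frame_power|exact: polyfun_gram_det|exact:
  polyfun_rho].
Qed.

Lemma normal_sys_polyfun : coefs_in pf normal_sys.
Proof. by apply: (coefs_in_normal_partF PC PD PM);
  [exact: entries_in_gram_adj|exact: polyfun_gram_det]. Qed.

(** * A configuration with regular and radical system *)

(** The centers 0, [e_l], [- e_l] for [l < K], and [(5/2) (e_K + e_(K+1))], for
which the Gram matrix is 1. The radii are determined by the powers, which are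
chosen as follows. Equal powers for [e_l] and [- e_l] make the corresponding
quadric [2 (X_l^2 - square_val)]; the power [5 * (- 108 scale)] of the last
center cancels the constant term of the last quadric. The value of
[square_val] makes the sum of the [X_l^2] equal to 1/2. The two remaining
numbers are such that the sextic restricted to each of the lines [X = 0] and
[Y = 0] is a product of three quadratic factors with distinct nonzero constant
terms, see [sextic_on_line]; the unit [scale] makes the coefficients
integers. *)
Definition scale : R := 144%:R^-1.
Definition rho_val : R := 2160%:R * scale ^+ 2.
Definition square_val : R := (2 * K)%:R^-1.
Definition frame_power_val (l : 'I_k) : R := if (l < K)%N then square_val else - 108%:R * scale.
Definition offset_power_val (j : 'I_K.+1) : R :=
  if (j < K)%N then square_val else - 540%:R * scale.
Definition offset_mx : 'M[R]_(K.+1, k) := \matrix_(j, l)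
  if (j < K)%N then - (l == j :> nat)%:R else 5%:R / 2%:R * (K <= l)%N%:R.
Definition center_mx : 'M[R]_(m, k) := col_mx (0 : 'rV_k) (col_mx 1%:M offset_mx).
Definition radius_row : 'rV[R]_m := row_mx (const_mx (Num.sqrt rho_val))
  (row_mx (\row_l Num.sqrt (1 + rho_val - frame_power_val l))
          (\row_j Num.sqrt (dot (row j offset_mx) (row j offset_mx) + rho_val
            - offset_power_val j))).
Definition special_config : T := (row_mx (0 : 'M_(m, 1)) center_mx : 'M_(m, 1 + k), radius_row).

Notation x0 := special_config.
Notation sys0 := (tangent_sys x0).

Lemma scale_gt0 : 0 < scale. Proof. by rewrite invr_gt0 ltr0n. Qed.
Lemma rho_val_gt0 : 0 < rho_val.
Proof. by rewrite mulr_gt0 ?exprn_gt0 ?scale_gt0 // ltr0n. Qed.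
Lemma square_val_gt0 : 0 < square_val. Proof. by rewrite invr_gt0 ltr0n muln_gt0. Qed.
Lemma square_val_lt1 : square_val < 1.
Proof. by rewrite invf_lt1 ?ltr0n ?muln_gt0 // ltr1n; lia. Qed.

Lemma frame_power_val_lt1 l : frame_power_val l < 1.
Proof.
rewrite /frame_power_val; case: ifP => _; first exact: square_val_lt1.
by apply: lt_trans ltr01; rewrite mulNr oppr_lt0 mulr_gt0 ?scale_gt0 ?ltr0n.
Qed.

Lemma offset_mx_sq j : offset_power_val j <= dot (row j offset_mx) (row j offset_mx).
Proof.
rewrite /offset_power_val; case: ifP => jK; last first.
  apply: (@le_trans _ _ 0); last by apply: sumr_ge0 => l _; rewrite -expr2 sqr_ge0.
  by rewrite mulNr oppr_le0 mulr_ge0 ?ler0n // ltW ?scale_gt0.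
apply: (@le_trans _ _ 1); first exact/ltW/square_val_lt1.
have jk : (j < k)%N by apply: ltn_trans jK _; rewrite leqnSn.
rewrite /dot (bigD1 (Ordinal jk)) //= !mxE jK eqxx mulNr mul1r opprK.
by rewrite lerDl; apply: sumr_ge0 => l _; rewrite -expr2 sqr_ge0.
Qed.

Lemma radius_offset_gt0 j : 0 < dot (row j offset_mx) (row j offset_mx) + rho_val
  - offset_power_val j.
Proof. by have := offset_mx_sq j; have := rho_val_gt0; lra. Qed.

Lemma radius_frame_gt0 l : 0 < 1 + rho_val - frame_power_val l.
Proof. by have := frame_power_val_lt1 l; have := rho_val_gt0; lra. Qed.

Lemma radius_origin : radius x0 idx0 = Num.sqrt rho_val.
Proof. by rewrite /radius /= /radius_row row_mxEl mxE. Qed.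
Lemma radius_frame l : radius x0 (idx_frame l) = Num.sqrt (1 + rho_val - frame_power_val l).
Proof. by rewrite /radius /= /radius_row row_mxEr row_mxEl mxE. Qed.
Lemma radius_offset j : radius x0 (idx_offset j) =
  Num.sqrt (dot (row j offset_mx) (row j offset_mx) + rho_val - offset_power_val j).
Proof. by rewrite /radius /= /radius_row row_mxEr row_mxEr mxE. Qed.

Lemma special_radius_gt0 i : 0 < radius x0 i.
Proof.
case: (idx_cover i) => [->|[l ->]|[j ->]].
- by rewrite radius_origin sqrtr_gt0 rho_val_gt0.
- by rewrite radius_frame sqrtr_gt0 radius_frame_gt0.
- by rewrite radius_offset sqrtr_gt0 radius_offset_gt0.
Qed.

Lemma center_ext i : center x0 i = consr 0 (row i center_mx).
Proof.
apply/rowP => l; rewrite /center /x0 !mxE raddf0.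
by case: (@fintype.split 1 k l) => j; rewrite !mxE.
Qed.

Lemma special_dependent : dependent_configs x0.
Proof.
split; first exact: special_radius_gt0.
exists (consr 1 0), 0; split.
  apply/negP => /eqP /rowP /(_ 0); rewrite consr0 mxE => /eqP.
  by rewrite oner_eq0.
by move=> i; rewrite center_ext dot_consr mulr0 dot0l addr0.
Qed.

Notation rc := (real_complex R).

Definition offset_mxC : 'M[C]_(K.+1, k) := map_mx rc offset_mx.
Definition frame_powerC : 'rV[C]_k := \row_l rc (frame_power_val l).

Lemma row_center_mx0 : row idx0 center_mx = 0.
Proof. by apply/rowP => l; rewrite !mxE; rewrite (unsplitK (inl _)) mxE. Qed.
Lemma row_center_mx_frame l : row (idx_frame l) center_mx = delta_mx 0 l.
Proof. by rewrite /center_mx /idx_frame rowKd rowKu row1. Qed.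
Lemma row_center_mx_offset j : row (idx_offset j) center_mx = row j offset_mx.
Proof. by rewrite /center_mx /idx_offset rowKd rowKd. Qed.

Lemma row_frame l : row l (frame_ x0) = consr 0 (delta_mx 0 l).
Proof.
rewrite rowK !center_ext row_center_mx0 row_center_mx_frame !toC_consr consrB rmorph0 subr0;
  congr (consr 0).
by apply/rowP => j; rewrite !mxE rmorph0 subr0 rmorph_nat.
Qed.

Lemma offset_special j : offset_ x0 j = consr 0 (row j offset_mxC).
Proof.
rewrite /offset !center_ext row_center_mx0 row_center_mx_offset !toC_consr consrB rmorph0 subr0;
  congr (consr 0).
by apply/rowP => l; rewrite !mxE rmorph0 subr0.
Qed.

Lemma gram_special : gram_ x0 = 1%:M.
Proof.
apply/matrixP => l l'.
have -> : gram_ x0 l l' = dot (row l (frame_ x0)) (row l' (frame_ x0)).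
  by rewrite dot_row -row_mul [RHS]mxE.
by rewrite !row_frame dot_consr mulr0 add0r dot_delta !mxE !eqxx eq_sym.
Qed.

Lemma gram_det_special : del_ x0 = 1.
Proof. by rewrite /gram_det gram_special det1. Qed.

Lemma gram_adj_special : AA_ x0 = 1%:M.
Proof. by rewrite /gram_adj gram_special adj1. Qed.

Lemma offset_coord_special j : bt_ x0 j = row j offset_mxC.
Proof.
rewrite /offset_coord gram_adj_special mulmx1; apply/rowP => l;
  rewrite -dot_row row_frame offset_special.
by rewrite dot_consr mulr0 add0r dot_delta.
Qed.

Lemma rho_special : rho_ x0 = rc rho_val.
Proof. by rewrite /rho radius_origin -rmorphXn /= sqr_sqrtr // ltW // rho_val_gt0. Qed.

Lemma frame_power_special : al_ x0 = frame_powerC.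
Proof.
apply/rowP => l; rewrite !mxE rho_special.
have -> : \sum_j frame_ x0 l j * (frame_ x0)^T j l = gram_ x0 l l by rewrite mxE.
rewrite gram_special mxE eqxx radius_frame -rmorphXn /= sqr_sqrtr;
  last exact/ltW/radius_frame_gt0.
by rewrite rmorphB rmorphD /= rmorph1; ring.
Qed.

Lemma offset_power_special j : eta_ x0 j = rc (offset_power_val j).
Proof.
rewrite /offset_power rho_special offset_special dot_consr mulr0 add0r radius_offset -rmorphXn
  /= sqr_sqrtr; last exact/ltW/radius_offset_gt0.
have -> : dot (row j offset_mxC) (row j offset_mxC) =
  rc (dot (row j offset_mx) (row j offset_mx)).
  by rewrite dot_morph map_row.
by rewrite -!rmorphB -rmorphD /=; congr rc; ring.
Qed.

Lemma sum_XY (V : nmodType) (G : 'I_k -> V) :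
  \sum_l G l = \sum_(l < K) G (inord l) + (G iX + G iY).
Proof.
rewrite !big_ord_recr /= -addrA; congr (_ + (G _ + G _)).
- apply: eq_bigr => l _; congr G; apply: val_inj; rewrite /= inordK //.
  by apply: ltn_trans (ltn_ord l) _; rewrite leqnSn.
- by apply: val_inj; rewrite /= val_iX.
- by apply: val_inj; rewrite /= val_iY.
Qed.

Lemma inord_ltK (l : 'I_K) : (inord l : 'I_k) = l :> nat.
Proof. by rewrite inordK //; apply: ltn_trans (ltn_ord l) _; rewrite leqnSn. Qed.

Definition sqroot : C := sqrtC (rc square_val).
Lemma sqroot_sq : sqroot ^+ 2 = rc square_val. Proof. exact: sqrtCK. Qed.
Lemma sqroot_neq0 : sqroot != 0.
Proof. by rewrite -sqrf_eq0 sqroot_sq fmorph_eq0 gt_eqF // square_val_gt0. Qed.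

Definition quad_coef (j : nat) : C := if (j < K)%N then 2%:R else 80%:R.
Lemma quad_coef_neq0 j : quad_coef j != 0.
Proof. by rewrite /quad_coef; case: ifP; rewrite pnatr_eq0. Qed.

Lemma tangent_sys_special_quad j : (j < K)%N -> sys0 j = quad_coef j *: sqdiff K sqroot j.
Proof.
move=> jK; have jK1 : (j < K.+1)%N by rewrite ltnW.
have jk : (j < k)%N by rewrite ltnW.
rewrite /tangent_sys jK1 offset_coord_special frame_power_special gram_det_special
  offset_power_special.
have EMj : map_mx mp (row (inord j : 'I_K.+1) offset_mxC) = - delta_mx 0 (inord j : 'I_k).
  apply/rowP => l; rewrite !mxE inordK // jK eqxx /= rmorphN rmorph_nat mpolyCN mpolyC_nat.
  by congr (- _%:R); rewrite -val_eqE /= inordK // eq_sym.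
have dl (y : 'rV[{mpoly C[k]}]_k) : dot (- delta_mx 0 (inord j : 'I_k)) y = - y 0 (inord j).
  by rewrite dotNl dotC dot_delta.
rewrite /quadricF EMj !dl [footF _ _ _ _]mxE linforms_low ?inordK // !mxE /frame_power_val
  /offset_power_val !inordK // jK.
rewrite /quad_coef jK /sqdiff sqroot_sq -mul_mpolyC mpolyC_nat mpolyC1; ring.
Qed.

Definition scaleP : {mpoly C[k]} := mp (rc scale).

Lemma scaleP144 : 144%:R * scaleP = 1.
Proof.
rewrite /scaleP -mpolyC_nat -mpolyCM -(rmorph_nat rc) -rmorphM /= /scale divff ?rmorph1 ?mpolyC1
  //.
by rewrite pnatr_eq0.
Qed.

Lemma frame_powerC_high (l : 'I_k) : (l < K)%N = false ->
  map_mx mp frame_powerC 0 l = - 108%:R * scaleP.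
Proof. by move=> h; rewrite !mxE /frame_power_val h rmorphM rmorphN rmorph_nat /= mpolyCM
  mpolyCN mpolyC_nat. Qed.

Lemma tangent_sys_special_conic : sys0 K = quad_coef K *: ('X_iX * 'X_iY).
Proof.
rewrite /tangent_sys ltnSn offset_coord_special frame_power_special gram_det_special
  offset_power_special.
pose h : {mpoly C[k]} := mp (2%:R^-1).
have h2 : 2%:R * h = 1.
  by rewrite /h -mpolyC_nat -mpolyCM divff ?mpolyC1 // pnatr_eq0.
have EMl (l : 'I_k) : map_mx mp (row (inord K : 'I_K.+1) offset_mxC) 0 l =
  5%:R * h * (K <= l)%N%:R.
  rewrite !mxE inordK // ltnn !rmorphM !rmorph_nat fmorphV rmorph_nat /=.
  by rewrite ?mpolyCM ?mpolyC_nat ?rmorph_nat /h.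
have dl (y : 'rV[{mpoly C[k]}]_k) :
    dot (map_mx mp (row (inord K : 'I_K.+1) offset_mxC)) y = 5%:R * h * (y 0 iX + y 0 iY).
  rewrite /dot sum_XY big1 ?add0r => [|l _].
    have kX : (K <= iX)%N by rewrite leqNgt iXK.
    have kY : (K <= iY)%N by rewrite leqNgt iYK.
    have EX := EMl iX; have EY := EMl iY; rewrite kX mulr1 in EX; rewrite kY mulr1 in EY.
    by rewrite EX EY mulrDr.
  by rewrite EMl inord_ltK leqNgt ltn_ord mulr0 mul0r.
rewrite /quadricF !dl ![footF _ _ _ _]mxE !frame_powerC_high ?iXK ?iYK // linforms_X linforms_Y.
rewrite /offset_power_val inordK // ltnn rmorphM rmorphN rmorph_nat /= mpolyCM mpolyCN
  mpolyC_nat -/scaleP.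
rewrite /quad_coef ltnn -mul_mpolyC mpolyC_nat mpolyC1.
set X := 'X_iX; set Y := 'X_iY.
have -> : (5%:R * h * (3%:R * X - Y + (3%:R * Y - X))) ^+ 2 + 1 * (5%:R * h *
   (-108%:R * scaleP - (3%:R * X - Y) ^+ 2 + (-108%:R * scaleP - (3%:R * Y - X) ^+ 2)))
   - 1 ^+ 2 * (- 540%:R * scaleP)
  = 25%:R * (2%:R * h) ^+ 2 * (X + Y) ^+ 2 - 540%:R * (2%:R * h - 1) * scaleP
    - 25%:R * (2%:R * h) * (X ^+ 2 + Y ^+ 2) + 30%:R * (2%:R * h) * (X * Y) by ring.
rewrite h2; ring.
Qed.

(** The squares of the zeros are - 36, - 12 and 17 times [scale], as found in
[sextic_on_line]. *)
Definition zero_of (c : C) : C := sqrtC (c * rc scale).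
Definition zero1 := zero_of (- 36%:R).
Definition zero2 := zero_of (- 12%:R).
Definition zero3 := zero_of (17%:R).
Definition sextic_zeros : seq C := [:: zero1; - zero1; zero2; - zero2; zero3; - zero3].

Lemma zero_of_sq c : zero_of c ^+ 2 = c * rc scale. Proof. exact: sqrtCK. Qed.

Lemma scaleC_neq0 : rc scale != 0.
Proof. by rewrite fmorph_eq0 gt_eqF // scale_gt0. Qed.

Lemma sextic_zeros_sq t : t \in sextic_zeros ->
  exists2 c : C, c \in [:: - 36%:R; - 12%:R; 17%:R] & t ^+ 2 = c * rc scale.
Proof.
have h c : c \in [:: - 36%:R; - 12%:R; 17%:R] -> forall t, t = zero_of c \/ t = - zero_of c ->
   exists2 c : C, c \in [:: - 36%:R; - 12%:R; 17%:R] & t ^+ 2 = c * rc scale.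
  by move=> hc t' [] ->; exists c; rewrite ?sqrrN ?zero_of_sq.
rewrite !inE => /orP [/eqP->|/orP [/eqP->|/orP [/eqP->|/orP [/eqP->|/orP [/eqP->|/eqP->]]]]].
- by apply: (h (- 36%:R)); rewrite ?inE ?eqxx ?orbT //; left.
- by apply: (h (- 36%:R)); rewrite ?inE ?eqxx ?orbT //; right.
- by apply: (h (- 12%:R)); rewrite ?inE ?eqxx ?orbT //; left.
- by apply: (h (- 12%:R)); rewrite ?inE ?eqxx ?orbT //; right.
- by apply: (h (17%:R)); rewrite ?inE ?eqxx ?orbT //; left.
- by apply: (h (17%:R)); rewrite ?inE ?eqxx ?orbT //; right.
Qed.

Lemma zero_of_neq0 c : c != 0 -> zero_of c != 0.
Proof. by move=> c_neq0; rewrite -sqrf_eq0 zero_of_sq mulf_neq0 ?scaleC_neq0. Qed.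

Lemma zero_of_neq c c' : c != c' ->
  (zero_of c == zero_of c') = false /\ (zero_of c == - zero_of c') = false.
Proof.
move=> cc; split; apply/negP => /eqP h; move: cc;
  rewrite -(inj_eq (mulIf scaleC_neq0)) -!zero_of_sq h ?sqrrN eqxx //.
Qed.

Lemma zero_of_opp c : c != 0 -> (zero_of c == - zero_of c) = false.
Proof.
by move=> c_neq0; apply/negbTE; rewrite -subr_eq0 opprK -mulr2n mulrn_eq0 /= zero_of_neq0.
Qed.

Lemma m36_neq0 : - 36%:R != 0 :> C. Proof. by rewrite oppr_eq0 pnatr_eq0. Qed.
Lemma m12_neq0 : - 12%:R != 0 :> C. Proof. by rewrite oppr_eq0 pnatr_eq0. Qed.
Lemma p17_neq0 : 17%:R != 0 :> C. Proof. by rewrite pnatr_eq0. Qed.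
Lemma m36_m12 : - 36%:R != - 12%:R :> C. Proof. by rewrite eqr_opp eqr_nat. Qed.
Lemma m36_p17 : - 36%:R != 17%:R :> C. Proof. by rewrite eq_sym -addr_eq0 -natrD pnatr_eq0. Qed.
Lemma m12_p17 : - 12%:R != 17%:R :> C. Proof. by rewrite eq_sym -addr_eq0 -natrD pnatr_eq0. Qed.

Lemma sextic_zeros_uniq : uniq sextic_zeros.
Proof.
have [a1 a2] := zero_of_neq m36_m12; have [a3 a4] := zero_of_neq m36_p17; have [a5 a6] :=
  zero_of_neq m12_p17.
have e a b : (- a == b :> C) = (a == - b) by rewrite eqr_oppLR.
rewrite /sextic_zeros /= !inE !e !opprK -!/(zero_of _) /zero1 /zero2 /zero3 a1 a2 a3 a4 a5 a6.
by rewrite !zero_of_opp ?m36_neq0 ?m12_neq0 ?p17_neq0.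
Qed.

Lemma sextic_zeros_neq0 : 0 \notin sextic_zeros.
Proof.
rewrite /sextic_zeros !inE ![0 == _]eq_sym !oppr_eq0 /zero1 /zero2 /zero3.
by rewrite !(negPf (zero_of_neq0 _)) ?m36_neq0 ?m12_neq0 ?p17_neq0.
Qed.

Definition sextic_coef : C := - 144%:R.
Lemma sextic_coef_neq0 : sextic_coef != 0. Proof. by rewrite oppr_eq0 pnatr_eq0. Qed.

Lemma zero_ofP_sq c : mp (zero_of c) ^+ 2 = mp c * scaleP.
Proof. by rewrite -(rmorphXn mp) /= zero_of_sq mpolyCM. Qed.

Lemma root_poly_expand i : root_poly sextic_zeros sextic_coef i =
  - 144%:R * (('X_i ^+ 2 + 36%:R * scaleP) *
  (('X_i ^+ 2 + 12%:R * scaleP) * ('X_i ^+ 2 - 17%:R * scaleP))) :> {mpoly C[k]}.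
Proof.
have E (x a b c : {mpoly C[k]}) : (x - a) * ((x - - a) * ((x - b) * ((x - - b) *
    ((x - c) * ((x - - c) * 1))))) = (x ^+ 2 - a ^+ 2) * ((x ^+ 2 - b ^+ 2) * (x ^+ 2 - c ^+ 2)).
  by ring.
have N c : mp (- zero_of c) = - mp (zero_of c) by apply: mpolyCN.
have N36 : mp (- 36%:R) = - 36%:R by rewrite mpolyCN mpolyC_nat.
have N12 : mp (- 12%:R) = - 12%:R by rewrite mpolyCN mpolyC_nat.
have N144 : mp sextic_coef = - 144%:R by rewrite /sextic_coef mpolyCN mpolyC_nat.
have N17 : mp 17%:R = 17%:R by rewrite mpolyC_nat.
rewrite /root_poly -mul_mpolyC N144 /sextic_zeros 6!big_cons big_nil (N (- 36%:R)) (N (- 12%:R))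
  (N 17%:R).
rewrite E (zero_ofP_sq (- 36%:R)) (zero_ofP_sq (- 12%:R)) (zero_ofP_sq 17%:R) N36 N12 N17.
by rewrite !mulNr !opprK.
Qed.

(** On either line the first [K] entries of the foot vanish, and those of
[u] contribute 1/2 to [u.u]. With 1 written as [144 * scale] and 1/2 as
[72 * scale], the claim is an identity between polynomials homogeneous in
[X ^+ 2] and [scale]. *)
Lemma sextic_on_line (phi : {rmorphism {mpoly C[k]} -> {mpoly C[k]}}) (X : {mpoly C[k]}) :
  (forall c, phi (mp c) = mp c) ->
  (forall l : 'I_k, (l < K)%N -> phi (linforms 0 l) ^+ 2 = mp (sqroot ^+ 2)) ->
  (phi (linforms 0 iX) = 3%:R * X /\ phi (linforms 0 iY) = - X) \/
  (phi (linforms 0 iX) = - X /\ phi (linforms 0 iY) = 3%:R * X) ->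
  phi (sys0 K.+1) = - 144%:R * ((X ^+ 2 + 36%:R * scaleP) *
  ((X ^+ 2 + 12%:R * scaleP) * (X ^+ 2 - 17%:R * scaleP))).
Proof.
move=> hC hl hXY.
have mC p q (M : 'M[C]_(p, q)) : map_mx phi (map_mx mp M) = map_mx mp M.
  by apply/matrixP => i j; rewrite !mxE hC.
rewrite /tangent_sys ltnn eqxx sexticF_morph !mC /= !hC gram_adj_special frame_power_special
  gram_det_special rho_special.
set u := map_mx phi linforms.
have ul (l : 'I_K) : u 0 (inord l) ^+ 2 = mp (sqroot ^+ 2) by rewrite mxE hl // inord_ltK.
have Kl (l : 'I_K) : footF (map_mx mp frame_powerC) u 0 (inord l) = 0.
  by rewrite mxE ul !mxE /frame_power_val inord_ltK ltn_ord sqroot_sq subrr.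
have KX : footF (map_mx mp frame_powerC) u 0 iX = - 108%:R * scaleP - u 0 iX ^+ 2.
  by rewrite mxE frame_powerC_high ?iXK.
have KY : footF (map_mx mp frame_powerC) u 0 iY = - 108%:R * scaleP - u 0 iY ^+ 2.
  by rewrite mxE frame_powerC_high ?iYK.
have dK (y : 'rV[{mpoly C[k]}]_k) : dot (footF (map_mx mp frame_powerC) u) y =
   (- 108%:R * scaleP - u 0 iX ^+ 2) * y 0 iX + (- 108%:R * scaleP - u 0 iY ^+ 2) * y 0 iY.
  by rewrite /dot sum_XY big1 ?add0r ?KX ?KY // => l _; rewrite Kl mul0r.
have du : dot u u = 72%:R * scaleP + (u 0 iX ^+ 2 + u 0 iY ^+ 2).
  rewrite /dot sum_XY -!expr2; congr (_ + _).
  under eq_bigr => l _ do rewrite -expr2 ul.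
  rewrite sumr_const card_ord -(rmorphMn mp) /= sqroot_sq -rmorphMn /= /scaleP -mpolyC_nat
    -mpolyCM.
  rewrite -(rmorph_nat rc) -rmorphM /= /square_val /scale; congr (mp (rc _)).
  rewrite natrM -mulr_natr; field; by rewrite pnatr_eq0 -lt0n.
rewrite /sexticF /normal_partF map_mx1 !mulmx1 !dK du KX KY.
have -> : mp 1 = 144%:R * scaleP by rewrite scaleP144 mpolyC1.
have -> : mp (rc rho_val) = 2160%:R * scaleP ^+ 2.
  by rewrite /rho_val rmorphM rmorphXn rmorph_nat /= mpolyCM rmorphXn mpolyC_nat.
have -> : 4%:R * (2160%:R * scaleP ^+ 2) * (144%:R * scaleP) = 8640%:R * scaleP ^+ 2.
  by rewrite scaleP144; ring.
have -> : u 0 iX = phi (linforms 0 iX) by rewrite mxE.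
have -> : u 0 iY = phi (linforms 0 iY) by rewrite mxE.
by case: hXY => -[-> ->]; ring.
Qed.

Lemma rmorph_linform (phi : {rmorphism {mpoly C[k]} -> {mpoly C[k]}}) (x y : {mpoly C[k]}) :
  phi (3%:R * x - y) = 3%:R * phi x - phi y.
Proof. by rewrite rmorphB rmorphM rmorph_nat. Qed.

Lemma linforms_low_sq i (l : 'I_k) eps : (l < K)%N -> i = iX \/ i = iY ->
  msubst1 i 0 (sign_subst sqroot K eps (linforms 0 l)) ^+ 2 = mp (sqroot ^+ 2).
Proof.
move=> lK _; rewrite linforms_low // /sign_subst msubstX lK msubst1C -rmorphXn /=; congr mp.
by rewrite /sign_of; case: (eps l); rewrite ?sqrrN.
Qed.

Lemma tangent_sys_special_line (i j : 'I_k) eps :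
  (i = iY /\ j = iX) \/ (i = iX /\ j = iY) ->
  msubst1 i 0 (sign_subst sqroot K eps (sys0 K.+1)) = root_poly sextic_zeros sextic_coef j.
Proof.
pose phi : {rmorphism {mpoly C[k]} -> {mpoly C[k]}} := msubst1 i 0 \o sign_subst sqroot K eps.
move=> ij; rewrite root_poly_expand; apply: (@sextic_on_line phi).
- by move=> c; rewrite /= /sign_subst msubstC msubst1C.
- by move=> l lK /=; apply: linforms_low_sq => //; case: ij => -[]; [right|left].
have phiX (l : 'I_k) : (l < K)%N = false -> phi 'X_l = if l == i then 0 else 'X_l.
  by move=> lK; rewrite /= /sign_subst msubstX lK msubst1X mpolyC0.
rewrite linforms_X linforms_Y !rmorph_linform !phiX ?iXK ?iYK //.
by case: ij => -[-> ->]; [left|right]; rewrite eqxx ?iYX ?(negPf (XYneq K)) mulr0 ?subr0 ?sub0r.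
Qed.

Lemma tangent_sys_special_lastY eps :
  msubst1 iY 0 (sign_subst sqroot K eps (sys0 K.+1)) = root_poly sextic_zeros sextic_coef iX.
Proof. by apply: tangent_sys_special_line; left. Qed.

Lemma tangent_sys_special_lastX eps :
  msubst1 iX 0 (sign_subst sqroot K eps (sys0 K.+1)) = root_poly sextic_zeros sextic_coef iY.
Proof. by apply: tangent_sys_special_line; right. Qed.

Notation I := (pt_index K).
Notation spt := (@pt C K sqroot sextic_zeros).

(** At a zero with [X^2 = c * scale], or the same for [Y], the value is
[(72 - 10 c) * scale], and [c] is one of - 36, - 12 and 17. *)
Lemma normal_sys_special i : (normal_sys x0).@[spt i] != 0.
Proof.
case: i => [e [b r]]; set z := spt _.
have -> : (normal_sys x0).@[z] = normal_partF 1%:M 1 (map_mx (meval z) linforms).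
  rewrite /normal_sys (normal_partF_morph (meval z)) map_meval gram_adj_special gram_det_special.
  by congr (normal_partF _ _ _); apply: mevalC.
rewrite /normal_partF mulmx1.
have zt : sextic_zeros`_r \in sextic_zeros by apply: roots_nth.
have [c hc tc] := sextic_zeros_sq zt.
set u := map_mx (meval z) linforms.
have zl (l : 'I_k) : (l < K)%N -> z l ^+ 2 = sqroot ^+ 2.
  by move=> lK; rewrite /z /pt /sign_pt lK /sign_of; case: (sign_ext _ _); rewrite ?sqrrN.
have zX : z iX = if b then sextic_zeros`_r else 0.
  by rewrite /z /pt /sign_pt iXK eqxx /=; case: (b).
have zY : z iY = if b then 0 else sextic_zeros`_r.
  by rewrite /z /pt /sign_pt iYK iYX /=; case: (b).
have uX : u 0 iX = 3%:R * z iX - z iY by rewrite mxE linforms_X mevalB mevalM !mevalXU rmorph_nat.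
have uY : u 0 iY = 3%:R * z iY - z iX by rewrite mxE linforms_Y mevalB mevalM !mevalXU rmorph_nat.
have ul (l : 'I_K) : u 0 (inord l) ^+ 2 = sqroot ^+ 2.
  by rewrite mxE linforms_low ?inord_ltK // mevalXU zl // inord_ltK.
have -> : dot u u = 72%:R * rc scale + (u 0 iX ^+ 2 + u 0 iY ^+ 2).
  rewrite /dot sum_XY -!expr2; congr (_ + _).
  under eq_bigr => l _ do rewrite -expr2 ul.
  rewrite sumr_const card_ord sqroot_sq -rmorphMn /= -(rmorph_nat rc) -rmorphM /= /square_val
    /scale.
  congr (rc _); rewrite natrM -mulr_natr; field; by rewrite pnatr_eq0 -lt0n.
have -> : u 0 iX ^+ 2 + u 0 iY ^+ 2 = 10%:R * (c * rc scale).
  by rewrite uX uY zX zY -tc; case: (b); ring.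
have t144 : 144%:R * rc scale = 1.
  by rewrite -(rmorph_nat rc) -rmorphM /= /scale divff ?rmorph1 // pnatr_eq0.
have -> : 1 - (72%:R * rc scale + 10%:R * (c * rc scale))
   = (72%:R - 10%:R * c) * rc scale by rewrite -[X in X - _]t144; ring.
rewrite mulf_neq0 ?scaleC_neq0 //; move: hc; rewrite !inE => /orP [/eqP->|/orP [/eqP->|/eqP->]].
- by rewrite mulrN opprK -natrM -natrD pnatr_eq0.
- by rewrite mulrN opprK -natrM -natrD pnatr_eq0.
- by rewrite subr_eq0 -natrM eqr_nat.
Qed.

Lemma sys_deg_le j : (sys_deg K j <= 6)%N.
Proof. by rewrite /sys_deg; case: ifP. Qed.

(** * Generic configurations *)

(** Three conditions that hold near the special configuration, hence where one
polynomial does not vanish: the system has as many zeros as there, the normal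
part is nonzero at all of them, and the frame is a basis of the hyperplane. *)
Theorem generic_tangents : exists a : T -> C, [/\ polyfun a, a x0 != 0
  & forall x, a x != 0 -> affinely_dependent x ->
      common_tangents x #= `I_(2 ^ K * 12)%N].
Proof.
have inj (i i' : I) : spt i =1 spt i' -> i = i'.
  exact: (pt_inj sqroot_neq0 (two_neq0 R) sextic_zeros_uniq erefl sextic_zeros_neq0).
have [l lsz linj] := separating_form inj.
have hsz := @tangent_sys_size x0.
have hne j : (j < k)%N -> sys0 j != 0.
  exact: (sys_neq0 sqroot_neq0 sextic_zeros_neq0 sextic_coef_neq0 quad_coef_neq0
    tangent_sys_special_quad tangent_sys_special_conic tangent_sys_special_lastY).
have hreg j D g : (j < k)%N -> (msize g <= D - sys_deg K j)%N ->
    tideal sys0 (sys_deg K) j D (g * sys0 j) -> tideal sys0 (sys_deg K) j (D - sys_deg K j) g.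
  exact: (sys_regular sqroot_neq0 (two_neq0 R) sextic_zeros_neq0 sextic_coef_neq0 quad_coef_neq0
    hsz tangent_sys_special_quad tangent_sys_special_conic tangent_sys_special_lastY
    tangent_sys_special_lastX).
have hzero i : common_zero sys0 k (spt i).
  by move=> j jk; exact: (pt_common_zero (ts := sextic_zeros) erefl tangent_sys_special_quad
    tangent_sys_special_conic tangent_sys_special_lastY tangent_sys_special_lastX i jk).
have hrad D g : (msize g <= D)%N -> (forall i, g.@[spt i] = 0) -> tideal sys0 (sys_deg K) k D g.
  exact: (pt_radical sqroot_neq0 (two_neq0 R) sextic_zeros_uniq erefl sextic_zeros_neq0
    sextic_coef_neq0 quad_coef_neq0 hsz tangent_sys_special_quad tangent_sys_special_conic
    tangent_sys_special_lastY tangent_sys_special_lastX).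
have I0 : (0 < #|{: I}|)%N by rewrite card_pt_index muln_gt0 expn_gt0.
have hdeg j : (j < k)%N -> (sys_deg K j <= 6)%N by move=> _; apply: sys_deg_le.
have G1 := generic_count (@polyfunC R m n) (@polyfunD R m n) (@polyfunM R m n) tangent_sys_size
  tangent_sys_polyfun
  (isT : (1 < 6)%N) hdeg hne hreg lsz linj hzero hrad I0.
have hwsz (x : T) : (msize (normal_sys x) <= 2.+1)%N by apply: msize_normal_partF;
  apply: linforms_size.
have G2 := generically_nonzero (@polyfunC R m n) (@polyfunD R m n) (@polyfunM R m n)
  tangent_sys_size tangent_sys_polyfun
  lsz linj hrad I0 normal_sys_polyfun hwsz normal_sys_special.
have G3 : generically (@polyfun R m n) x0 (fun x => del_ x != 0).
  exists (fun x => del_ x); split => //; first exact: polyfun_gram_det.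
  by rewrite gram_det_special oner_eq0.
have [a [Aa a0 aP]] := generically_and (@polyfunM R m n) G1
  (generically_and (@polyfunM R m n) G2 G3).
exists a; split => // x /aP [[phi [phi_inj phiP]] [wn dn]] dep.
have w0 u : direction_ x u -> normal_part_ x u != 0.
  by move=> us; rewrite -[u]dir_coords_invK -normal_sys_eval; apply: wn; apply/tangent_sys_zero;
    rewrite dir_coords_invK.
have [line_of [L1 L2 L3]] := tangents_param idx_cover dn dep w0.
have us i : direction_ x (dir_coords (phi i)) by apply/tangent_sys_zero/phiP; exists i.
rewrite -card_pt_index; apply: (@card_eq_ordinal _ _ _ (fun i => line_of (dir_coords (phi i)))).
  move=> i j /L2 => /(_ (us i) (us j)) /(congr1 dir_coords_inv).
  by rewrite !dir_coordsK => /phi_inj.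
move=> L; split=> [/L3 [u uu ->]|[i ->]]; last exact: L1.
have /phiP [i E] : common_zero (tangent_sys x) k (dir_coords_inv u 0) by apply/tangent_sys_zero;
  rewrite dir_coords_invK.
by exists i; rewrite -E dir_coords_invK.
Qed.

(** A complex polynomial in the coordinates of a configuration is nonzero when
its real part or its imaginary part is, which is a Zariski open condition over
the reals. Density follows from [dependent_irreducible]. *)
Theorem generic_number_of_tangents : exists U : set T,
     [/\ zariski_open_in (@dependent_configs R m n) U,
         U !=set0,
         zariski_dense_in (@dependent_configs R m n) U
       & forall x, U x -> common_tangents x #= `I_(2 ^ K * 12)%N].
Proof.
have [a [pa a0 aP]] := generic_tangents.
have [f [g fg]] := polyfun_real pa.
pose Z : set T := [set x | forall h, [set f; g] h -> h.@[coords x 0] = 0].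
have ZP x : ~ Z x <-> a x != 0.
  split=> [nZ|ax Zx].
    apply/negP => /eqP /fg [h1 h2]; apply: nZ => h [] -> //.
  move/negP: ax; apply; apply/eqP/fg; split; apply: Zx; [by left|by right].
exists (@dependent_configs R m n `\` Z); split.
- by exists Z => //; exists [set f; g].
- by exists x0; split; [apply: special_dependent|apply/ZP].
- move=> V [W [S SE] ->] [x1 [X1 nW]].
  have [h [Sh hx1]] : exists h, S h /\ h.@[coords x1 0] != 0.
    apply: contrapT => nex; apply: nW; rewrite SE => h Sh; apply/eqP.
    by apply: contrapT => hx; apply: nex; exists h; split => //; apply/negP.
  have [f' [f'P f'0]] : exists f', [set f; g] f' /\ f'.@[coords x0 0] != 0.
    have [fx|fx] := eqVneq (f.@[coords x0 0]) 0; last by exists f; split => //; left.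
    exists g; split; first by right.
    by apply: contra a0 => /eqP gx; apply/eqP/fg.
  have [y [Xy fy hy]] := dependent_irreducible special_dependent X1 f'0 hx1.
  exists y; split; split => //.
    by move=> Zy; move: fy; rewrite (Zy _ f'P) eqxx.
  by rewrite SE => Wy; move: hy; rewrite (Wy _ Sh) eqxx.
- by move=> x [[_ dep] /ZP ax]; apply: aP.
Qed.

End Instance.

(** * A configuration with real tangents only *)

Lemma card_eq_fin (T : Type) (A : set T) (I : finType) (g : I -> T) : injective g ->
  (forall y, A y <-> exists i, y = g i) -> A #= `I_#|I|.
Proof.
move=> gi gA; apply: (@card_eq_ordinal _ _ _ (g \o enum_val)).
  by move=> i j /gi /enum_val_inj.
move=> y; rewrite gA; split=> [[i ->]|[i ->]]; last by exists (enum_val i).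
by exists (enum_rank i); rewrite /= enum_rankK.
Qed.

Lemma consrN (S : comNzRingType) (n : nat) (a : S) (y : 'rV[S]_n) :
  - consr a y = consr (- a) (- y).
Proof. by apply: eq_consr => [|j]; rewrite [LHS]mxE ?consr0 // !consrS mxE. Qed.

Section CrossPolytope.
Variables (R : rcfType) (q' : nat).
Notation q := q'.+1.
Notation C := R[i].
Notation rc := (real_complex R).

(** The number [1 - r^2] for the common radius [r]. Any value strictly between 0
and [1 / q] would give as many lines; at the midpoint [gap] and [1 / q - gap]
are equal. *)
Definition gap : R := (2 * q)%:R^-1.
Definition cross_centers : 'M[R]_(q + q, q) := col_mx 1%:M (- 1%:M).
Definition cross : config R (q + q) q.+1 :=
  (row_mx (0 : 'M_(q + q, 1)) cross_centers : 'M_(q + q, 1 + q),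
   const_mx (Num.sqrt (1 - gap))).

Lemma gap_gt0 : 0 < gap. Proof. by rewrite invr_gt0 ltr0n muln_gt0. Qed.

Lemma gap_lt1 : gap < 1.
Proof. by rewrite invf_lt1 ?ltr0n ?muln_gt0 // ltr1n; lia. Qed.

Lemma cross_radius i : radius cross i = Num.sqrt (1 - gap).
Proof. by rewrite /radius mxE. Qed.

Lemma cross_center i : center cross i = consr 0 (row i cross_centers).
Proof.
apply/rowP => l; rewrite /center /cross !mxE raddf0.
by case: (@fintype.split 1 q l) => j; rewrite !mxE.
Qed.

Lemma cross_center_pos j : center cross (lshift q j) = consr 0 (delta_mx 0 j).
Proof. by rewrite cross_center rowKu row1. Qed.

Lemma cross_center_neg j : center cross (rshift q j) = consr 0 (- delta_mx 0 j).
Proof.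
rewrite cross_center rowKd; congr consr; apply/rowP => l.
by rewrite !mxE eqxx eq_sym.
Qed.

Lemma cross_center_inj : injective (fun i => center cross i).
Proof.
move=> i i' E.
have {}E : row i cross_centers = row i' cross_centers.
  apply/rowP => j; have /rowP /(_ (lift 0 j)) := E.
  by rewrite !cross_center !consrS.
case: (split_ordP i) (split_ordP i') E => [j ->|j ->] [j' ->|j' ->];
  rewrite ?rowKu ?rowKd => /rowP /(_ j); rewrite !mxE eqxx;
  case: (eqVneq j' j) => [->|_] //= h; exfalso; move: h; rewrite ?mulr0n ?mulr1n; lra.
Qed.

Lemma cross_dep : affinely_dependent cross.
Proof.
exists (consr 1 0), 0; split.
  apply/negP => /eqP /rowP /(_ 0); rewrite consr0 mxE => /eqP.
  by rewrite oner_eq0.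
by move=> i; rewrite cross_center dot_consr mulr0 dot0l addr0.
Qed.

Lemma consr_eta (S : comNzRingType) (w : 'rV[S]_q.+1) :
  w = consr (w 0 0) (\row_j w 0 (lift 0 j)).
Proof. by apply: eq_consr => [|j]; rewrite ?consr0 ?consrS ?mxE. Qed.

Lemma toC_delta j : toC (delta_mx 0 j : 'rV[R]_q) = delta_mx 0 j.
Proof. by apply/rowP => l; rewrite !mxE rmorph_nat. Qed.

Lemma cross_radius_sq i : rc (radius cross i) ^+ 2 = 1 - rc gap.
Proof.
rewrite cross_radius -rmorphXn /= sqr_sqrtr ?rmorphB ?rmorph1 //.
by rewrite subr_ge0 ltW ?gap_lt1.
Qed.

(** Index 0 is the coordinate along the normal. The conditions for the centers
[e_j] and [- e_j] differ by [4 p_j], so that [p] is on the normal line. *)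
Lemma cross_tangent_iff (p v : 'rV[C]_q.+1) : dot v v = 1 -> dot p v = 0 ->
  (forall i, tangent p v (center cross i) (radius cross i)) <->
  forall j, p 0 (lift 0 j) = 0 /\ v 0 (lift 0 j) ^+ 2 = p 0 0 ^+ 2 + rc gap.
Proof.
move=> v1 pv.
have dvd j : dot v (consr 0 (delta_mx 0 j)) = v 0 (lift 0 j).
  by rewrite {1}(consr_eta v) dot_consr mulr0 add0r dot_delta mxE.
have dpd j : dot p (consr 0 (delta_mx 0 j)) = p 0 (lift 0 j).
  by rewrite {1}(consr_eta p) dot_consr mulr0 add0r dot_delta mxE.
have ddd j : dot (consr 0 (delta_mx 0 j)) (consr 0 (delta_mx 0 j)) = 1 :> C.
  by rewrite dot_consr mulr0 add0r dot_delta mxE !eqxx.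
have tP (sgn : C) i j : toC (center cross i) = sgn *: consr 0 (delta_mx 0 j) -> sgn ^+ 2 = 1 ->
   tangent p v (center cross i) (radius cross i) <->
   v 0 (lift 0 j) ^+ 2 = dot p p - 2%:R * sgn * p 0 (lift 0 j) + rc gap.
  move=> E s2; rewrite /tangent E /= cross_radius_sq v1 mul1r !dotL (dotC v p) pv.
  rewrite [dot (consr _ _) p]dotC dvd dpd ddd mulr1 add0r sqrrN exprMn s2 mul1r.
  have -> : dot p p - sgn * p 0 (lift 0 j) - sgn * (p 0 (lift 0 j) - sgn) - (1 - rc gap)
    = dot p p - 2%:R * sgn * p 0 (lift 0 j) + rc gap + (sgn ^+ 2 - 1) by ring.
  by rewrite s2 subrr addr0.
have tpos j : toC (center cross (lshift q j)) = 1 *: consr 0 (delta_mx 0 j).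
  by rewrite cross_center_pos toC_consr rmorph0 toC_delta scale1r.
have tneg j : toC (center cross (rshift q j)) = -1 *: consr 0 (delta_mx 0 j).
  rewrite cross_center_neg toC_consr rmorph0 scaleN1r consrN oppr0; congr consr.
  by rewrite -toC_delta; apply/rowP => l; rewrite !mxE rmorphN.
have two0 : (2%:R : C) != 0 by rewrite pnatr_eq0.
have pp : (forall j, p 0 (lift 0 j) = 0) -> dot p p = p 0 0 ^+ 2.
  move=> h; rewrite /dot big_ord_recl -expr2 big1 ?addr0 // => j _.
  by rewrite h mulr0.
split=> [T|H].
  have p0 j : p 0 (lift 0 j) = 0.
    have /(tP 1 _ j (tpos j) (expr1n _ _)) E1 := T (lshift q j).
    have /(tP (-1) _ j (tneg j)) E2 := T (rshift q j).
    have {}E2 := E2 (_ : (-1) ^+ 2 = 1); rewrite sqrrN expr1n in E2.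
    have := E2 erefl; rewrite E1 => /eqP; rewrite -subr_eq0.
    have -> : dot p p - 2%:R * 1 * p 0 (lift 0 j) + rc gap -
      (dot p p - 2%:R * -1 * p 0 (lift 0 j) + rc gap) = - (2%:R * 2%:R) * p 0 (lift 0 j) by ring.
    by rewrite mulf_eq0 oppr_eq0 mulf_eq0 (negPf two0) => /eqP.
  move=> j; split=> //.
  have /(tP 1 _ j (tpos j) (expr1n _ _)) -> := T (lshift q j).
  by rewrite p0 mulr0 subr0 pp.
have {}pp : dot p p = p 0 0 ^+ 2 by apply: pp => j; case: (H j).
move=> i; case: (split_ordP i) => j ->; have [h1 h2] := H j.
  by apply/(tP 1 _ j (tpos j) (expr1n _ _)); rewrite h2 h1 pp mulr0 subr0.
apply/(tP (-1) _ j (tneg j)); first by rewrite sqrrN expr1n.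
by rewrite h2 h1 pp mulr0 subr0.
Qed.

Definition sgn (b : bool) : R := if b then 1 else -1.
Definition sign_row (e : {ffun 'I_q -> bool}) : 'rV[R]_q := \row_j sgn (e j).
Definition sqrt_gap : R := Num.sqrt gap.
Definition sqrt_2gap : R := Num.sqrt (2%:R * gap).
Definition sqrt_half : R := Num.sqrt 2%:R^-1.
(** As [p] is on the normal line, [p.v = 0] means that [p = 0] or that [v] is
parallel to the hyperplane; the boolean tells which. Opposite directions give
the same line: in the first case the normal component of [v] is taken positive,
in the second the sign of the first coordinate of [v] is taken to be that of
the normal coordinate of [p]. *)
Definition line_point (i : bool * {ffun 'I_q -> bool}) : 'rV[R]_q.+1 :=
  if i.1 then 0 else consr (sgn (i.2 0) * sqrt_gap) 0.
Definition line_dir (i : bool * {ffun 'I_q -> bool}) : 'rV[R]_q.+1 :=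
  if i.1 then consr sqrt_half (sqrt_gap *: sign_row i.2) else consr 0 (sqrt_2gap *: sign_row i.2).
Definition cross_line i : set 'rV[C]_q.+1 := cline (toC (line_point i)) (toC (line_dir i)).

Lemma sgn_sq b : sgn b ^+ 2 = 1.
Proof. by case: b; rewrite /sgn ?sqrrN expr1n. Qed.

Lemma sgn_neg b : sgn (~~ b) = - sgn b.
Proof. by case: b; rewrite /sgn ?opprK. Qed.

Lemma sqrt_gap_sq : sqrt_gap ^+ 2 = gap. Proof. by rewrite sqr_sqrtr // ltW ?gap_gt0. Qed.
Lemma sqrt_2gap_sq : sqrt_2gap ^+ 2 = 2%:R * gap.
Proof. by rewrite sqr_sqrtr // mulr_ge0 ?ler0n // ltW ?gap_gt0. Qed.
Lemma sqrt_half_sq : sqrt_half ^+ 2 = 2%:R^-1. Proof. by rewrite sqr_sqrtr // invr_ge0 ler0n. Qed.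
Lemma sqrt_gap_gt0 : 0 < sqrt_gap. Proof. by rewrite sqrtr_gt0 gap_gt0. Qed.
Lemma sqrt_2gap_gt0 : 0 < sqrt_2gap. Proof. by rewrite sqrtr_gt0 mulr_gt0 ?gap_gt0 ?ltr0n. Qed.
Lemma sqrt_half_gt0 : 0 < sqrt_half. Proof. by rewrite sqrtr_gt0 invr_gt0 ltr0n. Qed.

Lemma qgap : q%:R * gap = 2%:R^-1.
Proof. by rewrite /gap natrM invfM mulrCA divff ?mulr1 // pnatr_eq0. Qed.

Lemma dot_sign_row e : dot (sign_row e) (sign_row e) = q%:R.
Proof.
rewrite /dot (eq_bigr (fun=> 1)) ?sumr_const ?card_ord // => j _.
by rewrite mxE -expr2 sgn_sq.
Qed.

Lemma line_dir_unit i : dot (line_dir i) (line_dir i) = 1.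
Proof.
have h : (2%:R : R)^-1 + 2%:R^-1 = 1 by field.
case: i => [[] e]; rewrite /line_dir /= dot_consr !dotL dot_sign_row mulrA -expr2.
  by rewrite -expr2 sqrt_half_sq sqrt_gap_sq mulrC qgap.
by rewrite expr0n add0r -expr2 sqrt_2gap_sq -mulrA (mulrC gap) qgap divff // pnatr_eq0.
Qed.

Lemma line_point_dir i : dot (line_point i) (line_dir i) = 0.
Proof.
case: i => [[] e]; rewrite /line_point /line_dir /=; first by rewrite dot0l.
by rewrite dot_consr mulr0 dot0l addr0.
Qed.

Lemma cross_line_tangent i : (common_tangents cross `&` @real_line R q.+1) (cross_line i).
Proof.
have v1 : dot (toC (line_dir i)) (toC (line_dir i)) = 1 by rewrite toC_dot line_dir_unit rmorph1.
have pv : dot (toC (line_point i)) (toC (line_dir i)) = 0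
  by rewrite toC_dot line_point_dir rmorph0.
have v0 : line_dir i != 0 by apply: contra_eq_neq (line_dir_unit i) => ->;
  rewrite dot0l eq_sym oner_eq0.
split; last by exists (line_point i), (line_dir i).
exists (toC (line_point i)), (toC (line_dir i)); split=> //.
  by apply: contra_eq_neq v1 => ->; rewrite dot0l eq_sym oner_eq0.
apply/(cross_tangent_iff v1 pv) => j; rewrite /toC !mxE.
case: i {v1 pv v0} => [[] e]; rewrite /line_point /line_dir /=.
  by rewrite mxE consrS !mxE rmorph0 expr0n add0r -rmorphXn /= exprMn sgn_sq mulr1 sqrt_gap_sq.
rewrite !consrS consr0 !mxE rmorph0; split=> //.
rewrite -!rmorphXn /= -rmorphD /= !exprMn !sgn_sq mul1r mulr1 sqrt_gap_sq sqrt_2gap_sq;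
  congr rc; ring.
Qed.

Lemma sgn_inj : injective sgn.
Proof. by move=> [] [] //=; rewrite /sgn; lra. Qed.

Lemma sign_row_inj (c : R) e e' : 0 < c -> c *: sign_row e = c *: sign_row e' -> e = e'.
Proof.
move=> c0 /(scalerI (lt0r_neq0 c0)) /rowP E; apply/ffunP => j.
by have := E j; rewrite !mxE => /sgn_inj.
Qed.

Lemma toC_inj n : injective (@toC R n).
Proof.
move=> y z /rowP E; apply/rowP => j; have := E j.
by rewrite !mxE => /complexI.
Qed.

Lemma cross_line_inj : injective cross_line.
Proof.
move=> i i' E.
have v1 i0 : dot (toC (line_dir i0)) (toC (line_dir i0)) = 1
  by rewrite toC_dot line_dir_unit rmorph1.
have pv i0 : dot (toC (line_point i0)) (toC (line_dir i0)) = 0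
  by rewrite toC_dot line_point_dir rmorph0.
have [|] := @normalize_inj R _ 0 _ _ _ _ (v1 i) (pv i) (v1 i') (pv i').
  by rewrite !add0r; apply: E.
move=> /toC_inj pp vv.
have {}vv : line_dir i' = line_dir i \/ line_dir i' = - line_dir i.
  case: vv => [/toC_inj|h]; [by left|right; apply: toC_inj; rewrite h].
  by apply/rowP => j; rewrite !mxE rmorphN.
have cneq c y : c != 0 -> consr c y != 0 :> 'rV[R]_q.+1.
  move=> c0; apply: contra c0 => /eqP /(congr1 (fun w : 'rV_q.+1 => w 0 0)).
  by rewrite consr0 mxE => ->.
have sA b : sgn b * sqrt_gap != 0.
  by rewrite mulf_neq0 ?(lt0r_neq0 sqrt_gap_gt0) // -sqrf_eq0 sgn_sq oner_eq0.
have cS c y c' y' : consr c y = consr c' y' :> 'rV[R]_q.+1 -> c = c' /\ y = y'.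
  move=> /rowP h; split; first by have := h 0; rewrite !consr0.
  by apply/rowP => j; have := h (lift 0 j); rewrite !consrS.
case: i i' pp vv {E} => [b e] [b' e']; rewrite /line_point /line_dir /=; case: b; case: b' => /=.
- move=> _ []; rewrite ?consrN => /cS [h1 h2]; first by rewrite (sign_row_inj sqrt_gap_gt0 h2).
  by exfalso; have := sqrt_half_gt0; lra.
- by move/eqP; rewrite (negPf (cneq _ _ (sA _))).
- by move/esym/eqP; rewrite (negPf (cneq _ _ (sA _))).
- move=> /cS [h _] []; rewrite ?consrN => /cS [_ h2];
  first by rewrite (sign_row_inj sqrt_2gap_gt0 h2).
  have {}h := mulIf (lt0r_neq0 sqrt_gap_gt0) h.
  have /rowP /(_ 0) := h2; rewrite !mxE h -mulrN => /(mulfI (lt0r_neq0 sqrt_2gap_gt0)) H.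
  by exfalso; move: H; rewrite /sgn; case: (e 0); lra.
Qed.

Lemma sign_choice (w : 'I_q -> C) (c : R) : (forall j, w j ^+ 2 = rc c ^+ 2) ->
  exists e : {ffun 'I_q -> bool}, forall j, w j = rc (c * sgn (e j)).
Proof.
move=> h; exists [ffun j => w j == rc c] => j; rewrite ffunE.
have /eqP := h j; rewrite eqf_sqr; case: eqP => [-> _|_ /= /eqP ->].
  by rewrite /sgn mulr1.
by rewrite /sgn mulrN1 rmorphN.
Qed.

Definition flip (e : {ffun 'I_q -> bool}) : {ffun 'I_q -> bool} := [ffun j => ~~ e j].

(** The equations of [cross_tangent_iff] and [v.v = 1] fix the squares of all
the coordinates of [p] and [v]; every choice of signs is one of the listed
lines, after a change of sign of [v] if needed. *)
Lemma cross_line_surj L : common_tangents cross L -> exists i, L = cross_line i.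
Proof.
move=> [p [v [v0 -> T]]].
have vv0 : dot v v != 0.
  apply/negP => /eqP h.
  have T' i : dot v (p - toC (center cross i)) = 0.
    by apply/eqP; rewrite -sqrf_eq0; apply/eqP; rewrite (T i) h mul0r.
  have vj j : v 0 (lift 0 j) = 0.
    have := T' (lshift q j); have := T' (rshift q j).
    rewrite cross_center_pos cross_center_neg !toC_consr rmorph0 !dotDr !dotNr.
    rewrite {2 4}(consr_eta v) !dot_consr mulr0 !add0r toC_delta dot_delta.
    have -> : toC (- delta_mx 0 j : 'rV[R]_q) = - delta_mx 0 j.
      by rewrite -toC_delta; apply/rowP => l; rewrite !mxE rmorphN.
    rewrite dotNr dot_delta mxE opprK => /eqP; rewrite addr_eq0 => /eqP -> /eqP.
    by rewrite -opprD oppr_eq0 -mulr2n mulrn_eq0 => /eqP.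
  move: v0; apply/negP; rewrite negbK; apply/eqP; apply: eq_consr => [|j]; rewrite mxE //.
  apply/eqP; rewrite -sqrf_eq0 -h /dot big_ord_recl -expr2 big1 ?addr0 // => j _.
  by rewrite vj mulr0.
have [w [u [u1 wu -> tan]]] := normalize 0 p vv0; rewrite add0r in tan *.
have {T} H := (cross_tangent_iff u1 wu).1 (fun i => tan _ _ (T i)).
have wE : w = consr (w 0 0) 0.
  by apply: eq_consr => [|j]; rewrite ?consr0 ?consrS // mxE; case: (H j).
have uE := consr_eta u.
have u2 : u 0 0 ^+ 2 + q%:R * (w 0 0 ^+ 2 + rc gap) = 1.
  rewrite -[RHS]u1 /dot big_ord_recl -expr2; congr (_ + _).
  rewrite [RHS](eq_bigr (fun=> w 0 0 ^+ 2 + rc gap)) ?sumr_const ?card_ord ?mulr_natl // => j _.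
  by rewrite -expr2; case: (H j).
have qg : q%:R * rc gap = 2%:R^-1.
  by rewrite -(rmorph_nat rc) -rmorphM qgap fmorphV rmorph_nat.
have w0u0 : w 0 0 * u 0 0 = 0.
  by have := wu; rewrite {1}wE {1}uE dot_consr dot0l addr0.
have qn0 : (q%:R : C) != 0 by rewrite pnatr_eq0.
have toCsv (c : R) e : toC (c *: sign_row e) = \row_j rc (c * sgn (e j)).
  by apply/rowP => j; rewrite !mxE.
have svflip e : sign_row (flip e) = - sign_row e.
  by apply/rowP => j; rewrite !mxE ffunE sgn_neg.
have toCN n (y : 'rV[R]_n) : toC (- y) = - toC y.
  by apply/rowP => j; rewrite !mxE rmorphN.
have toC0 n : toC (0 : 'rV[R]_n) = 0 by apply/rowP => j; rewrite !mxE rmorph0.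
have [u00|u00] := eqVneq (u 0 0) 0.
  have wsq : w 0 0 ^+ 2 = rc gap.
    have E : q%:R * w 0 0 ^+ 2 + 2%:R^-1 = 1.
      by rewrite -[RHS]u2 u00 expr0n add0r mulrDr qg.
    by apply: (mulfI qn0); apply: (addIr 2%:R^-1); rewrite E qg; field.
  have [e he] : exists e : {ffun 'I_q -> bool}, forall j, u 0 (lift 0 j) =
    rc (sqrt_2gap * sgn (e j)).
    apply: sign_choice => j; have [_ ->] := H j;
      rewrite wsq -rmorphXn /= sqrt_2gap_sq rmorphM rmorph_nat; ring.
  have uE' : u = toC (consr 0 (sqrt_2gap *: sign_row e)).
    rewrite toC_consr rmorph0 toCsv {1}uE u00; congr consr; apply/rowP => j.
    by rewrite !mxE he.
  have wE' : w 0 0 = rc (sgn (e 0) * sqrt_gap) \/ w 0 0 = - rc (sgn (e 0) * sqrt_gap).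
    have : w 0 0 ^+ 2 == rc (sgn (e 0) * sqrt_gap) ^+ 2.
      by rewrite wsq -rmorphXn /= exprMn sgn_sq mul1r sqrt_gap_sq.
    by rewrite eqf_sqr => /orP [] /eqP h; [left|right].
  case: wE' => h.
    by exists (false, e); rewrite /cross_line /line_point /line_dir /= -uE' toC_consr -h toC0 -wE.
  exists (false, flip e); rewrite /cross_line /line_point /line_dir /= svflip scalerN ffunE
    sgn_neg mulNr.
  rewrite toC_consr rmorphN /= -h toC0 -wE -[LHS]cline_opp uE' -toCN consrN oppr0 //.
have w00 : w 0 0 = 0 by move/eqP: w0u0; rewrite mulf_eq0 (negPf u00) orbF => /eqP.
have w0 : w = 0 by apply: eq_consr => [|j]; rewrite mxE //; case: (H j).
have usq : u 0 0 ^+ 2 = rc sqrt_half ^+ 2.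
  have E : u 0 0 ^+ 2 + 2%:R^-1 = 1 by rewrite -[RHS]u2 w00 expr0n add0r qg.
  rewrite -rmorphXn /= sqrt_half_sq fmorphV rmorph_nat.
  by apply: (addIr 2%:R^-1); rewrite E; field.
have [e he] : exists e : {ffun 'I_q -> bool}, forall j, u 0 (lift 0 j) =
  rc (sqrt_gap * sgn (e j)).
  by apply: sign_choice => j; have [_ ->] := H j;
    rewrite w00 expr0n add0r -rmorphXn /= sqrt_gap_sq.
have /eqP := usq; rewrite eqf_sqr => /orP [] /eqP h.
  have uE' : u = toC (consr sqrt_half (sqrt_gap *: sign_row e)).
    by rewrite toC_consr -h toCsv {1}uE; congr consr; apply/rowP => j; rewrite !mxE he.
  by exists (true, e); rewrite /cross_line /line_point /line_dir /= toC0 w0 -uE'.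
have uE' : u = - toC (consr sqrt_half (sqrt_gap *: sign_row (flip e))).
  rewrite svflip scalerN toC_consr toCN toCsv consrN opprK -h {1}uE; congr consr.
  by apply/rowP => j; rewrite !mxE he.
by exists (true, flip e); rewrite /cross_line /line_point /line_dir /= toC0 w0 uE' cline_opp.
Qed.

Theorem cross_polytope_tangents : exists x : config R (q + q) q.+1,
     [/\ forall i, 0 < radius x i,
         injective (fun i => (center x i, radius x i)),
         affinely_dependent x
       & (common_tangents x `&` @real_line R q.+1) #= `I_(2 ^ q.+1)%N].
Proof.
exists cross; split.
- by move=> i; rewrite cross_radius sqrtr_gt0 subr_gt0 gap_lt1.
- by move=> i j [/cross_center_inj].
- exact: cross_dep.
have -> : (2 ^ q.+1)%N = #|{: bool * {ffun 'I_q -> bool}}|.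
  by rewrite card_prod card_ffun card_bool card_ord expnS.
apply: (card_eq_fin cross_line_inj) => L; split=> [[/cross_line_surj] //|[i ->]].
exact: cross_line_tangent.
Qed.

End CrossPolytope.

Theorem theorem7 (R : realType) (n : nat) (hn : (4 <= n)%N) :
  (exists U : set (config R (2 * n - 2)%N n),
     [/\ zariski_open_in (@dependent_configs R (2 * n - 2)%N n) U,
         U !=set0,
         zariski_dense_in (@dependent_configs R (2 * n - 2)%N n) U
       & forall x, U x -> common_tangents x #= `I_(3 * 2 ^ (n - 1))%N])
  /\
  (exists x : config R (2 * n - 2)%N n,
     [/\ forall i, 0 < radius x i,
         injective (fun i => (center x i, radius x i)),
         affinely_dependent x
       & (common_tangents x `&` @real_line R n) #= `I_(2 ^ n)%N]).
Proof.
case: n hn => [|[|[|[|k]]]] // _.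
have [e1 e2] : (2 * k.+4 - 2 = 1 + (k.+3 + k.+2))%N /\ (2 * k.+4 - 2 = k.+3 + k.+3)%N.
  by split; lia.
split.
  rewrite e1; have -> : (3 * 2 ^ (k.+4 - 1) = 2 ^ k.+1 * 12)%N.
    by rewrite subn1 /= !expnS; lia.
  exact: generic_number_of_tangents.
rewrite e2; exact: cross_polytope_tangents.
Qed.
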